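(* Assume the Lipschitz-Hessian condition, the ETO consistency conditions and the ETO regularity conditions (listed in the context), and that $\nabla_{\theta\theta}v_0(w_{\theta^{KL}})\ge0$. Let $\lambda_1\ge\dots\ge\lambda_q\ge0$ be the eigenvalues of $\frac12M_1^{ETO}\nabla_{\theta\theta}v_0(w_{\theta^{KL}})M_1^{ETO}$, and assume the quantities raised to negative powers below are nonzero. Then for all $t>0$, $$\Big|\mathbb P\Big(n\big(v_0(\hat w^{ETO})-v_0(w_{\theta^{KL}})-\nabla_\theta v_0(w_{\theta^{KL}})(\hat\theta^{ETO}-\theta^{KL})\big)\ge t\Big)-\mathbb P(\mathbb G^{ETO}\ge t)\Big|\lesssim D^{ETO}_{n,q},$$ where $D^{ETO}_{n,q}$ is independent of $t$ and satisfies: when $q=1$, $$D^{ETO}_{n,1}\lesssim\frac1{\sqrt{\lambda_1}}L_1^{1/2}\|M_1^{ETO}\|^{3/2}(\log n)^{3/4}n^{-1/4}+C^{ETO}_{n,1},$$ and when $q\ge2$, $$D^{ETO}_{n,q}\lesssim C^{ETO}_{n,q}+\Big(\Big(\sum_{i=1}^q\lambda_i^2\Big)\Big(\sum_{i=2}^q\lambda_i^2\Big)\Big)^{-1/4}L_1\|M_1^{ETO}\|^3q^{3/2}(\log n)^{3/2}n^{-1/2}.$$ Here $\lesssim$ hides constants independent of $n$ and $q$.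
   Context: Setup. $\Omega\subset\mathbb R^p$ and $\Theta\subset\mathbb R^q$ are open, $\mathcal Z\subset\mathbb R^d$, $c:\Omega\times\mathcal Z\to\mathbb R$ is a known cost function, $P$ is the (unknown) true distribution of a random vector $z\in\mathcal Z$, and $\{P_\theta:\theta\in\Theta\}$ is a parametric family of distributions on $\mathcal Z$ with densities $p_\theta$; $P$ need not belong to the family. $v_0(w):=\mathbb E_P[c(w,z)]$. For $\theta\in\Theta$, $w_\theta\in\arg\min_{w\in\Omega}\mathbb E_{P_\theta}[c(w,z)]$. The data $z_1,\dots,z_n$ are i.i.d. from $P$. $\hat\theta^{ETO}$ maximizes $\frac1n\sum_{i=1}^n\log p_\theta(z_i)$ over $\Theta$, $\hat w^{ETO}:=w_{\hat\theta^{ETO}}$, $\theta^{KL}:=\arg\max_{\theta\in\Theta}\mathbb E_P[\log p_\theta(z)]$; all optimizers are assumed to exist. Notation. Gradients are row vectors. $\nabla_\theta v_0(w_{\theta'})$, $\nabla_{\theta\theta}v_0(w_{\theta'})$ are the gradient and Hessian of $\theta\mapsto v_0(w_\theta)$ at $\theta'$. $\|\cdot\|$ is the Euclidean/spectral norm; for a random vector $X$, $\|X\|_r:=(\mathbb E\|X\|^r)^{1/r}$. $A\le B$ for symmetric matrices means $B-A$ is positive semidefinite; $(\cdot)^{1/2}$ is the positive semidefinite square root. $Y_0\sim N(0,I_q)$, $M_1^{ETO}:=\big((\nabla_{\theta\theta}\mathbb E_P[\log p_{\theta^{KL}}(z)])^{-1}\mathrm{var}_P(\nabla_\theta\log p_{\theta^{KL}}(z))(\nabla_{\theta\theta}\mathbb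 E_P[\log p_{\theta^{KL}}(z)])^{-1}\big)^{1/2}$ ($\mathrm{var}_P$ = covariance under $P$), $\mathbb G^{ETO}:=\frac12Y_0^\top M_1^{ETO}\nabla_{\theta\theta}v_0(w_{\theta^{KL}})M_1^{ETO}Y_0$. Lipschitz-Hessian condition: $\Theta$ is bounded and $\|\nabla_{\theta\theta}v_0(w_{\theta_1})-\nabla_{\theta\theta}v_0(w_{\theta_2})\|\le L_1\|\theta_1-\theta_2\|$ for all $\theta_1,\theta_2\in\Theta$. ETO consistency conditions: $\sup_{\theta\in\Theta}|\frac1n\sum_i\log p_\theta(z_i)-\mathbb E_P[\log p_\theta(z)]|\xrightarrow{P}0$; for all $\varepsilon>0$, $\sup_{\theta\in\Theta:\|\theta-\theta^{KL}\|\ge\varepsilon}\mathbb E_P[\log p_\theta(z)]<\mathbb E_P[\log p_{\theta^{KL}}(z)]$. ETO regularity conditions: with $m(\theta,z)=-\log p_\theta(z)$ and $\bar\theta=\theta^{KL}$, $m(\cdot,z)$ is twice differentiable in $\theta$, and there are constants $\mu,c_1,c_2,c_4,\underline\lambda_1,\underline\lambda_2>0$, $c_3\ge0$ and nonnegative functions $K_1,K_2,K_3$ on $\mathcal Z$ with $\|K_1(z)\|_9\le c_1$, $\|K_2(z)\|_4\le c_2$, $\|K_3(z)\|_4\le c_3$ such that for all $\theta\in\Theta$, $z\in\mathcal Z$: $\mathbb E_P[m(\theta,z)]-\mathbb E_P[m(\bar\theta,z)]\ge\mu\|\theta-\bar\theta\|^2$; $|m(\theta,z)-m(\bar\theta,z)|\le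 K_1(z)\|\theta-\bar\theta\|$; $\|\nabla_{\theta\theta}m(\theta,z)-\nabla_{\theta\theta}m(\bar\theta,z)\|\le K_2(z)\|\theta-\bar\theta\|$; $\nabla_{\theta\theta}m(\bar\theta,z)\le K_3(z)I$; $\lambda_{\min}(\mathbb E_P[\nabla_\theta m(\bar\theta,z)^\top\nabla_\theta m(\bar\theta,z)])\ge\underline\lambda_1$; $\lambda_{\min}(\nabla_{\theta\theta}\mathbb E_P[m(\bar\theta,z)])\ge\underline\lambda_2$; $\|\nabla_\theta m(\bar\theta,z)\|_4\le c_4\sqrt q$. Berry–Esseen error term: $C^{ETO}_{n,q}:=C^{ETO}q^{9/4}n^{-1/2}$, where $C^{ETO}$ is a constant depending only on $c_1,\dots,c_4,\mu,\underline\lambda_1,\underline\lambda_2$ such that $|\mathbb P(\sqrt n(\hat\theta^{ETO}-\theta^{KL})\in A)-\mathbb P(M_1^{ETO}Y_0\in A)|\le C^{ETO}_{n,q}$ for all $n$ and all convex $A\subset\mathbb R^q$. *)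

(* Defs.v *)
From HB Require Import structures.
From mathcomp Require Export all_boot all_order all_algebra.
From mathcomp Require Export all_classical all_reals all_analysis.
Export numFieldNormedType.Exports.

Set Implicit Arguments.
Unset Strict Implicit.
Unset Printing Implicit Defensive.

Import Order.TTheory GRing.Theory Num.Theory.

Local Open Scope classical_set_scope.
Local Open Scope ring_scope.

(* R^n (column vectors) with its Borel sigma-algebra. *)
Notation borelV R n := (g_sigma_algebraType (@open 'cV[R]_n)).

Section linear_algebra.
Context {R : realType}.

(* The library norm on matrices is the sup norm (same topology). *)
Definition enorm n (v : 'cV[R]_n) : R := Num.sqrt (\sum_i v i 0 ^+ 2).

Definition opnorm m n (A : 'M[R]_(m, n)) : R :=
  sup [set enorm (A *m x) | x in [set x : 'cV[R]_n | enorm x <= 1]].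

Definition psdmx n (A : 'M[R]_n) : Prop :=
  A^T = A /\ forall x : 'cV[R]_n, 0 <= (x^T *m A *m x) 0 0.

Definition is_psd_sqrt n (B A : 'M[R]_n) : Prop := psdmx B /\ B *m B = A.

(* The smallest eigenvalue, for a symmetric matrix of positive size. *)
Definition lambda_min n (A : 'M[R]_n) : R := inf [set a | eigenvalue A a].

(* Eigenvalues counted with multiplicity, largest first. *)
Definition is_spectrum n (A : 'M[R]_n) (lam : n.-tuple R) : Prop :=
  sorted >=%R lam /\ char_poly A = \prod_(l <- lam) ('X - l%:P).

End linear_algebra.

Section calculus.
Context {R : realType}.

Definition grad n (f : 'cV[R]_n -> R) (a : 'cV[R]_n) : 'rV[R]_n :=
  \row_i 'D_(delta_mx i 0) f a.

Definition hess n (f : 'cV[R]_n -> R) (a : 'cV[R]_n) : 'M[R]_n :=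
  \matrix_(i, j) 'D_(delta_mx j 0) (fun x => grad f x 0 i) a.

Definition twice_differentiable n (f : 'cV[R]_n -> R) (a : 'cV[R]_n) : Prop :=
  (\forall x \near a, differentiable f x) /\ differentiable (grad f) a.

(* Th is star-shaped about a within distance rho: such a rho exists at each
   point of an open set (open_star_within), and every rho is suitable when Th
   is convex (convex_star_within). *)
Definition star_within n (Th : set 'cV[R]_n) (a : 'cV[R]_n) (rho : R) : Prop :=
  forall x, Th x -> enorm (x - a) < rho ->
  forall s, 0 <= s <= 1 -> Th (a + s *: (x - a)).

Lemma ler_enorm n (v : 'cV[R]_n) : `|v| <= enorm v.
Proof.
have v0 : 0 <= enorm v by exact: sqrtr_ge0.
have H i : `|v i 0| <= enorm v.
  rewrite -sqrtr_sqr ler_sqrt ?sumr_ge0// => [|? _]; last exact: sqr_ge0.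
  by rewrite (bigD1 i)//= lerDl sumr_ge0// => ? _; exact: sqr_ge0.
rewrite /Num.norm/= mx_normrE; apply/bigmax_leP; split => // -[i j] _ /=.
by rewrite (ord1 j); exact: H.
Qed.

Lemma open_star_within n (Th : set 'cV[R]_n) (a : 'cV[R]_n) :
  open Th -> Th a -> exists2 rho, 0 < rho & star_within Th a rho.
Proof.
move=> oTh Tha; have /nbhs_ballP[e e0 eTh] : nbhs a Th by exact: open_nbhs_nbhs.
exists e => // x _ xe s /andP[s0 s1]; apply: eTh.
rewrite -ball_normE /ball_/= opprD addNKr normrN normrZ ger0_norm//.
by apply: le_lt_trans xe; apply: le_trans (ler_enorm _); rewrite ler_piMl.
Qed.

Lemma convex_star_within n (Th : set 'cV[R]_n) (a : 'cV[R]_n) rho :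
  convex_set Th -> Th a -> star_within Th a rho.
Proof.
move=> cTh Tha x Thx _ s /andP[s0 s1].
have := cTh x a (Itv01 s0 s1) (mem_set Thx) (mem_set Tha).
rewrite inE; congr (Th _).
rewrite /conv/= scalerBl scale1r scalerBr.
by rewrite addrC -addrA; congr (_ + _); rewrite addrC.
Qed.

End calculus.

Section probability.
Local Open Scope ereal_scope.
Context {R : realType}.

(* Z_0, Z_1, ... are independent with common law P; letting some of the B i be
   setT yields independence of every finite subfamily. *)
Definition iid_from d (T : measurableType d) d' (U : measurableType d')
    (Pr : probability T R) (Z : nat -> T -> U) (P : probability U R) : Prop :=
  forall (n : nat) (B : nat -> set U), (forall i, measurable (B i)) ->
    Pr [set om | forall i, (i < n)%N -> B i (Z i om)] = \prod_(i < n) P (B i).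

(* Y is distributed as N(0, I_n): independent standard normal coordinates. *)
Definition std_gaussian d (T : measurableType d) (Pr : probability T R) n
    (Y : T -> 'cV[R]_n) : Prop :=
  forall B : 'I_n -> set R, (forall i, measurable (B i)) ->
    Pr [set om | forall i, B i (Y om i 0%R)] =
    \prod_(i < n) normal_prob 0%R 1%R (B i).

End probability.

(* The densities are taken with respect to an arbitrary sigma-finite reference
   measure on the sample space. Functions of w, theta or z are total; only
   their values on Omega, Theta, Zset matter. *)
Record eto_problem (R : realType) (p q d : nat) := EtoProblem {
  Omega : set 'cV[R]_p;
  Theta : set 'cV[R]_q;
  Zset : set (borelV R d);
  cost : 'cV[R]_p -> borelV R d -> R;
  Ptrue : probability (borelV R d) R;
  refm : {sigma_finite_measure set (borelV R d) -> \bar R};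
  dens : 'cV[R]_q -> borelV R d -> R;
  Pmodel : 'cV[R]_q -> probability (borelV R d) R;
  wopt : 'cV[R]_q -> 'cV[R]_p;
  thetaKL : 'cV[R]_q }.

Definition BE_rate (R : realType) (C : R) (n q : nat) : R :=
  C * q%:R `^ (9 / 4) * n%:R `^ (- 2^-1).

Section ETO.
Context {R : realType} {p q d : nat}.
Variable S : eto_problem R p q d.

Definition EP (f : borelV R d -> R) : R := \int[Ptrue S]_(z in Zset S) f z.

Definition v0 (w : 'cV[R]_p) : R := EP (cost S w).

Definition v0w (theta : 'cV[R]_q) : R := v0 (wopt S theta).

Definition logp (theta : 'cV[R]_q) (z : borelV R d) : R := ln (dens S theta z).

Definition loss (theta : 'cV[R]_q) (z : borelV R d) : R := - logp theta z.

Definition normP (r : R) (f : borelV R d -> R) : \bar R :=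
  'N[Ptrue S]_(r%:E)[(EFin \o f) \_ (Zset S)].

(* Positivity of the densities makes log p_theta real-valued. *)
Definition eto_setting : Prop :=
  [/\ [/\ open (Omega S), open (Theta S), measurable (Zset S)
        & Ptrue S (Zset S) = 1%E],
      forall theta, Theta S theta ->
        [/\ measurable_fun (Zset S) (dens S theta),
            forall z, Zset S z -> 0 < dens S theta z,
            Pmodel S theta (Zset S) = 1%E
          & forall A, measurable A -> A `<=` Zset S ->
              Pmodel S theta A = (\int[refm S]_(z in A) (dens S theta z)%:E)%E],
      forall w, Omega S w ->
        (Ptrue S).-integrable (Zset S) (EFin \o cost S w) /\
        forall theta, Theta S theta ->
          (Pmodel S theta).-integrable (Zset S) (EFin \o cost S w),
      forall theta, Theta S theta ->
        Omega S (wopt S theta) /\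
        forall w, Omega S w ->
          \int[Pmodel S theta]_(z in Zset S) cost S (wopt S theta) z <=
          \int[Pmodel S theta]_(z in Zset S) cost S w z
    & [/\ forall theta, Theta S theta ->
          (Ptrue S).-integrable (Zset S) (EFin \o logp theta),
        Theta S (thetaKL S)
      & forall theta, Theta S theta -> EP (logp theta) <= EP (logp (thetaKL S))]].

Definition avg_logp (T : Type) (Z : nat -> T -> borelV R d) (n : nat) (om : T)
    (theta : 'cV[R]_q) : R :=
  n%:R^-1 * \sum_(i < n) logp theta (Z i om).

Definition is_mle (T : Type) (Z : nat -> T -> borelV R d)
    (that : nat -> T -> 'cV[R]_q) : Prop :=
  forall n om, (0 < n)%N -> Theta S (that n om) /\
    forall theta, Theta S theta ->
      avg_logp Z n om theta <= avg_logp Z n om (that n om).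

Definition lipschitz_hessian (L1 : R) : Prop :=
  [/\ bounded_set (Theta S),
      forall theta, Theta S theta -> twice_differentiable v0w theta
    & forall th1 th2, Theta S th1 -> Theta S th2 ->
        opnorm (hess v0w th1 - hess v0w th2) <= L1 * enorm (th1 - th2)].

Definition eto_consistency dT (T : measurableType dT) (Pr : probability T R)
    (Z : nat -> T -> borelV R d) : Prop :=
  let dev n om := ereal_sup
    [set (`|avg_logp Z n om theta - EP (logp theta)|)%:E | theta in Theta S] in
  let far eps := [set th | Theta S th /\ eps <= enorm (th - thetaKL S)] in
  (forall eps : R, 0 < eps ->
     (fun n => Pr [set om | (eps%:E < dev n om)%E]) @ \oo --> 0%E) /\
  (forall eps : R, 0 < eps ->
     (ereal_sup [set (EP (logp theta))%:E | theta in far eps] < (EP (logp (thetaKL S)))%:E)%E).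

Definition second_moment (g : borelV R d -> 'rV[R]_q) : 'M[R]_q :=
  \matrix_(i, j) EP (fun z => g z 0 i * g z 0 j).

Definition varP (g : borelV R d -> 'rV[R]_q) : 'M[R]_q :=
  \matrix_(i, j) EP (fun z => (g z 0 i - EP (fun z' => g z' 0 i)) *
                              (g z 0 j - EP (fun z' => g z' 0 j))).

Definition eto_regularity (mu c1 c2 c3 c4 lam1 lam2 : R) : Prop :=
  let thb := thetaKL S in
  let gradm theta z := grad (loss^~ z) theta in
  let hessm theta z := hess (loss^~ z) theta in
  let risk theta := EP (loss theta) in
  exists K1 K2 K3 : borelV R d -> R,
  [/\ forall z, Zset S z -> [/\ 0 <= K1 z, 0 <= K2 z & 0 <= K3 z],
      [/\ measurable_fun (Zset S) K1, measurable_fun (Zset S) K2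
        & measurable_fun (Zset S) K3],
      [/\ normP 9 K1 <= c1%:E, normP 4 K2 <= c2%:E & normP 4 K3 <= c3%:E]%E,
      [/\ forall theta z, Theta S theta -> Zset S z ->
            [/\ twice_differentiable (loss^~ z) theta,
                `|loss theta z - loss thb z| <= K1 z * enorm (theta - thb)
              & opnorm (hessm theta z - hessm thb z)
                <= K2 z * enorm (theta - thb)],
          forall theta, Theta S theta ->
            mu * enorm (theta - thb) ^+ 2 <= risk theta - risk thb
        & forall z, Zset S z -> psdmx ((K3 z)%:M - hessm thb z)]
    & [/\ lam1 <= lambda_min (second_moment (gradm thb)),
          twice_differentiable risk thb,
          lam2 <= lambda_min (hess risk thb)
        & (normP 4 (fun z => enorm (gradm thb z)^T)
           <= (c4 * Num.sqrt q%:R)%:E)%E]].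

Definition is_M1 (M1 : 'M[R]_q) : Prop :=
  let H := hess (fun theta => EP (logp theta)) (thetaKL S) in
  let V := varP (fun z => grad (logp^~ z) (thetaKL S)) in
  is_psd_sqrt M1 (invmx H *m V *m invmx H).

Definition G_form (M1 : 'M[R]_q) (y : 'cV[R]_q) : R :=
  2^-1 * (y^T *m M1 *m hess v0w (thetaKL S) *m M1 *m y) 0 0.

Definition linearized_regret (theta : 'cV[R]_q) : R :=
  v0w theta - v0w (thetaKL S)
  - (grad v0w (thetaKL S) *m (theta - thetaKL S)) 0 0.

(* Probabilities are compared on Borel convex sets only: a convex set need
   not be Borel. *)
Definition berry_esseen dT (T : measurableType dT) (Pr : probability T R)
    (that : nat -> T -> 'cV[R]_q) dY (TY : measurableType dY)
    (PrY : probability TY R) (Y0 : TY -> 'cV[R]_q) (M1 : 'M[R]_q) (C : R)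
    : Prop :=
  forall (n : nat) (A : set 'cV[R]_q), (0 < n)%N ->
    convex_set A -> measurable (A : set (borelV R q)) ->
    `|fine (Pr [set om | A (Num.sqrt n%:R *: (that n om - thetaKL S))])
      - fine (PrY [set om | A (M1 *m Y0 om)])| <= BE_rate C n q.

End ETO.

(* Main.v *)
(* A Taylor expansion turns n times the linearized regret into Q (sqrt n (theta^ - theta^KL)),
   where Q x = x^T H x / 2, with an error at most eps = L1 r^3 / sqrt n as long as
   sqrt n (theta^ - theta^KL) stays in the ball of radius r = |M1| (4 q ln n)^(1/2). The
   Berry-Esseen bound, applied to the sublevel sets of Q and to balls, moves everything to
   the Gaussian vector M1 Y0; what remains are Gaussian tails and the probability that
   Q (M1 Y0) falls in a window of length eps.
   Quadratic growth of the risk makes its Hessian coercive, hence the Frobenius norm of M1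
   is at most c4 q^(1/2) / mu, and the tails are O (q^2 n^(-1/2)).
   For the window, rotations diagonalize Q (M1 Y0) into sum_i lam_i Y_i^2. When q = 1 the
   bounded density of Y_1 gives 2 (eps / lam_1)^(1/2). When q >= 2 the window is dominated by
   a Cauchy kernel. Polar coordinates in (Y_1, Y_2) either bound its expectation by
   O (eps (lam_1 lam_2)^(-1/2)) directly, or, when no single eigenvalue dominates
   sum_(i >= 2) lam_i^2, through the characteristic function of the remaining sum, whose
   decay is quadratic because consecutive eigenvalues are paired. *)
Require Import Defs.
From HB Require Import structures.
From mathcomp Require Import ring lra zify measurable_realfun.
Import Order.TTheory GRing.Theory Num.Theory.
Set Implicit Arguments.
Unset Strict Implicit.
Unset Printing Implicit Defensive.
Local Open Scope classical_set_scope.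
Local Open Scope ring_scope.

(** The characteristic function of a single pair of chi-squares decays like 1/t, which is not
    integrable, and that of the later pairs does not see lam_1. Hence the first pair always stays in
    polar coordinates, and the transform is applied to the rest only when none of its pairs carries
    more than half of the energy. The bounds at a fixed slope tau combine into C / (a + b tau^2),
    whose integral C pi / sqrt (a b) is the origin of the power -1/4. The Cauchy kernel serves both
    routes: its primitive is atan, and it is the cosine transform of the exponential density.
    Cosines occur only as 1 + cos, so that every integrand is nonnegative and Tonelli's theorem
    suffices. The Taylor estimate is available only within distance rho of theta^KL, so sqrt n
    (theta^ - theta^KL) must also stay in a ball of radius rho sqrt n. The tail for this second ball
    may not bring M1 into the constants, which is the purpose of the Frobenius bound. Both tails are
    absorbed in the Berry-Esseen term, because q^2 <= q^(9/4), at the cost of a factor 1/C. *)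

(** * Improper integrals and the standard normal density *)

Section lebesgue_affine.
Context {R : realType}.
Local Notation mu := (@lebesgue_measure R).

Definition image_measure d d' (T : measurableType d) (T' : measurableType d')
    (m : {measure set T -> \bar R}) (f : T -> T')
    (mf : measurable_fun [set: T] f) : {measure set T' -> \bar R} :=
  measure_function_pushforward__canonical__measure_function_Measure m mf.

Lemma image_measureE d d' (T : measurableType d) (T' : measurableType d')
    (m : {measure set T -> \bar R}) (f : T -> T')
    (mf : measurable_fun [set: T] f) A : image_measure m mf A = m (f @^-1` A).
Proof. by []. Qed.

Lemma measurable_affine (a b : R) :
  measurable_fun [set: measurableTypeR R]
    ((fun x => a * x + b) : measurableTypeR R -> measurableTypeR R).
Proof.
by apply: (@measurable_funD _ (measurableTypeR R)) => //; exact: measurable_funM.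
Qed.

Let affine_measure (a b : R) (a0 : 0 < a) :
    {measure set (measurableTypeR R) -> \bar R} :=
  mscale (NngNum (ltW a0)) (image_measure mu (measurable_affine a b)).

(** Lebesgue measure is determined by half-open intervals, and the preimage of such an interval
    under x -> a x + b is shorter by the factor a. *)
Let affine_measureE (a b : R) (a0 : 0 < a) (A : set R) :
  measurable A -> mu A = affine_measure b a0 A.
Proof.
move=> mA; apply: lebesgue_measure_unique => // X [[x y] _ <-].
rewrite /affine_measure/= /mscale/= /pushforward.
have -> : (fun x : measurableTypeR R => a * x + b) @^-1` `]x, y] =
    `](x - b) / a, (y - b) / a]%classic.
  apply/seteqP; split => z /=; rewrite !in_itv/= => /andP[].
    by move=> h1 h2; rewrite ltr_pdivrMr// ler_pdivlMr//; apply/andP; split; lra.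
  rewrite ltr_pdivrMr// ler_pdivlMr// => h1 h2.
  by apply/andP; split; lra.
rewrite !lebesgue_measure_itv/= !lte_fin ltr_pM2r ?invr_gt0// ltrD2r.
case: ifPn => _; last by rewrite mule0.
rewrite -!EFinB -EFinM; congr EFin; field.
by rewrite gt_eqF.
Qed.

Lemma ge0_integral_affine (a b : R) (f : R -> \bar R) : 0 < a ->
  measurable_fun [set: R] f -> (forall x, 0 <= f x)%E ->
  (\int[mu]_x f x = a%:E * \int[mu]_x f (a * x + b)%R)%E.
Proof.
move=> a0 mf f0.
have -> : (\int[mu]_x f x = \int[affine_measure b a0]_x f x)%E.
  by apply: eq_measure_integral => A mA _; exact: affine_measureE.
rewrite ge0_integral_mscale//= ge0_integral_pushforward//.
exact: measurable_affine.
Qed.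

End lebesgue_affine.

Section improper_integrals.
Context {R : realType}.
Local Notation mu := (@lebesgue_measure R).
Implicit Types (h H : R -> R).

Lemma continuous_measurable_EFin (f : R -> R) (D : set R) :
  continuous f -> measurable_fun D (fun x => (f x)%:E).
Proof.
move=> cf; apply: measurable_funTS; apply/measurable_EFinP.
exact: continuous_measurable_fun.
Qed.

Lemma is_derive1_continuous (F : R -> R) (x d : R) :
  is_derive x 1 F d -> {for x, continuous F}.
Proof.
by move=> dF; apply/differentiable_continuous/derivable1_diffP; case: dF.
Qed.

Lemma ge0_integral_halfline h H (a l : R) :
  continuous h -> (forall x, 0 <= h x) ->
  (forall x : R, is_derive x 1 H (h x)) -> H x @[x --> +oo] --> l ->
  (\int[mu]_(x in `[a, +oo[) (h x)%:E = (l - H a)%:E)%E.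
Proof.
move=> ch h0 dH Hl; rewrite (ge0_continuous_FTC2y _ _ Hl) ?EFinB//.
- exact: continuous_subspaceT.
- by apply: cvg_at_right_filter; exact: is_derive1_continuous (dH a).
- by move=> x _; rewrite derive1E; exact: derive_val.
Qed.

(** The integrand is the derivative of H (k x^2 + w), so the fundamental theorem of calculus
    replaces a change of variables. *)
Lemma ge0_integral_sqr_subst h H (k w l : R) : 0 < k ->
  continuous h -> (forall x, 0 <= h x) ->
  (forall x : R, is_derive x 1 H (h x)) -> H x @[x --> +oo] --> l ->
  (\int[mu]_(x in `[0%R, +oo[) (2 * k * x * h (k * x ^+ 2 + w))%:E =
   (l - H w)%:E)%E.
Proof.
move=> k0 ch h0 dH Hl.
pose F x := H (k * x ^+ 2 + w).
have dF (x : R) : is_derive x 1 F (2 * k * x * h (k * x ^+ 2 + w)).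
  have dq : is_derive x 1 (fun x : R => k * x ^+ 2 + w) (2 * k * x).
    by apply: is_derive_eq; rewrite /GRing.scale/=; ring.
  rewrite mulrC; exact: is_derive1_comp.
have Fl : F x @[x --> +oo] --> l.
  apply: cvg_comp Hl.
  have c1 : k * x ^+ 2 @[x --> +oo] --> +oo.
    by apply: gt0_cvgMry => //; exact: cvgr_expr2.
  exact: (cvg_comp _ _ c1 (cvg_addrr w)).
have F0 : F 0 = H w by rewrite /F expr0n/= mulr0 add0r.
rewrite -F0 EFinB; apply: ge0_continuous_FTC2y Fl _ _ _ => //.
- by move=> x x0; rewrite !mulr_ge0// ltW.
- apply: continuous_subspaceT => x.
  have cq : {for x, continuous (fun x : R => k * x ^+ 2 + w)}.
    apply: (@continuousD _ R^o); last exact: cst_continuous.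
    by apply: continuousM; [exact: cst_continuous|exact: exprn_continuous].
  apply: continuousM; first by apply: continuousM => //; exact: cst_continuous.
  exact: (continuous_comp cq (ch _)).
- apply: cvg_at_right_filter.
  exact: is_derive1_continuous (dF 0).
- by move=> x _; rewrite derive1E; exact: derive_val.
Qed.

Lemma continuous_expRN : continuous (fun v : R => expR (- v)).
Proof.
move=> v; apply: (@continuous_comp _ _ _ -%R expR); last exact: continuous_expR.
exact: cvgN.
Qed.

Lemma osc_ge0 (k psi v : R) : 0 <= expR (- v) * (1 + cos (k * v + psi)).
Proof. by rewrite mulr_ge0 ?expR_ge0// -lerBlDl sub0r cos_geN1. Qed.

Lemma continuous_osc (k psi : R) :
  continuous (fun v : R => expR (- v) * (1 + cos (k * v + psi))).
Proof.
move=> v; have ck : {for v, continuous (fun v : R => k * v + psi)}.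
  apply: (@continuousD _ R^o); last exact: cst_continuous.
  by apply: continuousM => //; exact: cst_continuous.
have cc : {for v, continuous (fun v : R => cos (k * v + psi))}.
  exact: (continuous_comp ck (@continuous_cos _ _)).
apply: cvgM; first exact: continuous_expRN.
by apply: cvgD; [exact: cvg_cst|exact: cc].
Qed.

(** The primitive of exp (-v) (1 + cos (k v + psi)) that vanishes at +oo. *)
Definition osc_primitive (k psi v : R) : R :=
  expR (- v) * ((k * sin (k * v + psi) - cos (k * v + psi)) / (1 + k ^+ 2) - 1).

Lemma is_derive_osc_primitive (k psi v : R) :
  is_derive v 1 (osc_primitive k psi) (expR (- v) * (1 + cos (k * v + psi))).
Proof.
have k0 : 1 + k ^+ 2 != 0 by rewrite gt_eqF// ltr_pwDl// sqr_ge0.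
have d1 : is_derive v 1 (fun v : R => k * v + psi) k.
  by apply: is_derive_eq; rewrite /GRing.scale/=; ring.
have d2 : is_derive v 1 (fun v : R => expR (- v)) (- expR (- v)).
  by apply: is_derive_eq; rewrite /GRing.scale/=; ring.
have d3 : is_derive v 1 (fun v : R => sin (k * v + psi)) (cos (k * v + psi) * k).
  exact: is_derive1_comp.
have d4 : is_derive v 1 (fun v : R => cos (k * v + psi)) (- sin (k * v + psi) * k).
  exact: is_derive1_comp.
rewrite /osc_primitive; apply: is_derive_eq.
rewrite /GRing.scale/=; field.
exact: k0.
Qed.

Lemma cvg_osc_primitive (k psi : R) : osc_primitive k psi v @[v --> +oo] --> (0 : R).
Proof.
apply/cvgr0Pnorm_le => e e0.
pose M : R := `|k| + 2.
have M0 : 0 < M by rewrite ltr_wpDl.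
have : \forall v \near +oo, `|expR (- v : R)| <= e / M.
  have eM : 0 < e / M by exact: divr_gt0.
  by have /cvgr0Pnorm_le /(_ _ eM) := @cvgr_expR R.
apply: filterS => v /= ve; rewrite /osc_primitive normrM.
rewrite -[e](divfK (lt0r_neq0 M0)) ler_pM//.
apply: le_trans (ler_normB _ _) _; rewrite normr1 normrM.
have h1 : `|(1 + k ^+ 2)^-1| <= 1 :> R.
  by rewrite ger0_norm ?invr_ge0 ?addr_ge0 ?sqr_ge0// invf_le1 ?ltr_pwDl ?sqr_ge0// lerDl sqr_ge0.
have h2 : `|k * sin (k * v + psi) - cos (k * v + psi)| <= `|k| + 1.
  apply: le_trans (ler_normB _ _) _; apply: lerD; last by rewrite ler_norml cos_geN1 cos_le1.
  by rewrite normrM ler_piMr// ler_norml sin_geN1 sin_le1.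
rewrite /M -[2]/(1 + 1) addrA lerD2r -[leRHS]mulr1; exact: ler_pM.
Qed.

Lemma integral_osc (k psi : R) :
  (\int[mu]_(v in `[0%R, +oo[) (expR (- v) * (1 + cos (k * v + psi)))%:E =
   (1 + (cos psi - k * sin psi) / (1 + k ^+ 2))%:E)%E.
Proof.
rewrite (ge0_integral_halfline _ (@continuous_osc k psi) (@osc_ge0 k psi)
  (@is_derive_osc_primitive k psi) (@cvg_osc_primitive k psi)).
by rewrite sub0r /osc_primitive mulr0 add0r oppr0 expR0; congr EFin; ring.
Qed.

Lemma integral_sqr_osc (kap k psi : R) : 0 < kap ->
  (\int[mu]_(x in `[0%R, +oo[) (2 * kap * x * (expR (- (kap * x ^+ 2)) *
     (1 + cos (k * (kap * x ^+ 2) + psi))))%:E =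
   (1 + (cos psi - k * sin psi) / (1 + k ^+ 2))%:E)%E.
Proof.
move=> kap0; have := @ge0_integral_sqr_subst _ _ kap 0 _ kap0 (@continuous_osc k psi)
  (@osc_ge0 k psi) (@is_derive_osc_primitive k psi) (@cvg_osc_primitive k psi).
under eq_integral do rewrite addr0.
by move->; rewrite sub0r /osc_primitive mulr0 add0r oppr0 expR0; congr EFin; ring.
Qed.

Lemma is_derive_expRN (x : R) :
  is_derive x 1 (fun x : R => - expR (- x)) (expR (- x)).
Proof. by apply: is_derive_eq; rewrite /GRing.scale/=; ring. Qed.

Lemma cvg_expRN_primitive : - expR (- x : R) @[x --> +oo] --> (0 : R).
Proof. by rewrite -oppr0; apply: cvgN; exact: cvgr_expR. Qed.

Lemma integral_expRN :
  (\int[mu]_(x in `[0%R, +oo[) (expR (- x))%:E = 1%:E :> \bar R)%E.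
Proof.
rewrite (ge0_integral_halfline _ continuous_expRN _ is_derive_expRN
  cvg_expRN_primitive); last by move=> x; exact: expR_ge0.
by rewrite oppr0 expR0 sub0r opprK.
Qed.

Lemma oneDsqr_gt0 (x : R) : 0 < 1 + x ^+ 2.
Proof. by rewrite ltr_pwDl// sqr_ge0. Qed.

Lemma continuous_cauchy (e : R) : continuous (fun x : R => (1 + (x / e) ^+ 2)^-1).
Proof.
move=> x.
have c1 : {for x, continuous (fun x : R => x / e)}.
  by apply: cvgM => //; exact: cvg_cst.
have c2 : {for x, continuous (fun x : R => (x / e) ^+ 2)}.
  exact: (continuous_comp c1 (@exprn_continuous _ 2 _)).
apply: cvgV; first by rewrite gt_eqF// oneDsqr_gt0.
by apply: cvgD; [exact: cvg_cst|exact: c2].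
Qed.

Lemma cauchy_ge0 (x : R) : 0 <= (1 + x ^+ 2)^-1.
Proof. by rewrite invr_ge0 ltW// oneDsqr_gt0. Qed.

Lemma is_derive_cauchy (e x : R) : e != 0 ->
  is_derive x 1 (fun x : R => e * atan (x / e)) (1 + (x / e) ^+ 2)^-1.
Proof.
move=> e0; have d1 : is_derive x 1 (fun v : R => v / e) e^-1.
  by apply: is_derive_eq; rewrite /GRing.scale/=; ring.
have d3 : is_derive x 1 (fun v : R => atan (v / e)) ((1 + (x / e) ^+ 2)^-1 * e^-1).
  exact: is_derive1_comp.
apply: is_derive_eq; rewrite /GRing.scale/=; field.
by rewrite e0 gt_eqF// ltr_pwDl ?sqr_ge0// exprn_even_gt0.
Qed.

Lemma cvg_cauchy_primitive (e : R) : 0 < e ->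
  e * atan (x / e) @[x --> +oo] --> e * (pi / 2).
Proof.
move=> e0; apply: cvgM; first exact: cvg_cst.
have c1 : x / e @[x --> +oo] --> +oo.
  apply: gt0_cvgMly; last exact: cvg_id.
  by rewrite invr_gt0.
exact: (@cvg_comp _ _ _ (fun x : R => x / e) atan _ _ _ c1 (@cvgy_atan R)).
Qed.

(** The range of atan has length pi, which makes the bound uniform in the shift w. *)
Lemma integral_sqr_cauchy_le (kap w e : R) : 0 < kap -> 0 < e ->
  (\int[mu]_(x in `[0%R, +oo[) (2 * kap * x * (1 + ((kap * x ^+ 2 + w) / e) ^+ 2)^-1)%:E
    <= (e * pi)%:E)%E.
Proof.
move=> kap0 e0; have en0 : e != 0 by rewrite gt_eqF.
rewrite (ge0_integral_sqr_subst _ kap0 (@continuous_cauchy e) _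
  (fun x => is_derive_cauchy x en0) (cvg_cauchy_primitive e0)).
  rewrite lee_fin -mulrBr ler_pM2l//.
  by have := atan_gtNpi2 (w / e); lra.
by move=> x; exact: cauchy_ge0.
Qed.

Lemma integral_rational (a b : R) : 0 < a -> 0 < b ->
  (\int[mu]_(x in `[0%R, +oo[) ((a + b * x ^+ 2)^-1)%:E
    = (pi / 2 / Num.sqrt (a * b))%:E)%E.
Proof.
move=> a0 b0; pose e := Num.sqrt (a / b).
have e0 : 0 < e by rewrite sqrtr_gt0 divr_gt0.
have en0 : e != 0 by rewrite gt_eqF.
have e2 : e ^+ 2 = a / b by rewrite sqr_sqrtr// divr_ge0// ltW.
have E x : (a + b * x ^+ 2)^-1 = a^-1 * (1 + (x / e) ^+ 2)^-1.
  by rewrite expr_div_n e2 -invfM; congr (_^-1); field; rewrite ?gt_eqF.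
under eq_integral do rewrite E EFinM.
rewrite ge0_integralZl//; last 3 first.
- by apply: continuous_measurable_EFin; exact: continuous_cauchy.
- by move=> x _; rewrite lee_fin cauchy_ge0.
- by rewrite lee_fin invr_ge0 ltW.
rewrite (ge0_integral_halfline _ (@continuous_cauchy e) _
  (fun x => is_derive_cauchy x en0) (cvg_cauchy_primitive e0)); last first.
  by move=> x; exact: cauchy_ge0.
rewrite mul0r atan0 mulr0 subr0 -EFinM; congr EFin.
have -> : Num.sqrt (a * b) = a / e.
  rewrite -[a / e]gtr0_norm ?divr_gt0// -sqrtr_sqr; congr Num.sqrt.
  by rewrite expr_div_n e2; field; rewrite ?gt_eqF.
by field; rewrite ?gt_eqF.
Qed.

End improper_integrals.

(** * Integration against a measure given by a density *)

Section density.
Local Open Scope ereal_scope.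
Context d (T : measurableType d) (R : realType).
Variables (m m' : {measure set T -> \bar R}) (g : T -> R).
Hypothesis mg : measurable_fun [set: T] g.
Hypothesis g0 : forall x, (0 <= g x)%R.
Hypothesis m'E : forall A, measurable A -> m' A = \int[m]_(x in A) (g x)%:E.

Import HBNNSimple.

Let integral_density_nnsfun (h : {nnsfun T >-> R}) :
  \int[m']_x (h x)%:E = \int[m]_x ((h x)%:E * (g x)%:E).
Proof.
under [LHS]eq_integral do rewrite fimfunE -fsumEFin//.
rewrite [LHS]ge0_integral_fsum//; last 2 first.
  - by move=> r; exact/measurable_EFinP/measurableT_comp.
  - by move=> n x _; rewrite EFinM nnfun_muleindic_ge0.
under [RHS]eq_integral.
  move=> x xD; rewrite fimfunE -fsumEFin// muleC ge0_mule_fsumr; last first.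
    by move=> r; rewrite EFinM nnfun_muleindic_ge0.
  over.
rewrite [RHS]ge0_integral_fsum//; last 2 first.
  - move=> r; apply: emeasurable_funM; first exact/measurable_EFinP.
    by apply/measurable_EFinP; do 2 apply/measurableT_comp => //.
  - move=> n x _; rewrite mule_ge0 ?lee_fin//.
    by rewrite -lee_fin EFinM nnfun_muleindic_ge0.
apply: eq_fsbigr => r _.
rewrite integralZl_indic_nnsfun//= integral_indic// setIT m'E//.
have [r0|r0] := leP 0%R r.
  rewrite -ge0_integralZl//; last 2 first.
  - by apply: measurable_funTS; exact/measurable_EFinP.
  - by move=> x _; rewrite lee_fin.
  rewrite [LHS]integral_mkcond; apply: eq_integral => x _.
  rewrite patchE indicE; case: ifPn => _.
    by rewrite mulr1 muleC.
  by rewrite mulr0 mule0.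
(* A nonnegative simple function takes no negative value, so both sides vanish here. *)
have -> : h @^-1` [set r] = set0.
  apply/seteqP; split => // x /= hx; have : (0 <= h x)%R by [].
  by rewrite hx leNgt r0.
rewrite integral_set0 mule0 integral0_eq// => x _.
by rewrite indic0 mulr0 mule0.
Qed.

(** Approximation by nonnegative simple functions, with monotone convergence for both measures. *)
Lemma ge0_integral_density (f : T -> \bar R) :
  measurable_fun [set: T] f -> (forall x, 0 <= f x) ->
  \int[m']_x f x = \int[m]_x (f x * (g x)%:E).
Proof.
move=> mf f0; pose f_ := nnsfun_approx measurableT mf.
transitivity (limn (fun n => \int[m']_x (f_ n x)%:E)).
  rewrite -monotone_convergence//=.
  - apply: eq_integral => x _; apply/esym/cvg_lim => //=.
    exact: cvg_nnsfun_approx.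
  - by move=> n; apply: measurableT_comp => //; exact: measurable_funTS.
  - by move=> n x _; rewrite lee_fin.
  - by move=> x _ a b ab; rewrite lee_fin//; exact/lefP/nd_nnsfun_approx.
transitivity (limn (fun n => \int[m]_x ((f_ n x)%:E * (g x)%:E))).
  by congr (limn _); apply/funext => n; exact: integral_density_nnsfun.
rewrite -monotone_convergence//=.
- apply: eq_integral => x _; apply/cvg_lim => //.
  apply: cvgeZr => //; exact: cvg_nnsfun_approx.
- by move=> n; apply: emeasurable_funM; exact/measurable_EFinP.
- by move=> n x _; rewrite mule_ge0// lee_fin.
- move=> x _ a b ab; rewrite lee_wpmul2r// lee_fin//.
  exact/lefP/nd_nnsfun_approx.
Qed.
End density.

(** * The standard normal law on the line and its rotation invariance in the plane *)

Section std_normal.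
Context {R : realType}.
Local Notation mu := (@lebesgue_measure R).
Local Notation gamma := (@normal_prob R 0 1).
Local Notation phi := (@normal_pdf R 0 1).

Lemma std_normal_pdfE (x : R) :
  phi x = (Num.sqrt (2 * pi))^-1 * expR (- (x ^+ 2 / 2)).
Proof.
rewrite normal_pdfE ?oner_eq0// /normal_peak /normal_fun subr0 expr1n mul1r.
by congr (_ * _); rewrite ?mulNr// -mulr_natl.
Qed.

Lemma std_normal_pdf_ge0 (x : R) : 0 <= phi x.
Proof. exact: normal_pdf_ge0. Qed.

Lemma std_normal_pdfM (x y : R) :
  phi x * phi y = (2 * pi)^-1 * expR (- ((x ^+ 2 + y ^+ 2) / 2)).
Proof.
have p0 : 0 <= 2 * pi :> R by rewrite mulr_ge0// pi_ge0.
rewrite !std_normal_pdfE mulrACA -invfM -expr2 sqr_sqrtr// -expRD.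
by congr (_ * expR _); field.
Qed.

Lemma measurable_std_normal_pdf : measurable_fun [set: R] phi.
Proof. exact: measurable_normal_pdf. Qed.

Lemma ge0_integral_std_normal (f : R -> \bar R) :
  measurable_fun [set: R] f -> (forall x, 0 <= f x)%E ->
  (\int[gamma]_x f x = \int[mu]_x (f x * (phi x)%:E))%E.
Proof.
move=> mf f0; apply: ge0_integral_density => //.
- exact: measurable_std_normal_pdf.
- exact: std_normal_pdf_ge0.
Qed.

Lemma ge0_integral_std_normal2 (f : R * R -> \bar R) :
  measurable_fun [set: R * R] f -> (forall x, 0 <= f x)%E ->
  (\int[gamma \x gamma]_z f z =
   \int[mu]_x \int[mu]_y (f (x, y) * (phi x * phi y)%:E))%E.
Proof.
move=> mf f0; rewrite fubini_tonelli1//.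
rewrite ge0_integral_std_normal//; last 2 first.
- exact: measurable_fun_fubini_tonelli_F.
- by move=> x; apply: integral_ge0.
apply: eq_integral => x _.
have mfx : measurable_fun [set: R] (fun y => f (x, y)).
  by apply: measurableT_comp => //; exact: pair1_measurable.
rewrite /fubini_F/= ge0_integral_std_normal// -ge0_integralZr//.
- by apply: eq_integral => y _; rewrite -muleA -EFinM mulrC.
- by apply: emeasurable_funM => //; apply/measurable_EFinP; exact: measurable_std_normal_pdf.
- by move=> y _; rewrite mule_ge0// lee_fin std_normal_pdf_ge0.
- by rewrite lee_fin std_normal_pdf_ge0.
Qed.

Lemma measurable_std_normal_pdf2 :
  measurable_fun [set: R * R] (fun z => phi z.1 * phi z.2).
Proof.
by apply: measurable_funM; apply: measurableT_comp;
  [exact: measurable_std_normal_pdf|exact: measurable_fst|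
   exact: measurable_std_normal_pdf|exact: measurable_snd].
Qed.

Let integral_scale (h : R -> \bar R) (k : R) : 0 <= k ->
  measurable_fun [set: R] h -> (forall x, 0 <= h x)%E ->
  (\int[mu]_x (k%:E * h x) = k%:E * \int[mu]_x h x)%E.
Proof. by move=> k0 mh h0; rewrite ge0_integralZl//. Qed.

(* Two affine substitutions, one in each variable, undo the rotation. *)
Lemma std_normal2_rotation (c s : R) (f : R * R -> \bar R) :
  0 < c -> c ^+ 2 + s ^+ 2 = 1 ->
  measurable_fun [set: R * R] f -> (forall x, 0 <= f x)%E ->
  (\int[gamma \x gamma]_z f (c * z.1 + s * z.2, - s * z.1 + c * z.2)%R =
   \int[gamma \x gamma]_z f z)%E.
Proof.
move=> c0 cs mf f0.
have cn0 : c != 0 by rewrite gt_eqF.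
have m1 : measurable_fun [set: R * R] (fun z : R * R => z.1) by exact: measurable_fst.
have m2 : measurable_fun [set: R * R] (fun z : R * R => z.2) by exact: measurable_snd.
have mlin a b : measurable_fun [set: R * R] (fun z : R * R => a * z.1 + b * z.2).
  by apply: measurable_funD; exact: measurable_funM.
pose rot (z : R * R) : R * R := (c * z.1 + s * z.2, - s * z.1 + c * z.2).
have mrot : measurable_fun [set: R * R] rot.
  by apply: measurable_fun_pair; exact: mlin.
pose G (z : R * R) : \bar R := (f z * (phi z.1 * phi z.2)%:E)%E.
have mG : measurable_fun [set: R * R] G.
  apply: emeasurable_funM => //; apply/measurable_EFinP.
  exact: measurable_std_normal_pdf2.
have G0 z : (0 <= G z)%E.
  by rewrite mule_ge0// lee_fin mulr_ge0// std_normal_pdf_ge0.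
have f0rot x : (0 <= (f \o rot) x)%E by exact: f0.
rewrite (ge0_integral_std_normal2 mf f0).
transitivity (\int[gamma \x gamma]_z (f \o rot) z)%E => //.
rewrite (ge0_integral_std_normal2 (measurableT_comp mf mrot) f0rot).
transitivity (\int[mu]_x \int[mu]_y (G \o rot) (x, y))%E.
  apply: eq_integral => x _; apply: eq_integral => y _.
  rewrite /G /rot/= !std_normal_pdfM; congr (_ * (_ * expR (- (_ / 2)))%:E)%E.
  have -> : x ^+ 2 + y ^+ 2 = (c ^+ 2 + s ^+ 2) * (x ^+ 2 + y ^+ 2).
    by rewrite cs mul1r.
  by ring.
(* With u = c x + s y the second rotated coordinate - s x + c y equals (y - s u) / c, because c^2 +
   s^2 = 1. So [G'] is the rotated integrand in the variables (u, y). Passing from x to u, and from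
   y to (y - s u) / c, produces the same factor 1/c on the two sides. *)
pose G' (z : R * R) := G (z.1, (z.2 - s * z.1) / c).
have mG' : measurable_fun [set: R * R] G'.
  apply: measurableT_comp => //; apply: measurable_fun_pair => //.
  apply: measurable_funM => //; apply: measurable_funB => //.
  exact: measurable_funM.
have G'0 z : (0 <= G' z)%E by exact: G0.
have G0rot z : (0 <= (G \o rot) z)%E by exact: G0.
transitivity (\int[mu]_y \int[mu]_x (G \o rot) (x, y))%E.
  exact: (@fubini_tonelli _ _ _ _ _ mu mu _ (measurableT_comp mG mrot) G0rot).
have mG'y y : measurable_fun [set: R] (fun x => G' (x, y)).
  by apply: measurableT_comp => //; exact: pair2_measurable.
have mGx x : measurable_fun [set: R] (fun y => G (x, y)).
  by apply: measurableT_comp => //; exact: pair1_measurable.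
have ci0 : 0 < c^-1 by rewrite invr_gt0.
pose H (y : R) := (\int[mu]_x G' (x, y))%E.
pose K (x : R) := (\int[mu]_y G' (x, y))%E.
have mH : measurable_fun [set: R] H by exact: measurable_fun_fubini_tonelli_G.
have mK : measurable_fun [set: R] K by exact: measurable_fun_fubini_tonelli_F.
have H0 y : (0 <= H y)%E by apply: integral_ge0.
have K0 y : (0 <= K y)%E by apply: integral_ge0.
have HK : (\int[mu]_y H y = \int[mu]_x K x)%E.
  by apply/esym; exact: (@fubini_tonelli _ _ _ _ _ mu mu _ mG' G'0).
have EJ y : (\int[mu]_x (G \o rot) (x, y) =
    \int[mu]_x G' (c * x + s * y, y)%R)%E.
  apply: eq_integral => x _; rewrite /G' /rot/=; congr (G (_, _)).
  have -> : y - s * (c * x + s * y) = (c ^+ 2 + s ^+ 2 - s ^+ 2) * y - s * c * x.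
    by rewrite cs; ring.
  by field.
have cK (e : \bar R) : (c^-1%:E * (c%:E * e) = e)%E.
  by rewrite muleA -EFinM (mulVf cn0) mul1e.
have EH y : (\int[mu]_x (G \o rot) (x, y) = c^-1%:E * H y)%E.
  apply: (etrans (EJ y)); apply/esym; apply: etrans (cK _).
  congr (c^-1%:E * _)%E.
  exact: (ge0_integral_affine (s * y) c0 (mG'y y) (fun=> G'0 _)).
have EM x : (\int[mu]_y G (x, c^-1 * y + - s * x / c)%R = K x)%E.
  apply: eq_integral => y _; rewrite /G'/=; congr (G (_, _)).
  by field.
have EK x : (\int[mu]_y G (x, y) = c^-1%:E * K x)%E.
  apply: etrans (congr1 (fun e => c^-1%:E * e)%E (EM x)).
  exact: (ge0_integral_affine (- s * x / c) ci0 (mGx x) (fun=> G0 _)).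
have ci0' := ltW ci0.
transitivity (\int[mu]_y (c^-1%:E * H y))%E.
  by apply: eq_integral => y _; exact: EH.
apply: (etrans (integral_scale ci0' mH H0)).
apply: (etrans (congr1 (fun z => c^-1%:E * z)%E HK)).
apply: (etrans (esym (integral_scale ci0' mK K0))).
by apply: eq_integral => x _; exact/esym/EK.
Qed.

End std_normal.

(** * Rotations and Gaussian vectors *)

Section givens.
Context {R : realType}.

Definition givens n (i j : 'I_n) (c s : R) : 'M[R]_n :=
  \matrix_(k, l)
    if k == i then (if l == i then c else if l == j then s else 0)
    else if k == j then (if l == i then - s else if l == j then c else 0)
    else (k == l)%:R.

Lemma givens_mulE n (i j : 'I_n) (c s : R) (v : 'cV[R]_n) k : i != j ->
  (givens i j c s *m v) k 0 =
    if k == i then c * v i 0 + s * v j 0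
    else if k == j then - s * v i 0 + c * v j 0 else v k 0.
Proof.
move=> ij; have ji : j == i = false by rewrite eq_sym; exact: negbTE.
rewrite mxE; under eq_bigr do rewrite mxE.
case: eqVneq => [ki|ki]; [|case: eqVneq => [kj|kj]].
- rewrite (bigD1 i)//= (bigD1 j)/= ?ji// eqxx eqxx addrA big1 ?addr0//.
  by move=> l /andP[/negbTE -> /negbTE ->]; rewrite mul0r.
- rewrite (bigD1 i)//= (bigD1 j)/= ?ji// eqxx eqxx addrA big1 ?addr0//.
  by move=> l /andP[/negbTE -> /negbTE ->]; rewrite mul0r.
- rewrite (bigD1 k)//= eqxx mul1r big1 ?addr0// => l /negbTE.
  by rewrite eq_sym => ->; rewrite mul0r.
Qed.

(** Only Givens rotations with c > 0 generate, since these are the ones whose two affine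
    substitutions have positive slope. Their products still diagonalize every symmetric matrix with
    a given real spectrum. *)
Inductive rotation n : 'M[R]_n -> Prop :=
| rotation1 : rotation 1%:M
| rotation_givens i j c s O : i != j -> 0 < c -> c ^+ 2 + s ^+ 2 = 1 ->
    rotation O -> rotation (givens i j c s *m O).

Lemma rotation_mul n (A B : 'M[R]_n) :
  rotation A -> rotation B -> rotation (A *m B).
Proof.
move=> + rB; elim=> [|i j c s O ij c0 cs _ IH]; first by rewrite mul1mx.
by rewrite -mulmxA; exact: rotation_givens.
Qed.

Lemma givens_dot n (i j : 'I_n) (c s : R) (v w : 'cV[R]_n) : i != j ->
  c ^+ 2 + s ^+ 2 = 1 ->
  ((givens i j c s *m v)^T *m (givens i j c s *m w)) 0 0 = (v^T *m w) 0 0.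
Proof.
move=> ij cs; have ji : j != i by rewrite eq_sym.
rewrite !mxE; under eq_bigr do rewrite mxE !givens_mulE//.
under [RHS]eq_bigr do rewrite mxE.
rewrite (bigD1 i)//= (bigD1 j)//= [RHS](bigD1 i)//= [in RHS](bigD1 j)//=.
rewrite !eqxx (negbTE ji) !addrA; congr (_ + _).
  transitivity ((c ^+ 2 + s ^+ 2) * (v i 0 * w i 0 + v j 0 * w j 0)).
    by ring.
  by rewrite cs mul1r.
by apply: eq_bigr => k /andP[/negbTE -> /negbTE ->].
Qed.

Lemma rotation_dot n (O : 'M[R]_n) (v w : 'cV[R]_n) : rotation O ->
  ((O *m v)^T *m (O *m w)) 0 0 = (v^T *m w) 0 0.
Proof.
elim=> [|i j c s O' ij c0 cs _ IH]; first by rewrite !mul1mx.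
by rewrite -!mulmxA givens_dot.
Qed.

Lemma rotation_orth n (O : 'M[R]_n) : rotation O -> O^T *m O = 1%:M.
Proof.
move=> rO; apply/matrixP => i j.
have := rotation_dot (delta_mx i 0) (delta_mx j 0) rO.
rewrite trmx_mul -mulmxA (mulmxA O^T) !trmx_delta -!rowE -!colE.
by rewrite !mxE/= andbT => ->; rewrite eq_sym.
Qed.

Lemma rotation_orthT n (O : 'M[R]_n) : rotation O -> O *m O^T = 1%:M.
Proof. by move/rotation_orth/mulmx1C. Qed.

Lemma givens_lift n (i j : 'I_n) (c s : R) :
  block_mx 1%:M 0 0 (givens i j c s) =
  givens (rshift 1 i) (rshift 1 j) c s :> 'M[R]_(1 + n).
Proof.
apply/matrixP => k l; rewrite [RHS]mxE -[k]splitK -[l]splitK.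
case: (fintype.split k) => k'; case: (fintype.split l) => l' /=.
- by rewrite block_mxEul !eq_lrshift eq_lshift mxE.
- by rewrite block_mxEur !eq_lrshift mxE.
- rewrite block_mxEdl !eq_rshift !eq_rlshift !eq_lrshift mxE.
  by case: ifP => // _; case: ifP.
- by rewrite block_mxEdr !eq_rshift mxE.
Qed.

Lemma rotation_lift n (O : 'M[R]_n) : rotation O ->
  rotation (block_mx 1%:M 0 0 O : 'M[R]_(1 + n)).
Proof.
elim=> [|i j c s O' ij c0 cs _ IH].
  by rewrite -scalar_mx_block; exact: rotation1.
have -> : block_mx 1%:M 0 0 (givens i j c s *m O') =
    block_mx 1%:M 0 0 (givens i j c s) *m block_mx 1%:M 0 0 O' :> 'M[R]_(1 + n).
  by rewrite mulmx_block !(mul0mx, mulmx0, addr0, add0r, mul1mx).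
by rewrite givens_lift; apply: rotation_givens.
Qed.

(** If coordinate i is nonzero, its sign can be put into s so that c is positive. If it is zero,
    clearing coordinate j would take a quarter turn, for which c = 0; an eighth of a turn is applied
    first to make coordinate i nonzero. *)
Lemma givens_align n (i j : 'I_n) (v : 'cV[R]_n) : i != j ->
  exists O, [/\ rotation O, (O *m v) j 0 = 0 &
    forall k, k != i -> k != j -> (O *m v) k 0 = v k 0].
Proof.
move=> ij; have ji : j == i = false by rewrite eq_sym; exact: negbTE.
suff H (w : 'cV[R]_n) : w i 0 != 0 -> exists O, [/\ rotation O, (O *m w) j 0 = 0 &
    forall k, k != i -> k != j -> (O *m w) k 0 = w k 0].
  have [vi0|/H//] := eqVneq (v i 0) 0.
  have [vj0|vj0] := eqVneq (v j 0) 0.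
    exists 1%:M; split; rewrite ?mul1mx//; exact: rotation1.
  pose r : R := (Num.sqrt 2)^-1.
  have r0 : 0 < r by rewrite invr_gt0 sqrtr_gt0.
  have r2 : r ^+ 2 + r ^+ 2 = 1 by rewrite exprVn sqr_sqrtr//; field.
  have rG : rotation (givens i j r r).
    by rewrite -[givens _ _ _ _]mulmx1; apply: rotation_givens => //; exact: rotation1.
  have [] := H (givens i j r r *m v).
    by rewrite givens_mulE// eqxx vi0 mulr0 add0r mulf_neq0// gt_eqF.
  move=> Q [rO Oj Ok]; exists (Q *m givens i j r r); split.
  - exact: rotation_mul.
  - by rewrite -mulmxA.
  - by move=> k ki kj; rewrite -mulmxA Ok// givens_mulE// (negbTE ki) (negbTE kj).
move=> wi0; pose r := Num.sqrt (w i 0 ^+ 2 + w j 0 ^+ 2).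
have r0 : 0 < r.
  by rewrite sqrtr_gt0 ltr_pwDl ?sqr_ge0// exprn_even_gt0.
have r2 : r ^+ 2 = w i 0 ^+ 2 + w j 0 ^+ 2.
  by rewrite sqr_sqrtr// addr_ge0// sqr_ge0.
have rn0 : r != 0 by rewrite gt_eqF.
pose e : R := Num.sg (w i 0).
have e2 : e ^+ 2 = 1 by rewrite sqr_sg wi0.
pose c := `|w i 0| / r; pose s := e * w j 0 / r.
have c0 : 0 < c by rewrite divr_gt0// normr_gt0.
exists (givens i j c s); split.
- rewrite -[givens _ _ _ _]mulmx1; apply: rotation_givens => //; last exact: rotation1.
  rewrite /c /s !expr_div_n exprMn e2 mul1r real_normK ?num_real//.
  by rewrite -mulrDl -r2 divff// sqrf_eq0.
- have wE : w i 0 = e * `|w i 0| := numEsg (w i 0).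
  rewrite givens_mulE// ji eqxx /c /s {1}wE.
  transitivity ((1 - e ^+ 2) * (w j 0 * `|w i 0| / r)); first by ring.
  by rewrite e2 subrr mul0r.
- by move=> k ki kj; rewrite givens_mulE// (negbTE ki) (negbTE kj).
Qed.

Lemma rotation_align n (v : 'cV[R]_n.+1) :
  exists O a, rotation O /\ O *m v = a *: delta_mx 0 0.
Proof.
suff H m : (m <= n)%N -> exists O, rotation O /\
    forall k : 'I_n.+1, (k != 0 :> nat)%N -> (k <= m)%N -> (O *m v) k 0 = 0.
  have [Q [rQ Ok]] := H n (leqnn n).
  exists Q, ((Q *m v) 0 0); split => //; apply/matrixP => k l.
  rewrite (ord1 l) [RHS]mxE [X in _ * X]mxE eqxx andbT; case: eqVneq => [->|k0].
    by rewrite mulr1.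
  by rewrite mulr0 Ok// -ltnS.
elim: m => [_|m IH mn].
  by exists 1%:M; split; [exact: rotation1|case=> -[|k]//].
have [Q [rQ Ok]] := IH (ltnW mn).
pose j : 'I_n.+1 := Ordinal (mn : (m.+1 < n.+1)%N).
have [Q' [rO' O'j O'k]] := @givens_align _ 0 j (Q *m v) isT.
exists (Q' *m Q); split; first exact: rotation_mul.
move=> k k0 km; rewrite -mulmxA.
have [->//|kj] := eqVneq k j.
rewrite O'k//; apply: Ok => //.
by move: km; rewrite leq_eqVlt => /predU1P[kE|//]; case/negP: kj; exact/eqP/val_inj.
Qed.

End givens.

Section gaussian_vector.
Context {R : realType} d (T : measurableType d) (Pr : probability T R).
Local Notation gamma := (@normal_prob R 0 1).

Definition measurable_coords n (Y : T -> 'cV[R]_n) :=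
  forall i, measurable_fun [set: T] (fun om => Y om i 0).

Let rot (c s : R) (z : R * R) : R * R := (c * z.1 + s * z.2, - s * z.1 + c * z.2).

Let measurable_rot (c s : R) : measurable_fun [set: R * R] (rot c s).
Proof.
have m1 : measurable_fun [set: R * R] (fun z : R * R => z.1) by exact: measurable_fst.
have m2 : measurable_fun [set: R * R] (fun z : R * R => z.2) by exact: measurable_snd.
have mlin a b : measurable_fun [set: R * R] (fun z : R * R => a * z.1 + b * z.2).
  by apply: measurable_funD; exact: measurable_funM.
by apply: measurable_fun_pair; exact: mlin.
Qed.

Lemma std_normal2_rotation_measure (c s : R) (D : set (R * R)) :
  0 < c -> c ^+ 2 + s ^+ 2 = 1 -> measurable D ->
  ((gamma \x gamma) (rot c s @^-1` D) = (gamma \x gamma) D)%E.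
Proof.
move=> c0 cs mD.
have mD' : measurable (rot c s @^-1` D).
  by rewrite -[X in measurable X]setTI; exact: measurable_rot.
rewrite -(setIT (_ @^-1` _)) -[in RHS](setIT D) -!integral_indic//.
have := @std_normal2_rotation R c s (fun z => (\1_D z)%:E) c0 cs.
by apply => //; apply/measurable_EFinP; exact: measurable_indic.
Qed.

Lemma measurable_coords_mul n (M : 'M[R]_n) (Y : T -> 'cV[R]_n) :
  measurable_coords Y -> measurable_coords (fun om => M *m Y om).
Proof.
move=> mY i; under eq_fun do rewrite mxE.
by apply: measurable_sum => j; exact: measurable_funM.
Qed.

Lemma continuous_borelV_measurable n (f : 'cV[R]_n -> R) :
  continuous f -> measurable_fun [set: borelV R n] f.
Proof.
move=> cf; apply: (measurability _ (RGenOInfty.measurableE R)).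
move=> /= _ [_ [a ->]] <-; rewrite setTI; apply: sub_sigma_algebra.
apply: open_comp; first by move=> x _; exact: cf.
exact: interval_open.
Qed.

Lemma measurable_coords_RV n (Y : {RV Pr >-> borelV R n}) :
  measurable_coords (Y : T -> 'cV[R]_n).
Proof.
move=> i.
have mc : measurable_fun [set: borelV R n] (fun v : 'cV[R]_n => v i 0).
  by apply: continuous_borelV_measurable; exact: coord_continuous.
apply: (measurableT_comp mc); exact: measurable_funP.
Qed.

(* Off the coordinates i and j the event only contributes a factor. *)
Lemma std_gaussian_pair n (Y : T -> 'cV[R]_n) (i j : 'I_n) (B : 'I_n -> set R)
    (D : set (R * R)) : i != j ->
  measurable_coords Y -> std_gaussian Pr Y -> (forall k, measurable (B k)) ->
  measurable D ->
  (Pr ([set om | forall k, k != i -> k != j -> B k (Y om k 0%R)] `&`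
       [set om | D (Y om i 0%R, Y om j 0%R)]) =
   \prod_(k | (k != i) && (k != j)) gamma (B k) * (gamma \x gamma) D)%E.
Proof.
move=> ij mY gY mB mD.
have ji : j != i by rewrite eq_sym.
set E := [set om | _].
have mE : measurable E.
  have -> : E = \bigcap_(k in [set k | (k != i) && (k != j)])
      ((fun om => Y om k 0) @^-1` B k).
    apply/seteqP; split => om h k /=; first by move=> /andP[]; exact: h.
    by move=> ki kj; apply: h; rewrite /= ki kj.
  apply: fin_bigcap_measurable; first exact: finite_finset.
  move=> k _.
  by rewrite -[X in measurable X]setTI; exact: mY.
have mp : measurable_fun [set: T] ((fun om => (Y om i 0, Y om j 0)) :
    T -> measurableTypeR R * measurableTypeR R).
  by apply: measurable_fun_pair; exact: mY.
have gfin A : measurable A -> gamma A \is a fin_num.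
  by move=> mA; exact: fin_num_measure.
pose c := (\prod_(k | (k != i) && (k != j)) fine (gamma (B k)))%R.
have c0 : 0 <= c by apply: prodr_ge0 => k _; exact: fine_ge0.
have cE : (\prod_(k | (k != i) && (k != j)) gamma (B k))%E = c%:E.
  rewrite /c; elim/big_rec2: _ => // k x y _ ->.
  by rewrite EFinM fineK//; apply: gfin; exact: mB.
(* [nu] is the law of the pair restricted to [E]. Both [nu] and [cgg] agree with the product of
   [gamma] and [cg] on rectangles, and this determines them. *)
pose nu := image_measure (mrestr Pr mE) mp.
pose cg := mscale (NngNum c0) gamma.
pose cgg := mscale (NngNum c0) (gamma \x gamma)%E.
rewrite cE.
transitivity ((gamma \x cg)%E D); last first.
  apply: (@product_measure_unique _ _ _ _ R gamma cg cgg) => // A A' mA mA'.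
  by rewrite /cgg/= /mscale/= product_measure1E// muleCA.
rewrite (@product_measure_unique _ _ _ _ R gamma cg nu)//.
  by rewrite /nu image_measureE/= /mrestr setIC.
move=> A A' mA mA'; rewrite /nu image_measureE/= /mrestr /cg /mscale/=.
pose B' (k : 'I_n) : set R := if k == i then A else if k == j then A' else B k.
have mB' k : measurable (B' k).
  rewrite /B'; case: ifP => _; first exact: mA.
  by case: ifP => _; [exact: mA'|exact: mB].
transitivity (Pr [set om | forall k, B' k (Y om k 0)]).
  congr (Pr _); apply/seteqP; split => om /=.
    move=> [[hA hA'] hE] k; rewrite /B'.
    by case: eqVneq => [->//|ki]; case: eqVneq => [->//|kj]; exact: hE.
  move=> h; split; first split.
  - by have := h i; rewrite /B' eqxx.
  - by have := h j; rewrite /B' (negbTE ji) eqxx.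
  - by move=> k ki kj; have := h k; rewrite /B' (negbTE ki) (negbTE kj).
rewrite gY// (bigD1 i)//= (bigD1 j)//= -cE.
rewrite /B' eqxx (negbTE ji) eqxx; congr (_ * _)%E; rewrite muleC; congr (_ * _)%E.
by apply: eq_bigr => k /andP[/negbTE -> /negbTE ->].
Qed.

Lemma std_gaussian_givens n (Y : T -> 'cV[R]_n) (i j : 'I_n) (c s : R) :
  i != j -> 0 < c -> c ^+ 2 + s ^+ 2 = 1 ->
  measurable_coords Y -> std_gaussian Pr Y ->
  std_gaussian Pr (fun om => givens i j c s *m Y om).
Proof.
move=> ij c0 cs mY gY B mB.
have ji : j != i by rewrite eq_sym.
have mD : measurable (B i `*` B j) by exact: measurableX.
have mD' : measurable (rot c s @^-1` (B i `*` B j)).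
  by rewrite -[X in measurable X]setTI; exact: measurable_rot.
transitivity (Pr ([set om | forall k, k != i -> k != j -> B k (Y om k 0)] `&`
       [set om | (rot c s @^-1` (B i `*` B j)) (Y om i 0, Y om j 0)])).
  congr (Pr _); apply/seteqP; split => om /=.
    move=> h; split.
      by move=> k ki kj; have := h k; rewrite givens_mulE// (negbTE ki) (negbTE kj).
    split; first by have := h i; rewrite givens_mulE// eqxx.
    by have := h j; rewrite givens_mulE// eqxx (negbTE ji).
  move=> [h [hi hj]] k; rewrite givens_mulE//.
  by case: eqVneq => [->//|ki]; case: eqVneq => [->//|kj]; exact: h.
rewrite std_gaussian_pair// std_normal2_rotation_measure// product_measure1E.
- by rewrite [RHS](bigD1 i)//= [in RHS](bigD1 j)//= muleC muleA.
- exact: mB.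
- exact: mB.
Qed.

Lemma std_gaussian_rotation n (Y : T -> 'cV[R]_n) (O : 'M[R]_n) : rotation O ->
  measurable_coords Y -> std_gaussian Pr Y ->
  std_gaussian Pr (fun om => O *m Y om).
Proof.
move=> rO mY gY; elim: rO => [|i j c s O' ij c0 cs _ IH].
  by under [X in std_gaussian _ X]eq_fun do rewrite mul1mx.
under [X in std_gaussian _ X]eq_fun do rewrite -mulmxA.
by apply: std_gaussian_givens => //; exact: measurable_coords_mul.
Qed.

End gaussian_vector.

(** * The spectral theorem by Givens rotations *)

Section diagonalization.
Context {R : realType}.
Lemma char_poly_orth_conj n (O A : 'M[R]_n) : O *m O^T = 1%:M ->
  char_poly (O *m A *m O^T) = char_poly A.
Proof.
move=> OO; pose c (B : 'M[R]_n) := map_mx polyC B.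
have cOO : c O *m c O^T = 1%:M by rewrite -map_mxM OO map_mx1.
have -> : char_poly (O *m A *m O^T) = \det (c O *m char_poly_mx A *m c O^T).
  rewrite /char_poly; congr (\det _); rewrite /char_poly_mx !map_mxM/=.
  by rewrite mulmxBr mulmxBl scalar_mxC -[_ *m c O *m _]mulmxA cOO mulmx1.
by rewrite !det_mulmx mulrAC -det_mulmx cOO det1 mul1r.
Qed.

(** The eigenvalues are split off in the order of [lam]. A rotation takes an eigenvector of the head
    to the first axis, symmetry then clears the first row, and cancelling the factor of the head in
    the characteristic polynomial shows that the lower block has the tail of [lam] as its
    spectrum. *)
Lemma rotation_diag n (A : 'M[R]_n) (lam : seq R) : A^T = A ->
  char_poly A = \prod_(l <- lam) ('X - l%:P) ->
  exists O, rotation O /\ O *m A *m O^T = diag_mx (\row_i lam`_i).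
Proof.
elim: n A lam => [|n IH] A lam symA chA.
  by exists 1%:M; split; [exact: rotation1|apply/matrixP => -[]].
case: lam chA => [|l lam] chA.
  by have := size_char_poly A; rewrite chA big_nil size_poly1.
have : eigenvalue A l.
  by rewrite eigenvalue_root_char chA big_cons rootM root_XsubC eqxx.
move=> /eigenvalueP[v vA v0].
have [Q [a [rQ Qv]]] := rotation_align v^T.
have a0 : a != 0.
  apply: contra v0 => /eqP a0; rewrite -[v]trmxK.
  by rewrite -[v^T]mul1mx -(rotation_orth rQ) -mulmxA Qv a0 scale0r mulmx0 trmx0.
pose B := Q *m A *m Q^T.
have symB : B^T = B by rewrite /B !trmx_mul trmxK symA mulmxA.
have Be : B *m delta_mx 0 0 = l *: delta_mx 0 0 :> 'cV_n.+1.
  have -> : delta_mx 0 0 = a^-1 *: (Q *m v^T) :> 'cV_n.+1.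
    by rewrite Qv scalerA mulVf// scale1r.
  rewrite -scalemxAr scalerA mulrC -scalerA; congr (_ *: _).
  rewrite /B -!mulmxA (mulmxA Q^T) (rotation_orth rQ) mul1mx.
  by rewrite -{1}symA -trmx_mul vA linearZ/= -scalemxAr.
have B0 i : B i 0 = l * (i == 0)%:R.
  have := congr1 (fun M : 'cV_n.+1 => M i 0) Be.
  by rewrite -colE !mxE andbT.
have BD : B = Q *m A *m Q^T by [].
clearbody B.
pose A' : 'M[R]_n := drsubmx (B : 'M[R]_(1 + n)%N).
have BE : B = block_mx l%:M 0 0 A' :> 'M[R]_(1 + n).
  rewrite -[LHS](@submxK _ 1 n 1 n); congr block_mx.
  - apply/matrixP => i j; rewrite !ord1 mxE [in LHS]mxE [RHS]mxE eqxx mulr1n.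
    have -> : lshift n (0 : 'I_1) = 0 by apply/val_inj.
    by rewrite B0 eqxx mulr1.
  - apply/matrixP => i j; rewrite !ord1 !mxE -symB mxE.
    have -> : lshift n (0 : 'I_1) = 0 by apply/val_inj.
    by rewrite B0 mulr0.
  - apply/matrixP => i j; rewrite !ord1 !mxE.
    have -> : lshift n (0 : 'I_1) = 0 by apply/val_inj.
    by rewrite B0 mulr0.
have symA' : A'^T = A'.
  by rewrite /A' trmx_drsub symB.
clearbody A'.
have chA' : char_poly A' = \prod_(l <- lam) ('X - l%:P).
  have : char_poly B = ('X - l%:P) * char_poly A'.
    rewrite BE /char_poly (@char_block_diag_mx _ 1 n) (@det_ublock _ 1 n); congr (_ * _).
    by rewrite det_mx11 /char_poly_mx !mxE eqxx !mulr1n.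
  rewrite BD char_poly_orth_conj ?rotation_orthT// chA big_cons.
  by move=> h; apply/esym/(mulfI _ h); rewrite polyXsubC_eq0.
have [Q' [rQ' QA]] := IH A' lam symA' chA'.
exists ((block_mx 1%:M 0 0 Q' : 'M[R]_(1 + n)) *m Q); split.
  by apply: rotation_mul => //; exact: rotation_lift.
rewrite trmx_mul -!mulmxA (mulmxA A) (mulmxA Q) (mulmxA Q) -BD BE.
have E : block_mx 1%:M 0 0 Q' *m
    (block_mx l%:M 0 0 A' *m (block_mx 1%:M 0 0 Q')^T) =
    block_mx l%:M 0 0 (diag_mx (\row_i lam`_i)) :> 'M[R]_(1 + n).
  rewrite tr_block_mx !trmx0 trmx1 !mulmx_block.
  by rewrite !(mul0mx, mulmx0, addr0, add0r, mul1mx, mulmx1) mulmxA QA.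
apply: (etrans E).
apply/matrixP => i j; rewrite [RHS]mxE -[i](@splitK 1 n) -[j](@splitK 1 n).
case: (fintype.split i) => i'; case: (fintype.split j) => j' /=.
- rewrite block_mxEul !ord1 !mxE eqxx.
  by have -> : lshift n (0 : 'I_1) = 0 by apply/val_inj.
- rewrite block_mxEur mxE (_ : (_ == _) = false) ?mulr0n ?mxE//.
  exact: (@eq_lrshift 1 n).
- rewrite block_mxEdl mxE (_ : (_ == _) = false) ?mulr0n ?mxE//.
  exact: (@eq_rlshift 1 n).
- by rewrite block_mxEdr !mxE/= (_ : (_ == _) = (i' == j')).
Qed.

Lemma quad_diag n (A : 'M[R]_n) (lam : seq R) : A^T = A ->
  char_poly A = \prod_(l <- lam) ('X - l%:P) ->
  exists O, rotation O /\ forall y : 'cV[R]_n,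
    (y^T *m A *m y) 0 0 = \sum_(i < n) lam`_i * (O *m y) i 0 ^+ 2.
Proof.
move=> symA chA; have [Q [rQ QA]] := rotation_diag symA chA.
exists Q; split => // y; have QQ := rotation_orth rQ.
have -> : y^T *m A *m y = (Q *m y)^T *m diag_mx (\row_i lam`_i) *m (Q *m y).
  rewrite -QA trmx_mul !mulmxA -(mulmxA y^T Q^T Q) QQ mulmx1.
  by rewrite -(mulmxA (y^T *m A) Q^T Q) QQ mulmx1.
rewrite mul_mx_diag mxE; apply: eq_bigr => i _; rewrite !mxE.
by rewrite mulrAC mulrC expr2.
Qed.

End diagonalization.

(** * Anti-concentration of weighted chi-squares *)

Section gaussian_tail_sums.
Context {R : realType} d (T : measurableType d) (Pr : probability T R).
Local Notation gamma := (@normal_prob R 0 1).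
Variables (q : nat) (Y : nat -> T -> R) (lam : nat -> R).
Hypothesis mY : forall i, measurable_fun [set: T] (Y i).
Hypothesis gY : forall B : nat -> set R, (forall i, measurable (B i)) ->
  Pr [set om | forall i, (i < q)%N -> B i (Y i om)] =
  (\prod_(0 <= i < q) gamma (B i))%E.

Definition tail_sum (k : nat) (om : T) : R :=
  \sum_(k <= i < q) lam i * Y i om ^+ 2.

Lemma measurable_tail_sum k : measurable_fun [set: T] (tail_sum k).
Proof.
rewrite /tail_sum; apply: measurable_sum => i.
by apply: measurable_funM => //; exact: measurable_funX.
Qed.

Let measurable_tail_sum' k :
  measurable_fun [set: T] (tail_sum k : T -> measurableTypeR R).
Proof. exact: measurable_tail_sum. Qed.

Lemma tail_sumS k om : (k < q)%N ->
  tail_sum k om = lam k * Y k om ^+ 2 + tail_sum k.+1 om.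
Proof. by move=> kq; rewrite /tail_sum big_ltn. Qed.

Let tail_rv k : {mfun T >-> measurableTypeR R} :=
  HB.pack (tail_sum k : T -> measurableTypeR R)
    (isMeasurableFun.Build _ _ _ _ _ (measurable_tail_sum' k)).

Let mu k := distribution Pr (tail_rv k).

Let prefix (k : nat) (B : nat -> set R) :=
  [set om | forall i, (i < k)%N -> B i (Y i om)].

Let weight (k : nat) (B : nat -> set R) : R :=
  \prod_(0 <= i < k) fine (gamma (B i)).

Let weightE k B : (forall i, measurable (B i)) ->
  (\prod_(0 <= i < k) gamma (B i))%E = (weight k B)%:E.
Proof.
move=> mB; rewrite /weight; elim/big_rec2: _ => // i x y _ ->.
by rewrite EFinM fineK//; apply: fin_num_measure; exact: mB.
Qed.

Let weight_ge0 k B : 0 <= weight k B.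
Proof. by apply: prodr_ge0 => i _; exact: fine_ge0. Qed.

Let prob_prefix k B : (k <= q)%N -> (forall i, measurable (B i)) ->
  Pr (prefix k B) = (weight k B)%:E.
Proof.
move=> kq mB; pose B' i := if (i < k)%N then B i else [set: R].
have mB' i : measurable (B' i) by rewrite /B'; case: ifP.
transitivity (Pr [set om | forall i, (i < q)%N -> B' i (Y i om)]).
  congr (Pr _); apply/seteqP; split => om /= h i.
    by move=> _; rewrite /B'; case: ifPn => // /h.
  by move=> ik; have := h i (leq_trans ik kq); rewrite /B' ik.
rewrite gY// (big_cat_nat _ kq)//= [X in (_ * X)%E]big1_seq ?mule1; last first.
  move=> i /andP[_]; rewrite mem_index_iota => /andP[ki _].
  by rewrite /B' ltnNge ki/= probability_setT.
rewrite -weightE//; apply: eq_big_nat => i /andP[_ ik].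
by rewrite /B' ik.
Qed.

Let measurable_prefix k B : (forall i, measurable (B i)) ->
  measurable (prefix k B).
Proof.
move=> mB; have -> : prefix k B = \bigcap_(i in `I_k) (Y i @^-1` B i).
  by apply/seteqP; split => om h i /=; exact: h.
apply: fin_bigcap_measurable; first exact: finite_II.
by move=> i _; rewrite -[X in measurable X]setTI; exact: mY.
Qed.

Let measurable_Y_tail k : measurable_fun [set: T]
  ((fun om => (Y k om, tail_sum k.+1 om)) :
     T -> measurableTypeR R * measurableTypeR R).
Proof. by apply: measurable_fun_pair; [exact: mY|exact: measurable_tail_sum]. Qed.

(** Independence of a tail from all earlier coordinates, proved downwards from the empty tail. The
    whole prefix is carried along because the step from k + 1 to k moves coordinate k from the
    prefix into the tail. *)
Let indep k := forall B A, (forall i, measurable (B i)) -> measurable A ->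
  Pr (prefix k B `&` tail_sum k @^-1` A) = ((weight k B)%:E * mu k A)%E.

Let joint_law k B (D : set (measurableTypeR R * measurableTypeR R)) :
  indep k.+1 -> (forall i, measurable (B i)) -> measurable D ->
  Pr (prefix k B `&` [set om | D (Y k om, tail_sum k.+1 om)]) =
  ((weight k B)%:E * (gamma \x mu k.+1) D)%E.
Proof.
move=> ik mB mD; have w0 := weight_ge0 k B.
pose nu := image_measure (mrestr Pr (measurable_prefix k mB)) (measurable_Y_tail k).
pose cm := mscale (NngNum w0) (mu k.+1).
pose cgg := mscale (NngNum w0) (gamma \x mu k.+1)%E.
transitivity ((gamma \x cm)%E D); last first.
  apply: (@product_measure_unique _ _ _ _ R gamma cm cgg) => // A A' mA mA'.
  by rewrite /cgg/= /mscale/= product_measure1E// muleCA.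
rewrite (@product_measure_unique _ _ _ _ R gamma cm nu)//.
  by rewrite /nu image_measureE/= /mrestr setIC.
move=> A A' mA mA'; rewrite /nu image_measureE/= /mrestr /cm /mscale/=.
pose B' (i : nat) : set R := if i == k then A else B i.
have mB' i : measurable (B' i).
  by rewrite /B'; case: ifP => _; [exact: mA|exact: mB].
transitivity (Pr (prefix k.+1 B' `&` tail_sum k.+1 @^-1` A')).
  congr (Pr _); apply/seteqP; split => om /=.
    move=> [[hA hA'] hE]; split => // i; rewrite ltnS leq_eqVlt /B'.
    by case: eqVneq => [->//|_] /= /hE.
  move=> [h hA']; split; last first.
    by move=> i ik'; have := h i (ltnW ik'); rewrite /B' ltn_eqF.
  by split => //; have := h k (ltnSn k); rewrite /B' eqxx.
rewrite ik// /weight big_nat_recr//= {2}/B' eqxx EFinM fineK; last first.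
  by apply: fin_num_measure; exact: mA.
rewrite (_ : \prod_(0 <= i < k) fine (gamma (B' i)) = weight k B).
  by rewrite -muleA muleCA.
by apply: eq_big_nat => i /andP[_ ik']; rewrite /B' ltn_eqF.
Qed.

Let indep_tail m k : (k + m)%N = q -> indep k.
Proof.
elim: m k => [|m IH] k kq B A mB mA.
  have {}kq : k = q by rewrite -kq addn0.
  have -> : tail_sum k @^-1` A = [set om | A 0].
    by apply/seteqP; split => om /=; rewrite /tail_sum kq big_geq.
  have [A0|A0] := pselect (A 0).
    have -> : [set _ | A 0] = [set: T] by apply/seteqP; split.
    rewrite setIT prob_prefix ?kq// /mu/= /distribution/= /pushforward/=.
    rewrite (_ : _ @^-1` A = [set: T]) ?probability_setT ?mule1//.
    by apply/seteqP; split => om //= _; rewrite /tail_sum big_geq.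
  have -> : [set _ | A 0] = set0 :> set T by apply/seteqP; split.
  rewrite setI0 measure0 /mu/= /distribution/= /pushforward/=.
  rewrite (_ : _ @^-1` A = set0) ?measure0 ?mule0//.
  by apply/seteqP; split => om //=; rewrite /tail_sum kq big_geq.
have kq' : (k < q)%N by rewrite -kq addnS ltnS leq_addr.
have ik : indep k.+1 by apply: IH; rewrite addSnnS.
pose g (z : measurableTypeR R * measurableTypeR R) : measurableTypeR R :=
  lam k * z.1 ^+ 2 + z.2.
have mg : measurable_fun [set: _] g.
  apply: (@measurable_funD _ (measurableTypeR R * measurableTypeR R)%type R) => //.
  by apply: measurable_funM => //; exact: measurable_funX.
have mD : measurable (g @^-1` A).
  by rewrite -[X in measurable X]setTI; apply: mg.
have E : tail_sum k @^-1` A =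
    [set om | (g @^-1` A) (Y k om, tail_sum k.+1 om)].
  by apply/seteqP; split => om /=; rewrite /g/= -tail_sumS.
rewrite E joint_law//; congr (_ * _)%E.
(* With a trivial prefix the same identity computes [mu k A]. *)
have := joint_law ik (fun=> measurableT) mD.
rewrite /weight big1_seq; last by move=> i _; rewrite probability_setT.
rewrite mul1e => <-; rewrite /mu/= /distribution/= /pushforward/=.
rewrite E; congr (Pr _); apply/seteqP; split => om //= h.
by case: h.
Qed.

Lemma ge0_integral_tail_sum1 k (f : R * R -> \bar R) : (k < q)%N ->
  measurable_fun [set: R * R] f -> (forall z, 0 <= f z)%E ->
  (\int[Pr]_om f (Y k om, tail_sum k.+1 om) =
   \int[Pr]_om \int[gamma]_x f (x, tail_sum k.+1 om))%E.
Proof.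
move=> kq mf f0.
have ik : indep k.+1 by apply: (@indep_tail (q - k.+1)); rewrite subnKC.
have mf' : measurable_fun [set: measurableTypeR R * measurableTypeR R] f by exact: mf.
have E D : measurable D ->
    image_measure Pr (measurable_Y_tail k) D = (gamma \x mu k.+1)%E D.
  move=> mD; have := joint_law ik (fun=> measurableT) mD.
  rewrite /weight big1_seq; last by move=> i _; rewrite probability_setT.
  rewrite mul1e => <-; rewrite image_measureE.
  by congr (Pr _); apply/seteqP; split => om //= h; case: h.
transitivity (\int[image_measure Pr (measurable_Y_tail k)]_z f z)%E.
  by rewrite ge0_integral_pushforward//; exact: measurable_Y_tail.
transitivity (\int[(gamma \x mu k.+1)%E]_z f z)%E.
  by apply: eq_measure_integral => D mD _; exact: E.
rewrite fubini_tonelli2//.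
rewrite ge0_integral_distribution//.
- exact: measurable_fun_fubini_tonelli_G.
- by move=> y; apply: integral_ge0.
Qed.

Lemma ge0_integral_tail_sum2 k (g : R -> \bar R) : (k.+1 < q)%N ->
  measurable_fun [set: R] g -> (forall z, 0 <= g z)%E ->
  (\int[Pr]_om g (tail_sum k om) =
   \int[Pr]_om \int[gamma \x gamma]_z
     g (lam k * z.1 ^+ 2 + lam k.+1 * z.2 ^+ 2 + tail_sum k.+2 om)%R)%E.
Proof.
move=> kq mg g0.
pose s l (z : R * R) : R := l * z.1 ^+ 2 + z.2.
have ms l : measurable_fun [set: R * R] (s l).
  by apply: measurable_funD => //; apply: measurable_funM => //; exact: measurable_funX.
have mgs l : measurable_fun [set: R * R] (g \o s l) by exact: measurableT_comp.
pose h (w : R) := (\int[gamma]_x (g \o s (lam k)) (x, w))%E.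
have h0 w : (0 <= h w)%E by apply: integral_ge0 => x _; exact: g0.
have mh : measurable_fun [set: R] h.
  apply: (@measurable_fun_fubini_tonelli_G _ _ _ _ _ gamma (g \o s (lam k))).
  - exact: mgs.
  - by move=> z; exact: g0.
transitivity (\int[Pr]_om h (tail_sum k.+1 om))%E.
  rewrite -(ge0_integral_tail_sum1 (ltnW kq) (mgs _) (fun z => g0 _)).
  by apply: eq_integral => om _; rewrite /s/= -tail_sumS// ltnW.
transitivity (\int[Pr]_om (h \o s (lam k.+1)) (Y k.+1 om, tail_sum k.+2 om))%E.
  by apply: eq_integral => om _; rewrite /s/= -tail_sumS.
rewrite (ge0_integral_tail_sum1 kq (measurableT_comp mh (ms _)) (fun z => h0 _)).
apply: eq_integral => om _; rewrite fubini_tonelli2.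
- apply: eq_integral => y _; apply: eq_integral => x _; congr g.
  by rewrite /s/=; ring.
- apply: measurableT_comp => //; apply: measurable_funD => //.
  by apply: measurable_funD; apply: measurable_funM => //; exact: measurable_funX.
- by move=> z; exact: g0.
Qed.

End gaussian_tail_sums.

(** * Slope coordinates in the plane *)

Section polar.
Context {R : realType}.
Local Notation mu := (@lebesgue_measure R).
Local Notation gamma := (@normal_prob R 0 1).
Local Notation phi := (@normal_pdf R 0 1).

(** The joint density of x and the slope tau when (x, [|x| tau) is standard normal in the plane; the
    factor]|x| is the Jacobian. *)
Definition polar_density (tau x : R) : R :=
  (2 * pi)^-1 * (`|x| * expR (- ((1 + tau ^+ 2) / 2 * x ^+ 2))).

Lemma polar_density_ge0 tau x : 0 <= polar_density tau x.
Proof.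
by rewrite /polar_density !mulr_ge0 ?expR_ge0// invr_ge0 mulr_ge0// pi_ge0.
Qed.

Lemma measurable_polar_density :
  measurable_fun [set: R * R] (fun z : R * R => polar_density z.1 z.2).
Proof.
have m1 : measurable_fun [set: R * R] (fun z : R * R => z.1) by exact: measurable_fst.
have m2 : measurable_fun [set: R * R] (fun z : R * R => z.2) by exact: measurable_snd.
apply: measurable_funM => //; apply: measurable_funM.
  exact: measurableT_comp.
apply: measurableT_comp => //; apply: measurableT_comp => //.
apply: measurable_funM; last exact: measurable_funX.
by apply: measurable_funM => //; apply: measurable_funD => //; exact: measurable_funX.
Qed.

(* The second coordinate is written as y = `|x| tau. *)
Lemma std_normal2_polar (a b w : R) (g : R -> R) :
  measurable_fun [set: R] g -> (forall x, 0 <= g x) ->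
  (\int[gamma \x gamma]_z (g (a * z.1 ^+ 2 + b * z.2 ^+ 2 + w))%:E =
   \int[mu]_tau \int[mu]_x
     (polar_density tau x * g ((a + b * tau ^+ 2) * x ^+ 2 + w))%:E)%E.
Proof.
move=> mg g0.
have m1 : measurable_fun [set: R * R] (fun z : R * R => z.1) by exact: measurable_fst.
have m2 : measurable_fun [set: R * R] (fun z : R * R => z.2) by exact: measurable_snd.
have mq : measurable_fun [set: R * R]
    (fun z : R * R => g (a * z.1 ^+ 2 + b * z.2 ^+ 2 + w)).
  apply: measurableT_comp => //; apply: measurable_funD => //.
  by apply: measurable_funD; apply: measurable_funM => //; exact: measurable_funX.
pose F (z : R * R) : R :=
  polar_density z.2 z.1 * g ((a + b * z.2 ^+ 2) * z.1 ^+ 2 + w).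
have mF : measurable_fun [set: R * R] (EFin \o F).
  apply/measurable_EFinP; apply: measurable_funM.
    exact: (measurableT_comp measurable_polar_density (measurable_fun_pair m2 m1)).
  apply: measurableT_comp => //; apply: measurable_funD => //.
  apply: measurable_funM; last exact: measurable_funX.
  by apply: measurable_funD => //; apply: measurable_funM => //; exact: measurable_funX.
have F0 z : (0 <= (EFin \o F) z)%E.
  by rewrite lee_fin mulr_ge0// polar_density_ge0.
rewrite ge0_integral_std_normal2//; last 2 first.
- exact/measurable_EFinP.
- by move=> z; rewrite lee_fin.
transitivity (\int[mu]_x \int[mu]_tau (EFin \o F) (x, tau))%E; last first.
  exact: (@fubini_tonelli _ _ _ _ _ mu mu _ mF F0).
pose K (x : R) : \bar R :=
  (\int[mu]_y ((g (a * (x, y).1 ^+ 2 + b * (x, y).2 ^+ 2 + w))%:E *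
    (phi x * phi y)%:E))%E.
have mKy : measurable_fun [set: R * R]
    (fun z : R * R => ((g (a * z.1 ^+ 2 + b * z.2 ^+ 2 + w))%:E * (phi z.1 * phi z.2)%:E)%E).
  apply: emeasurable_funM; first exact/measurable_EFinP.
  by apply/measurable_EFinP; exact: measurable_std_normal_pdf2.
have Ky0 z : (0 <=
    (fun z : R * R => ((g (a * z.1 ^+ 2 + b * z.2 ^+ 2 + w))%:E * (phi z.1 * phi z.2)%:E)%E) z)%E.
  by rewrite mule_ge0// lee_fin// mulr_ge0// std_normal_pdf_ge0.
have mK : measurable_fun [set: R] K.
  exact: (@measurable_fun_fubini_tonelli_F _ _ _ _ _ mu _ mKy Ky0).
have mL : measurable_fun [set: R] (fun x => \int[mu]_tau (EFin \o F) (x, tau))%E.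
  exact: (@measurable_fun_fubini_tonelli_F _ _ _ _ _ mu _ mF F0).
transitivity (\int[mu]_x K x)%E; first by [].
rewrite -(@integral_setD1 R K 0 setT); last 2 first.
- exact: measurableD.
- exact: measurable_funTS.
rewrite -[RHS](@integral_setD1 R _ 0 setT); last 2 first.
- exact: measurableD.
- exact: measurable_funTS.
apply: eq_integral => x; rewrite inE => -[_ /eqP x0].
have x0' : 0 < `|x| by rewrite normr_gt0.
have mKx : measurable_fun [set: R]
    (fun y : R => ((g (a * x ^+ 2 + b * y ^+ 2 + w))%:E * (phi x * phi y)%:E)%E).
  exact: (measurableT_comp mKy (pair1_measurable x)).
have Kx0 y : (0 <= (g (a * x ^+ 2 + b * y ^+ 2 + w))%:E * (phi x * phi y)%:E)%E.
  exact: (Ky0 (x, y)).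
apply: (etrans (ge0_integral_affine 0 x0' mKx Kx0)).
rewrite -ge0_integralZl//; last first.
  exact: (measurableT_comp mKx (measurable_affine _ _)).
apply: eq_integral => y _; rewrite /F/= -!EFinM; congr EFin.
rewrite /polar_density std_normal_pdfM addr0 exprMn real_normK ?num_real//.
rewrite (_ : a * x ^+ 2 + b * (x ^+ 2 * y ^+ 2) + w =
  (a + b * y ^+ 2) * x ^+ 2 + w); last by ring.
rewrite (_ : (x ^+ 2 + x ^+ 2 * y ^+ 2) / 2 = (1 + y ^+ 2) / 2 * x ^+ 2);
  last by ring.
by ring.
Qed.

Lemma continuous_polar_density tau : continuous (polar_density tau).
Proof.
move=> x; have c1 : {for x, continuous (fun x : R => - ((1 + tau ^+ 2) / 2 * x ^+ 2))}.
  apply: (@continuousN _ R^o).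
  by apply: cvgM; [exact: cvg_cst|exact: exprn_continuous].
have c2 : {for x, continuous (fun x : R => expR (- ((1 + tau ^+ 2) / 2 * x ^+ 2)))}.
  exact: (continuous_comp c1 (@continuous_expR _ _)).
apply: cvgM; first exact: cvg_cst.
by apply: cvgM; [exact: norm_continuous|exact: c2].
Qed.

Lemma polar_density_halfline (tau : R) (h : R -> R) :
  continuous h -> (forall x, 0 <= h x) -> (forall x, h (- x) = h x) ->
  (\int[mu]_x (polar_density tau x * h x)%:E =
   \int[mu]_(x in `[0%R, +oo[)
     (pi^-1 * x * expR (- ((1 + tau ^+ 2) / 2 * x ^+ 2)) * h x)%:E)%E.
Proof.
move=> ch h0 hN; rewrite (@ge0_symfun_integralT R (fun x => polar_density tau x * h x)).
- rewrite set_itvcy -ge0_integralZl//; last 3 first.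
  + by rewrite -set_itvcy; exact: measurable_itv.
  + apply: measurable_funTS; apply/measurable_EFinP; apply: measurable_funM.
      exact: (continuous_measurable_fun (@continuous_polar_density tau)).
    exact: continuous_measurable_fun.
  + by move=> x _; rewrite lee_fin mulr_ge0// polar_density_ge0.
  apply: eq_integral => x; rewrite inE/= => x0; rewrite -EFinM; congr EFin.
  rewrite /polar_density ger0_norm// invfM.
  transitivity ((2 * 2^-1) * (pi^-1 * x * expR (- ((1 + tau ^+ 2) / 2 * x ^+ 2)) * h x)).
    by ring.
  by rewrite divff// mul1r.
- by move=> x; rewrite mulr_ge0// polar_density_ge0.
- by move=> x; apply: cvgM; [exact: continuous_polar_density|exact: ch].
- by move=> x /=; rewrite hN /polar_density normrN sqrrN.
Qed.

Let kap (tau : R) := (1 + tau ^+ 2) / 2.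

Let kap_gt0 tau : 0 < kap tau.
Proof. by rewrite divr_gt0// oneDsqr_gt0. Qed.

Let continuous_quad (b w : R) : continuous (fun x : R => b * x ^+ 2 + w).
Proof.
move=> x; apply: cvgD; last exact: cvg_cst.
by apply: cvgM; [exact: cvg_cst|exact: exprn_continuous].
Qed.

(** The slope has the Cauchy density 1 / (pi (1 + tau^2)), and given the slope x^2 is exponential
    with rate [kap tau]. So this is an exponential integral in x^2. *)
Lemma integral_polar_density_cos (tau k psi : R) :
  (\int[mu]_x (polar_density tau x * (1 + cos (k * x ^+ 2 + psi)))%:E =
   ((pi * (1 + tau ^+ 2))^-1 * (1 + (cos psi - k / kap tau * sin psi) /
      (1 + (k / kap tau) ^+ 2)))%:E)%E.
Proof.
have k0 := kap_gt0 tau; have kn0 : kap tau != 0 by rewrite gt_eqF.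
have pi0 : pi != 0 :> R by rewrite gt_eqF// pi_gt0.
rewrite (@polar_density_halfline tau (fun x => 1 + cos (k * x ^+ 2 + psi))); last 3 first.
- have c1 := @continuous_quad k psi.
  move=> x; apply: cvgD; first exact: cvg_cst.
  exact: (continuous_comp (c1 x) (@continuous_cos _ _)).
- by move=> x; rewrite -lerBlDl sub0r cos_geN1.
- by move=> x; rewrite sqrrN.
rewrite EFinM -(integral_sqr_osc (k / kap tau) psi k0) -ge0_integralZl//.
- apply: eq_integral => x _; rewrite -EFinM; congr EFin.
  rewrite -/(kap tau) (_ : k / kap tau * (kap tau * x ^+ 2) = k * x ^+ 2); last by field.
  rewrite (_ : 2 * kap tau = 1 + tau ^+ 2); last by rewrite /kap; field.
  rewrite invfM; have n0 : 1 + tau ^+ 2 != 0 by rewrite gt_eqF// oneDsqr_gt0.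
  move: (@pi R) pi0 => p p0; field.
  by rewrite n0 p0.
- apply: continuous_measurable_EFin => x.
  have c1 : continuous (fun x : R => kap tau * x ^+ 2).
    by move=> y; apply: cvgM; [exact: cvg_cst|exact: exprn_continuous].
  apply: cvgM; first by apply: cvgM => //; exact: cvg_cst.
  exact: (continuous_comp (c1 x) (@continuous_osc _ _ _ _)).
- move=> x; rewrite /= in_itv/= andbT => x0; rewrite lee_fin mulr_ge0// ?osc_ge0//.
  by rewrite mulr_ge0// mulr_ge0// ltW.
- by rewrite lee_fin invr_ge0 mulr_ge0 ?pi_ge0// ltW// oneDsqr_gt0.
Qed.

Lemma integral_polar_density (tau : R) :
  (\int[mu]_x (polar_density tau x)%:E = ((pi * (1 + tau ^+ 2))^-1)%:E)%E.
Proof.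
have := integral_polar_density_cos tau 0 (pi / 2).
rewrite cos_pihalf mul0r mul0r subrr mul0r addr0 mulr1 => <-.
by apply: eq_integral => x _; rewrite mul0r add0r cos_pihalf addr0 mulr1.
Qed.

(** The Gaussian factor is bounded by 1, so all the decay in tau has to come from b, which later
    depends on tau. *)
Lemma integral_polar_density_cauchy (tau b w e : R) : 0 < b -> 0 < e ->
  (\int[mu]_x (polar_density tau x * (1 + ((b * x ^+ 2 + w) / e) ^+ 2)^-1)%:E
   <= (e / (2 * b))%:E)%E.
Proof.
move=> b0 e0; have pi0 : 0 < pi :> R by exact: pi_gt0.
have ch : continuous (fun x : R => (1 + ((b * x ^+ 2 + w) / e) ^+ 2)^-1).
  by move=> x; exact: (continuous_comp (@continuous_quad b w x) (@continuous_cauchy _ e _)).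
rewrite (@polar_density_halfline tau (fun x => (1 + ((b * x ^+ 2 + w) / e) ^+ 2)^-1))//; last 2 first.
- by move=> x; exact: cauchy_ge0.
- by move=> x; rewrite sqrrN.
pose h x : R := 2 * b * x * (1 + ((b * x ^+ 2 + w) / e) ^+ 2)^-1.
have ch' : continuous h.
  by move=> x; apply: cvgM; [apply: cvgM => //; exact: cvg_cst|exact: ch].
have h0 x : 0 <= x -> 0 <= h x.
  by move=> x0; rewrite /h !mulr_ge0 ?cauchy_ge0// ltW.
apply: (@le_trans _ _ (\int[mu]_(x in `[0%R, +oo[) ((2 * b * pi)^-1%:E * (h x)%:E))%E).
  apply: ge0_le_integral => //.
  - move=> x; rewrite /= in_itv/= andbT => x0.
    by rewrite lee_fin !mulr_ge0 ?expR_ge0 ?cauchy_ge0// invr_ge0 ltW.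
  - apply: continuous_measurable_EFin => x.
    have c1 : {for x, continuous (fun x : R => - ((1 + tau ^+ 2) / 2 * x ^+ 2))}.
      apply: (@continuousN _ R^o).
      by apply: cvgM; [exact: cvg_cst|exact: exprn_continuous].
    apply: cvgM; last exact: ch.
    apply: cvgM; first by apply: cvgM => //; exact: cvg_cst.
    exact: (continuous_comp c1 (@continuous_expR _ _)).
  - apply: emeasurable_funM => //; exact: continuous_measurable_EFin.
  - move=> x; rewrite /= in_itv/= andbT => x0; rewrite -EFinM lee_fin /h [leRHS]mulrA.
    apply: ler_wpM2r; first exact: cauchy_ge0.
    rewrite (_ : (2 * b * pi)^-1 * (2 * b * x) = pi^-1 * x); last first.
      by move: (@pi R) pi0 => p p0; field; rewrite !gt_eqF.
    rewrite ler_piMr ?mulr_ge0// ?invr_ge0 ?(ltW pi0)//.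
    rewrite -[leRHS]expR0 ler_expR oppr_le0 mulr_ge0 ?sqr_ge0//.
    by rewrite divr_ge0// ltW// oneDsqr_gt0.
rewrite ge0_integralZl//; last 3 first.
- exact: continuous_measurable_EFin.
- by move=> x; rewrite /= in_itv/= andbT => x0; rewrite lee_fin h0.
- by rewrite lee_fin invr_ge0 !mulr_ge0// ltW.
apply: (@le_trans _ _ ((2 * b * pi)^-1%:E * (e * pi)%:E)%E).
  apply: lee_wpmul2l; last exact: integral_sqr_cauchy_le.
  by rewrite lee_fin invr_ge0 !mulr_ge0// ltW.
rewrite -EFinM lee_fin le_eqVlt; apply/orP; left; apply/eqP.
by move: (@pi R) pi0 => p p0; field; rewrite !gt_eqF.
Qed.

End polar.

Section real_facts.
Context {R : realType}.
Local Notation mu := (@lebesgue_measure R).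

Lemma integral_rationalT (a b : R) : 0 < a -> 0 < b ->
  (\int[mu]_x ((a + b * x ^+ 2)^-1)%:E = (pi / Num.sqrt (a * b))%:E)%E.
Proof.
move=> a0 b0; have ab x : 0 < a + b * x ^+ 2.
  by rewrite ltr_pwDl// mulr_ge0 ?sqr_ge0// ltW.
rewrite (@ge0_symfun_integralT R (fun x => (a + b * x ^+ 2)^-1)).
- rewrite -set_itvcy integral_rational// -EFinM; congr EFin.
  by rewrite mulrA [2 * _]mulrC divfK ?pnatr_eq0.
- by move=> x; rewrite invr_ge0 ltW.
- move=> x; apply: cvgV; first by rewrite gt_eqF.
  apply: cvgD; first exact: cvg_cst.
  by apply: cvgM; [exact: cvg_cst|exact: exprn_continuous].
- by move=> x /=; rewrite sqrrN.
Qed.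

Lemma integral_probability_cst d (T : measurableType d) (Pr : probability T R)
    (r : R) : (\int[Pr]_om r%:E = r%:E)%E.
Proof. by rewrite integral_cst//= probability_setT mule1. Qed.

(** Amplitude and phase: integrating out one pair multiplies the cosine by a factor at most 1 and
    shifts its phase by atan k. The result is again a cosine, so pairs can be removed one after the
    other. *)
Lemma cos_phase (k psi : R) :
  (cos psi - k * sin psi) / (1 + k ^+ 2) =
  (Num.sqrt (1 + k ^+ 2))^-1 * cos (psi + atan k).
Proof.
have k0 : 0 < 1 + k ^+ 2 by exact: oneDsqr_gt0.
have s0 : Num.sqrt (1 + k ^+ 2) != 0 by rewrite gt_eqF// sqrtr_gt0.
have -> : cos (psi + atan k) = (Num.sqrt (1 + k ^+ 2))^-1 * (cos psi - k * sin psi).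
  have c0 : cos (atan k) != 0 by rewrite cos_atan invr_eq0.
  have sE : sin (atan k) = k * cos (atan k).
    by rewrite -{2}[k]atanK /tan divfK.
  by rewrite cosD sE cos_atan; ring.
rewrite mulrA -invfM -expr2 sqr_sqrtr ?(ltW k0)//.
by rewrite mulrC.
Qed.

(** The product is at least 1 + e_1 + e_2, with e_1 = S and e_2 = (S^2 - sum of x_j^2) / 2 the
    elementary symmetric sums. When no x_j exceeds S / 2, the sum of squares is at most S^2 / 2,
    hence e_2 >= S^2 / 4 and the square is complete. *)
Lemma prod1D_ge_sqr (m : nat) (x : nat -> R) : (forall j, 0 <= x j) ->
  (forall j, (j < m)%N -> 2 * x j <= \sum_(i < m) x i) ->
  (1 + (\sum_(j < m) x j) / 2) ^+ 2 <= \prod_(j < m) (1 + x j).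
Proof.
move=> x0 xS; set S := \sum_(j < m) x j.
have H n : 1 + \sum_(j < n) x j +
    ((\sum_(j < n) x j) ^+ 2 - \sum_(j < n) x j ^+ 2) / 2 <= \prod_(j < n) (1 + x j)
    /\ \sum_(j < n) x j ^+ 2 <= (\sum_(j < n) x j) ^+ 2.
  elim: n => [|n [IH1 IH2]].
    by rewrite !big_ord0 expr0n/= subr0 mul0r !addr0.
  rewrite !big_ord_recr/=; move: IH1 IH2.
  set A := \sum_(j < n) x j; set B := \sum_(j < n) x j ^+ 2.
  set P := \prod_(j < n) _; move=> IH1 IH2.
  have A0 : 0 <= A by rewrite sumr_ge0.
  have xn := x0 n; split; last by nra.
  have : (1 + A + (A ^+ 2 - B) / 2) * (1 + x n) <= P * (1 + x n).
    by rewrite ler_wpM2r// addr_ge0.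
  by apply: le_trans; nra.
have [h1 _] := H m; apply: le_trans h1.
have : \sum_(j < m) x j ^+ 2 <= S / 2 * S.
  rewrite -/S mulr_sumr; apply: ler_sum => j _.
  rewrite expr2 ler_wpM2r//; have := xS j (ltn_ord j).
  by rewrite -/S; lra.
rewrite -/S; set B := \sum_(j < m) _; move=> hB.
nra.
Qed.

(** 81 is 3^4. In both cases of the anti-concentration bound, M is the product of the two sums of
    squares and u the product of the two scales. *)
Lemma inv_sqrt_le_powR (u M : R) : 0 < u -> 0 < M -> M <= 81 * u ^+ 2 ->
  (Num.sqrt u)^-1 <= 3 * M `^ (- 4^-1).
Proof.
move=> u0 M0 Mu; have su : 0 < Num.sqrt u by rewrite sqrtr_gt0.
have p0 : 0 < M `^ (4^-1) by exact: powR_gt0.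
have h : M `^ (4^-1) <= 3 * Num.sqrt u.
  rewrite -(@ler_pXn2r _ 4)// ?nnegrE ?(ltW p0)//.
  rewrite -powR_mulrn ?powR_ge0// -powRrM mulVf ?pnatr_eq0// powRr1 ?(ltW M0)//.
  apply: le_trans Mu _; rewrite exprMn le_eqVlt; apply/orP; left; apply/eqP.
  rewrite -[in LHS](sqr_sqrtr (ltW u0)) -exprM; ring.
by rewrite powRN ler_pdivlMr// mulrC ler_pdivrMr.
Qed.

(** Adding 2 l y <= e and 2 s y <= e replaces the minimum of two bounds by a single one that is
    rational in tau and can be integrated in closed form. *)
Lemma harmonic_le (y l s e : R) : 0 < l -> 0 < s ->
  y <= e / (2 * l) -> y <= e / (2 * s) -> y <= e * (l + s)^-1.
Proof.
move=> l0 s0; rewrite !ler_pdivlMr ?mulr_gt0 ?addr_gt0//; lra.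
Qed.

End real_facts.

(** * Characteristic functions and the window probability *)

Section gaussian_concentration.
Context {R : realType} d (T : measurableType d) (Pr : probability T R).
Local Notation gamma := (@normal_prob R 0 1).
Local Notation mu := (@lebesgue_measure R).
Variables (q : nat) (Y : nat -> T -> R) (lam : nat -> R).
Hypothesis mY : forall i, measurable_fun [set: T] (Y i).
Hypothesis gY : forall B : nat -> set R, (forall i, measurable (B i)) ->
  Pr [set om | forall i, (i < q)%N -> B i (Y i om)] =
  (\prod_(0 <= i < q) gamma (B i))%E.
Hypothesis lam0 : forall i, 0 <= lam i.
Hypothesis lamS : forall i, lam i.+1 <= lam i.
Local Notation W := (tail_sum q Y lam).

Let polar_fun k (g : R -> R) (z : T * R * R) : R :=
  polar_density z.1.2 z.2 *
  g ((lam k + lam k.+1 * z.1.2 ^+ 2) * z.2 ^+ 2 + W k.+2 z.1.1).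

Let measurable_polar_fun k g : measurable_fun [set: R] g ->
  measurable_fun [set: T * R * R] (polar_fun k g).
Proof.
move=> mg.
have m12 : measurable_fun [set: T * R * R] (fun z : T * R * R => z.1.2).
  exact: (measurableT_comp measurable_snd measurable_fst).
have m11 : measurable_fun [set: T * R * R] (fun z : T * R * R => z.1.1).
  exact: (measurableT_comp measurable_fst measurable_fst).
have m2 : measurable_fun [set: T * R * R] (fun z : T * R * R => z.2) by exact: measurable_snd.
apply: measurable_funM.
  exact: (measurableT_comp measurable_polar_density (measurable_fun_pair m12 m2)).
apply: measurableT_comp => //; apply: measurable_funD; last first.
  by apply: measurableT_comp => //; exact: measurable_tail_sum.
apply: measurable_funM; last exact: measurable_funX.
by apply: measurable_funD => //; apply: measurable_funM => //; exact: measurable_funX.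
Qed.

Let polar_fun_ge0 k g z : (forall x, 0 <= g x) -> 0 <= polar_fun k g z.
Proof. by move=> g0; rewrite mulr_ge0// polar_density_ge0. Qed.

(** The slope is moved outermost because all later estimates are made at a fixed tau, averaging over
    x and the remaining coordinates in either order. *)
Lemma tail_sum_polar k (g : R -> R) : (k.+1 < q)%N ->
  measurable_fun [set: R] g -> (forall x, 0 <= g x) ->
  (\int[Pr]_om (g (W k om))%:E =
   \int[mu]_tau \int[Pr]_om \int[mu]_x (polar_density tau x *
     g ((lam k + lam k.+1 * tau ^+ 2) * x ^+ 2 + W k.+2 om))%:E)%E.
Proof.
move=> kq mg g0.
rewrite (@ge0_integral_tail_sum2 _ _ _ Pr q Y lam mY gY k (EFin \o g) kq)//;
  last exact/measurable_EFinP.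
have mF : measurable_fun [set: T * R * R] (EFin \o polar_fun k g).
  by apply/measurable_EFinP; exact: measurable_polar_fun.
have F0 z : (0 <= (EFin \o polar_fun k g) z)%E by rewrite lee_fin polar_fun_ge0.
pose H (z : T * R) := (\int[mu]_x (EFin \o polar_fun k g) (z, x))%E.
have mH : measurable_fun [set: T * R] H.
  exact: (@measurable_fun_fubini_tonelli_F _ _ _ _ _ mu _ mF F0).
have H0 z : (0 <= H z)%E by apply: integral_ge0.
transitivity (\int[Pr]_om \int[mu]_tau H (om, tau))%E.
  by apply: eq_integral => om _; exact: std_normal2_polar.
exact: (@fubini_tonelli _ _ _ _ _ Pr mu _ mH H0).
Qed.

(* Each pair (k + 2j, k + 2j + 1) contributes through its smaller eigenvalue. *)
Definition char_bound (m k : nat) (t : R) : R :=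
  \prod_(j < m) (Num.sqrt (1 + (2 * t * lam (k + j.*2).+1) ^+ 2))^-1.

Lemma char_bound_ge0 m k t : 0 <= char_bound m k t.
Proof. by apply: prodr_ge0 => j _; rewrite invr_ge0 sqrtr_ge0. Qed.

Let char_boundS m k t : char_bound m.+1 k t =
  (Num.sqrt (1 + (2 * t * lam k.+1) ^+ 2))^-1 * char_bound m k.+2 t.
Proof.
rewrite /char_bound big_ord_recl/= addn0; congr (_ * _).
by apply: eq_bigr => j _; rewrite /bump/= doubleS !addnS !addSn.
Qed.

Let measurable_1Dcos (t a : R) : measurable_fun [set: R] (fun v => 1 + cos (t * v + a)).
Proof.
apply: measurable_funD => //; apply: measurableT_comp.
  exact: continuous_measurable_fun (@continuous_cos _).
by apply: measurable_funD => //; exact: measurable_funM.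
Qed.

Let cos1D_ge0 (x : R) : 0 <= 1 + cos x.
Proof. by rewrite -lerBlDl sub0r cos_geN1. Qed.

(** Stated for every phase a, this bounds the modulus of the characteristic function of the tail.
    The induction uses the freedom in a: removing a pair leaves the phase a + atan kp. *)
Lemma tail_sum_char_bound m k t a : (k + m.*2 <= q)%N ->
  (\int[Pr]_om (1 + cos (t * W k om + a))%:E <= (1 + char_bound m k t)%:E)%E.
Proof.
elim: m k a => [|m IH] k a.
  move=> _; rewrite /char_bound big_ord0.
  apply: (@le_trans _ _ (\int[Pr]_om (1 + 1 : R)%:E)%E).
    apply: ge0_le_integral => //.
    - apply/measurable_EFinP.
      exact: (measurableT_comp (measurable_1Dcos t a) (measurable_tail_sum q lam mY k)).
    - by move=> om _; rewrite lee_fin lerD2l cos_le1.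
  by rewrite integral_probability_cst.
rewrite doubleS => kq.
have kq' : (k.+1 < q)%N by apply: leq_trans kq; rewrite !addnS !ltnS leq_addr.
have kq2 : (k.+2 + m.*2 <= q)%N by rewrite !addSn -!addnS.
rewrite (tail_sum_polar kq' (measurable_1Dcos t a))//.
rewrite char_boundS.
have pq0 (x : R) : 0 < pi + pi * x ^+ 2.
  by rewrite ltr_pwDl ?pi_gt0// mulr_ge0 ?pi_ge0 ?sqr_ge0.
set b := lam k.+1; set P := char_bound m k.+2 t.
have P0 : 0 <= P by exact: char_bound_ge0.
set rb := (Num.sqrt _)^-1.
have rb0 : 0 <= rb by rewrite invr_ge0 sqrtr_ge0.
apply: (@le_trans _ _ (\int[mu]_tau ((1 + rb * P)%:E * ((pi + pi * tau ^+ 2)^-1)%:E))%E);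
  last first.
  rewrite ge0_integralZl//; last 3 first.
  - apply: continuous_measurable_EFin => x.
    apply: cvgV; first by rewrite gt_eqF.
    apply: cvgD; first exact: cvg_cst.
    by apply: cvgM; [exact: cvg_cst|exact: exprn_continuous].
  - by move=> x _; rewrite lee_fin invr_ge0 ltW.
  - by rewrite lee_fin addr_ge0// mulr_ge0.
  rewrite integral_rationalT ?pi_gt0// -expr2 sqrtr_sqr gtr0_norm ?pi_gt0//.
  by rewrite divff ?mule1// gt_eqF// pi_gt0.
have mF : measurable_fun [set: T * R * R] (EFin \o polar_fun k (fun v => 1 + cos (t * v + a))).
  by apply/measurable_EFinP; exact: measurable_polar_fun.
have F0 z : (0 <= (EFin \o polar_fun k (fun v => 1 + cos (t * v + a))%R) z)%E.
  by rewrite lee_fin polar_fun_ge0.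
pose H (z : T * R) := (\int[mu]_x (EFin \o polar_fun k (fun v => 1 + cos (t * v + a))%R) (z, x))%E.
have mH : measurable_fun [set: T * R] H.
  exact: (@measurable_fun_fubini_tonelli_F _ _ _ _ _ mu _ mF F0).
have H0 z : (0 <= H z)%E by apply: integral_ge0.
apply: ge0_le_integral => //.
- by move=> tau _; apply: integral_ge0 => om _; exact: (H0 (om, tau)).
- exact: (@measurable_fun_fubini_tonelli_G _ _ _ _ _ Pr _ mH H0).
- apply: emeasurable_funM => //; apply: continuous_measurable_EFin => x.
  apply: cvgV; first by rewrite gt_eqF.
  apply: cvgD; first exact: cvg_cst.
  by apply: cvgM; [exact: cvg_cst|exact: exprn_continuous].
move=> tau _.
have t0 : 0 < 1 + tau ^+ 2 by exact: oneDsqr_gt0.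
have pt0 : 0 <= (pi * (1 + tau ^+ 2))^-1 :> R.
  by rewrite invr_ge0 mulr_ge0 ?pi_ge0// ltW.
pose kp := t * (lam k + lam k.+1 * tau ^+ 2) / ((1 + tau ^+ 2) / 2).
pose r := (Num.sqrt (1 + kp ^+ 2))^-1.
have r0 : 0 <= r by rewrite invr_ge0 sqrtr_ge0.
have r1 : r <= 1.
  rewrite invf_le1 ?sqrtr_gt0 ?oneDsqr_gt0// -[leLHS]sqrtr1 ler_wsqrtr//.
  by rewrite lerDl sqr_ge0.
(* kp is 2 t times a weighted mean of [lam k] and [lam k.+1], so replacing the mean by the smaller
   eigenvalue gives a factor independent of tau. *)
have rrb : r <= rb.
  rewrite /r /rb lef_pV2 ?posrE ?sqrtr_gt0 ?oneDsqr_gt0//.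
  rewrite ler_wsqrtr// lerD2l.
  have -> : 2 * t * b = t * (2 * b) by ring.
  have -> : kp = t * ((lam k + b * tau ^+ 2) / ((1 + tau ^+ 2) / 2)).
    by rewrite /kp mulrA.
  rewrite (exprMn _ t) (exprMn _ t).
  apply: ler_wpM2l; first exact: sqr_ge0.
  have b0 : 0 <= b by exact: lam0.
  have bl : b <= lam k by exact: lamS.
  have h0 : 2 * b <= (lam k + b * tau ^+ 2) / ((1 + tau ^+ 2) / 2).
    by rewrite ler_pdivlMr ?divr_gt0//; lra.
  by rewrite ler_pXn2r// nnegrE; [apply: mulr_ge0|apply: le_trans h0; apply: mulr_ge0].
have mW a' : measurable_fun [set: T] (fun om => (1 + cos (t * W k.+2 om + a'))%:E).
  apply/measurable_EFinP.
  exact: (measurableT_comp (measurable_1Dcos t a') (measurable_tail_sum q lam mY _)).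
have := IH k.+2 (a + atan kp) kq2; rewrite -/P.
set J := (\int[Pr]_om _)%E => JP.
(* Writing 1 + r cos u as (1 - r) + r (1 + cos u), with r <= 1, keeps each term nonnegative. *)
apply: (@le_trans _ _ (((pi * (1 + tau ^+ 2))^-1)%:E * ((1 - r)%:E + r%:E * J))%E).
  rewrite le_eqVlt; apply/orP; left; apply/eqP.
  rewrite /J -ge0_integralZl//.
  have -> : ((1 - r)%:E = \int[Pr]_om (1 - r)%:E)%E.
    by rewrite integral_probability_cst.
  rewrite -ge0_integralD//; last 3 first.
  - by move=> om _; rewrite lee_fin subr_ge0.
  - by move=> om _; rewrite mule_ge0// lee_fin.
  - exact: emeasurable_funM.
  rewrite -ge0_integralZl//; last 2 first.
  - by apply: emeasurable_funD => //; exact: emeasurable_funM.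
  - by move=> om _; rewrite adde_ge0 ?mule_ge0// lee_fin// subr_ge0.
  apply: eq_integral => om _.
  transitivity (\int[mu]_x (polar_density tau x * (1 +
      cos (t * (lam k + lam k.+1 * tau ^+ 2) * x ^+ 2 + (t * W k.+2 om + a))))%:E)%E.
    by apply: eq_integral => x _; congr (_ * (1 + cos _))%:E; rewrite /b; ring.
  apply: (etrans (integral_polar_density_cos _ _ _)); congr EFin.
  rewrite -/kp cos_phase -/r addrA.
  by move: (cos _) => u; ring.
rewrite muleC (_ : pi + pi * tau ^+ 2 = pi * (1 + tau ^+ 2)); last by rewrite mulrDr mulr1.
apply: lee_wpmul2r; first by rewrite lee_fin.
apply: (@le_trans _ _ ((1 - r)%:E + r%:E * (1 + P)%:E)%E).
  by rewrite leeD2l// lee_wpmul2l// lee_fin.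
rewrite -EFinM -EFinD lee_fin.
have : r * P <= rb * P by rewrite ler_wpM2r.
by lra.
Qed.

Let pair_energy m k : R := \sum_(j < m) lam (k + j.*2).+1 ^+ 2.

(** The hypothesis says that no pair carries more than half of the energy. It turns factors that
    decay like 1/t each into a quadratic decay governed by the whole energy, through
    [prod1D_ge_sqr]. *)
Lemma char_bound_le m k t :
  (forall j, (j < m)%N -> 2 * lam (k + j.*2).+1 ^+ 2 <= pair_energy m k) ->
  char_bound m k t <= (1 + 2 * pair_energy m k * t ^+ 2)^-1.
Proof.
move=> hS; set S1 := pair_energy m k.
pose x j := (2 * t * lam (k + j.*2).+1) ^+ 2.
have x0 j : 0 <= x j by exact: sqr_ge0.
have xE j : x j = 4 * t ^+ 2 * lam (k + j.*2).+1 ^+ 2 by rewrite /x; ring.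
have SE : \sum_(j < m) x j = 4 * t ^+ 2 * S1.
  by rewrite /S1 mulr_sumr; apply: eq_bigr => j _.
have S10 : 0 <= S1 by apply: sumr_ge0 => j _; exact: sqr_ge0.
have H : (1 + (\sum_(j < m) x j) / 2) ^+ 2 <= \prod_(j < m) (1 + x j).
  apply: prod1D_ge_sqr => // j jm; rewrite SE xE.
  rewrite (mulrCA 2); apply: ler_wpM2l; last exact: hS.
  by rewrite mulr_ge0// sqr_ge0.
have -> : char_bound m k t = (Num.sqrt (\prod_(j < m) (1 + x j)))^-1.
  rewrite /char_bound; elim/big_rec2: _ => [|j y1 y2 _ ->].
    by rewrite sqrtr1 invr1.
  by rewrite sqrtrM ?invfM// ltW// oneDsqr_gt0.
have h0 : 0 < 1 + 2 * S1 * t ^+ 2.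
  by rewrite ltr_pwDl// mulr_ge0 ?sqr_ge0// mulr_ge0.
have -> : 1 + 2 * S1 * t ^+ 2 = Num.sqrt ((1 + (\sum_(j < m) x j) / 2) ^+ 2).
  have E : 1 + (\sum_(j < m) x j) / 2 = 1 + 2 * S1 * t ^+ 2 by rewrite SE; field.
  by rewrite E sqrtr_sqr gtr0_norm.
rewrite lef_pV2 ?posrE ?sqrtr_gt0; first exact: ler_wsqrtr.
- by apply: prodr_gt0 => j _; exact: oneDsqr_gt0.
- have E : 1 + (\sum_(j < m) x j) / 2 = 1 + 2 * S1 * t ^+ 2 by rewrite SE; field.
  by rewrite E exprn_gt0.
Qed.

(** The exponential density, extended by 0 so that it can be exchanged with the expectation over the
    whole line. *)
Let expd (s : R) : R := \1_(`[0, +oo[ : set R) s * expR (- s).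

Let expd_ge0 s : 0 <= expd s.
Proof. by rewrite mulr_ge0 ?expR_ge0. Qed.

Let measurable_expd : measurable_fun [set: R] expd.
Proof.
apply: measurable_funM; first exact: measurable_indic.
exact: continuous_measurable_fun continuous_expRN.
Qed.

Let integral_expd (h : R -> R) :
  (\int[mu]_s (expd s * h s)%:E = \int[mu]_(s in `[0%R, +oo[) (expR (- s) * h s)%:E)%E.
Proof.
rewrite [RHS]integral_mkcond; apply: eq_integral => s _.
rewrite patchE /expd indicE; case: ifPn => _; first by rewrite mul1r.
by rewrite !mul0r.
Qed.

Let integral_expd_cos (y : R) :
  ((1 + (1 + y ^+ 2)^-1)%:E = \int[mu]_s (expd s * (1 + cos (y * s)))%:E)%E.
Proof.
rewrite (integral_expd (fun s => 1 + cos (y * s))).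
have := integral_osc y 0; rewrite cos0 sin0 mulr0 subr0 mul1r => <-.
by apply: eq_integral => s _; rewrite addr0.
Qed.

(* 1 / (1 + y^2) is the cosine transform of the exponential density, so the *)
(* bound on the characteristic function integrates to a concentration bound. *)
Lemma tail_sum_cauchy m k w e : (k + m.*2 <= q)%N -> 0 < e ->
  0 < pair_energy m k ->
  (forall j, (j < m)%N -> 2 * lam (k + j.*2).+1 ^+ 2 <= pair_energy m k) ->
  (\int[Pr]_om ((1 + ((W k om + w) / e) ^+ 2)^-1)%:E <=
   (pi / 2 * e / Num.sqrt (2 * pair_energy m k))%:E)%E.
Proof.
move=> kq e0 S10 hS; set S1 := pair_energy m k.
have mW : measurable_fun [set: T] (fun om => (W k om + w) / e).
  apply: measurable_funM => //; apply: measurable_funD => //.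
  exact: measurable_tail_sum.
have mK : measurable_fun [set: T] (fun om => ((1 + ((W k om + w) / e) ^+ 2)^-1)%:E).
  have mk : measurable_fun [set: R] (fun x : R => (1 + (x / 1) ^+ 2)^-1).
    exact: continuous_measurable_fun (@continuous_cauchy R 1).
  apply/measurable_EFinP.
  by have := measurableT_comp mk mW; apply: eq_measurable_fun => om _ /=; rewrite divr1.
pose F (z : T * R) : R := expd z.2 * (1 + cos ((W k z.1 + w) / e * z.2)).
have mF : measurable_fun [set: T * R] (EFin \o F).
  apply/measurable_EFinP; apply: measurable_funM.
    exact: (measurableT_comp measurable_expd measurable_snd).
  apply: measurable_funD => //; apply: measurableT_comp.
    exact: continuous_measurable_fun (@continuous_cos _).
  apply: measurable_funM; last exact: measurable_snd.
  exact: (measurableT_comp mW measurable_fst).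
have F0 z : (0 <= (EFin \o F) z)%E by rewrite lee_fin mulr_ge0.
(* Adding 1 to both sides turns the kernel into the transform of 1 + cos. *)
rewrite -(@leeD2lE _ 1%:E)//.
apply: (@le_trans _ _ (\int[Pr]_om \int[mu]_s (EFin \o F) (om, s))%E).
  rewrite le_eqVlt; apply/orP; left; apply/eqP.
  rewrite -{1}(integral_probability_cst Pr 1) -ge0_integralD//; last first.
    by move=> om _; rewrite lee_fin cauchy_ge0.
  apply: eq_integral => om _; rewrite -EFinD.
  exact: integral_expd_cos.
rewrite (@fubini_tonelli _ _ _ _ _ Pr mu _ mF F0).
pose c := 2 * S1 / e ^+ 2.
have c0 : 0 < c by rewrite divr_gt0 ?exprn_gt0// mulr_gt0.
have mc : measurable_fun [set: R] (fun s : R => (1 + c * s ^+ 2)^-1).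
  apply: continuous_measurable_fun => x; apply: cvgV.
    by rewrite gt_eqF// ltr_pwDl// mulr_ge0 ?sqr_ge0// ltW.
  apply: cvgD; first exact: cvg_cst.
  by apply: cvgM; [exact: cvg_cst|exact: exprn_continuous].
have cs0 s : 0 <= (1 + c * s ^+ 2)^-1.
  by rewrite invr_ge0 addr_ge0// mulr_ge0 ?sqr_ge0// ltW.
apply: (@le_trans _ _ (\int[mu]_s ((expd s)%:E +
    (\1_(`[0, +oo[ : set R) s * (1 + c * s ^+ 2)^-1)%:E))%E).
  apply: ge0_le_integral => //.
  - by move=> s _; apply: integral_ge0 => om _; exact: F0.
  - exact: (@measurable_fun_fubini_tonelli_G _ _ _ _ _ Pr _ mF F0).
  - apply: emeasurable_funD; apply/measurable_EFinP => //.
    by apply: measurable_funM => //; exact: measurable_indic.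
  move=> s _.
  apply: (@le_trans _ _ ((expd s)%:E * \int[Pr]_om (1 + cos (s / e * W k om + s / e * w))%:E)%E).
    rewrite -ge0_integralZl//; last 2 first.
    - apply/measurable_EFinP.
      exact: (measurableT_comp (measurable_1Dcos _ _) (measurable_tail_sum q lam mY k)).
    - by rewrite lee_fin.
    rewrite le_eqVlt; apply/orP; left; apply/eqP; apply: eq_integral => om _.
    by rewrite -EFinM /F/=; congr (_ * (1 + cos _))%:E; ring.
  apply: (@le_trans _ _ ((expd s)%:E * (1 + char_bound m k (s / e))%:E)%E).
    by rewrite lee_wpmul2l ?lee_fin//; exact: tail_sum_char_bound.
  rewrite -EFinM -EFinD lee_fin mulrDr mulr1 lerD2l.
  have cb : char_bound m k (s / e) <= (1 + c * s ^+ 2)^-1.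
    apply: le_trans (char_bound_le _ hS) _.
    rewrite le_eqVlt; apply/orP; left; apply/eqP; congr (_^-1); congr (1 + _).
    by rewrite /c -/S1 expr_div_n; field; rewrite gt_eqF.
  rewrite /expd -mulrA indicE mem_setE in_itv/= andbT.
  have [s0|s0] := leP 0 s; last by rewrite !mul0r.
  (* The exponential is bounded by 1. The quadratic decay alone makes the integral finite and, since
     c is proportional to 1 / e^2, linear in e. *)
  rewrite !mul1r; apply: le_trans cb; rewrite ler_piMl ?char_bound_ge0//.
  by rewrite -[leRHS]expR0 ler_expR oppr_le0.
rewrite ge0_integralD//; last 4 first.
- by move=> s _; rewrite lee_fin.
- exact/measurable_EFinP.
- by move=> s _; rewrite lee_fin mulr_ge0.
- by apply/measurable_EFinP; apply: measurable_funM => //; exact: measurable_indic.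
apply: leeD.
  rewrite (_ : (\int[_]_s _)%E = \int[mu]_s (expd s * 1)%:E)%E; last first.
    by apply: eq_integral => s _; rewrite mulr1.
  rewrite (integral_expd (fun=> 1)) -integral_expRN le_eqVlt; apply/orP; left.
  by apply/eqP; apply: eq_integral => s _; rewrite mulr1.
rewrite (_ : (\int[_]_s _)%E = \int[mu]_(s in `[0%R, +oo[) ((1 + c * s ^+ 2)^-1)%:E)%E;
  last first.
  rewrite [RHS]integral_mkcond; apply: eq_integral => s _.
  by rewrite patchE indicE; case: ifPn => _; rewrite ?mul1r ?mul0r.
rewrite integral_rational// mul1r lee_fin le_eqVlt; apply/orP; left; apply/eqP.
have -> : Num.sqrt c = Num.sqrt (2 * S1) / e.
  by rewrite /c sqrtrM ?mulr_ge0 ?(ltW S10)// sqrtrV ?exprn_ge0 ?(ltW e0)// sqrtr_sqr gtr0_norm.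
by rewrite invfM invrK; ring.
Qed.

(** Integrating over the slope turns the two scales a and b into the inverse of their geometric
    mean. *)
Let polar_bound k (g : R -> R) (C a b : R) : (k.+1 < q)%N ->
  measurable_fun [set: R] g -> (forall x, 0 <= g x) ->
  0 <= C -> 0 < a -> 0 < b ->
  (forall tau, \int[Pr]_om \int[mu]_x (EFin \o polar_fun k g) (om, tau, x) <=
     (C * (a + b * tau ^+ 2)^-1)%:E)%E ->
  (\int[Pr]_om (g (W k om))%:E <= (C * (pi / Num.sqrt (a * b)))%:E)%E.
Proof.
move=> kq mg g0 C0 a0 b0 H.
have mF : measurable_fun [set: T * R * R] (EFin \o polar_fun k g).
  by apply/measurable_EFinP; exact: measurable_polar_fun.
have F0 z : (0 <= (EFin \o polar_fun k g) z)%E by rewrite lee_fin polar_fun_ge0.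
pose h (z : T * R) := (\int[mu]_x (EFin \o polar_fun k g) (z, x))%E.
have mh : measurable_fun [set: T * R] h.
  exact: (@measurable_fun_fubini_tonelli_F _ _ _ _ _ mu _ mF F0).
have h0 z : (0 <= h z)%E by apply: integral_ge0.
have mab : measurable_fun [set: R] (fun x : R => ((a + b * x ^+ 2)^-1)%:E).
  apply: continuous_measurable_EFin => x.
  apply: cvgV; first by rewrite gt_eqF// ltr_pwDl// mulr_ge0 ?sqr_ge0// ltW.
  apply: cvgD; first exact: cvg_cst.
  by apply: cvgM; [exact: cvg_cst|exact: exprn_continuous].
have ab0 (x : R) : 0 <= (a + b * x ^+ 2)^-1.
  by rewrite invr_ge0 addr_ge0 ?(ltW a0)// mulr_ge0 ?sqr_ge0 ?(ltW b0).
rewrite (tail_sum_polar kq mg g0) EFinM -integral_rationalT// -ge0_integralZl//.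
- apply: ge0_le_integral => //.
  + by move=> tau _; apply: integral_ge0 => om _; exact: (h0 (om, tau)).
  + exact: (@measurable_fun_fubini_tonelli_G _ _ _ _ _ Pr _ mh h0).
  + exact: emeasurable_funM.
  + by move=> tau _; rewrite -EFinM; exact: H.
- by move=> x _; rewrite lee_fin.
Qed.

Let cauchy_kernel (w e v : R) : R := (1 + ((v + w) / e) ^+ 2)^-1.

Let measurable_cauchy_kernel w e : measurable_fun [set: R] (cauchy_kernel w e).
Proof.
have mk : measurable_fun [set: R] (fun x : R => (1 + (x / e) ^+ 2)^-1).
  exact: continuous_measurable_fun (@continuous_cauchy R e).
have ms : measurable_fun [set: R] (fun v : R => v + w).
  by apply: measurable_funD.
exact: (measurableT_comp mk ms).
Qed.

Let polar_cauchy_le w e tau om : 0 < e -> 0 < lam 0 ->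
  (\int[mu]_x (EFin \o polar_fun 0 (cauchy_kernel w e)) (om, tau, x) <=
   (e / (2 * (lam 0%N + lam 1%N * tau ^+ 2)))%:E)%E.
Proof.
move=> e0 l0; apply: le_trans (integral_polar_density_cauchy tau (W 2 om + w) _ e0).
  rewrite le_eqVlt; apply/orP; left; apply/eqP; apply: eq_integral => x _.
  by rewrite /polar_fun /cauchy_kernel/= addrA.
by rewrite ltr_pwDl// mulr_ge0 ?sqr_ge0.
Qed.

(** Only the first pair is used: the other coordinates act as a shift, and the bound at fixed slope
    is uniform in the shift. *)
Lemma concentration_two w e : (1 < q)%N -> 0 < e -> 0 < lam 1 ->
  (\int[Pr]_om (cauchy_kernel w e (W 0 om))%:E <=
   (e / 2 * (pi / Num.sqrt (lam 0%N * lam 1%N)))%:E)%E.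
Proof.
move=> q1 e0 l1; have l0 : 0 < lam 0 by exact: lt_le_trans (lamS 0).
apply: polar_bound => //; first by move=> x; exact: cauchy_ge0.
  by rewrite divr_ge0// ltW.
move=> tau; apply: (@le_trans _ _ (\int[Pr]_om (e / 2 * (lam 0%N + lam 1%N * tau ^+ 2)^-1)%:E)%E);
  last by rewrite integral_probability_cst.
have mF : measurable_fun [set: T * R * R] (EFin \o polar_fun 0 (cauchy_kernel w e)).
  by apply/measurable_EFinP; exact: measurable_polar_fun.
have F0 z : (0 <= (EFin \o polar_fun 0 (cauchy_kernel w e)) z)%E.
  by rewrite lee_fin polar_fun_ge0// => x; exact: cauchy_ge0.
pose h (z : T * R) := (\int[mu]_x (EFin \o polar_fun 0 (cauchy_kernel w e)) (z, x))%E.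
have mh : measurable_fun [set: T * R] h.
  exact: (@measurable_fun_fubini_tonelli_F _ _ _ _ _ mu _ mF F0).
apply: ge0_le_integral => //.
- by move=> om _; apply: integral_ge0 => x _; exact: F0.
- exact: (measurableT_comp mh (pair2_measurable tau)).
- by move=> om _; rewrite -mulrA -invfM; exact: polar_cauchy_le.
Qed.

(** At a fixed slope there are two bounds, one from the randomness of x and one from the remaining
    coordinates. The first sees [lam 0], the second sees the energy and decays in tau; [harmonic_le]
    merges them. *)
Lemma concentration_many m w e : (2 + m.*2 <= q)%N -> 0 < e -> 0 < lam 0 ->
  0 < pair_energy m 2 ->
  (forall j, (j < m)%N -> 2 * lam (2 + j.*2).+1 ^+ 2 <= pair_energy m 2) ->
  (\int[Pr]_om (cauchy_kernel w e (W 0 om))%:E <=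
   (e * (pi / Num.sqrt ((lam 0%N + Num.sqrt (2 * pair_energy m 2)) *
      Num.sqrt (2 * pair_energy m 2))))%:E)%E.
Proof.
move=> mq e0 l0 S0 hS; set sigma := Num.sqrt (2 * pair_energy m 2).
have sg0 : 0 < sigma by rewrite sqrtr_gt0 mulr_gt0.
have q1 : (1 < q)%N by apply: leq_trans mq; rewrite leq_addr.
apply: polar_bound => //.
- by move=> x; exact: cauchy_ge0.
- exact: ltW.
- exact: addr_gt0.
have mF : measurable_fun [set: T * R * R] (EFin \o polar_fun 0 (cauchy_kernel w e)).
  by apply/measurable_EFinP; exact: measurable_polar_fun.
have F0 z : (0 <= (EFin \o polar_fun 0 (cauchy_kernel w e)) z)%E.
  by rewrite lee_fin polar_fun_ge0// => x; exact: cauchy_ge0.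
pose h (z : T * R) := (\int[mu]_x (EFin \o polar_fun 0 (cauchy_kernel w e)) (z, x))%E.
have mh : measurable_fun [set: T * R] h.
  exact: (@measurable_fun_fubini_tonelli_F _ _ _ _ _ mu _ mF F0).
move=> tau; have t0 : 0 < 1 + tau ^+ 2 by exact: oneDsqr_gt0.
(* Here x is integrated first and the term in [lam 1] is dropped. *)
have b1 : (\int[Pr]_om h (om, tau) <= (e / (2 * lam 0%N))%:E)%E.
  apply: (@le_trans _ _ (\int[Pr]_om (e / (2 * lam 0%N))%:E)%E);
    last by rewrite integral_probability_cst.
  apply: ge0_le_integral => //.
  - by move=> om _; apply: integral_ge0 => x _; exact: F0.
  - exact: (measurableT_comp mh (pair2_measurable tau)).
  - move=> om _; apply: le_trans (polar_cauchy_le _ _ _ e0 l0) _.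
    rewrite lee_fin; apply: ler_wpM2l; first exact: ltW.
    have h1 : 0 <= lam 1%N * tau ^+ 2 by rewrite mulr_ge0 ?sqr_ge0.
    rewrite lef_pV2 ?posrE ?mulr_gt0//; last by rewrite ltr_pwDl.
    by rewrite ler_pM2l// lerDl.
(* Here the remaining coordinates are averaged first, for x fixed; the mass 1 / (pi (1 + tau^2)) of
   [polar_density] supplies the decay. *)
have b2 : (\int[Pr]_om h (om, tau) <= (e / (2 * (sigma * (1 + tau ^+ 2))))%:E)%E.
  pose F' (z : T * R) := (EFin \o polar_fun 0 (cauchy_kernel w e)) (z.1, tau, z.2).
  have mF' : measurable_fun [set: T * R] F'.
    apply: (measurableT_comp mF); apply: measurable_fun_pair; last exact: measurable_snd.
    by apply: measurable_fun_pair => //; exact: measurable_fst.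
  have F'0 z : (0 <= F' z)%E by exact: F0.
  rewrite (@fubini_tonelli _ _ _ _ _ Pr mu F' mF' F'0).
  pose B := pi / 2 * e / sigma.
  have B0 : 0 <= B by rewrite divr_ge0 ?(ltW sg0)// mulr_ge0 ?(ltW e0)// divr_ge0// pi_ge0.
  apply: (@le_trans _ _ (\int[mu]_x ((polar_density tau x)%:E * B%:E))%E).
    apply: ge0_le_integral => //.
    + by move=> x _; apply: integral_ge0 => om _; exact: F'0.
    + exact: (@measurable_fun_fubini_tonelli_G _ _ _ _ _ Pr _ mF' F'0).
    + apply: emeasurable_funM => //; apply: continuous_measurable_EFin.
      exact: continuous_polar_density.
    move=> x _; set y := (lam 0%N + lam 1%N * tau ^+ 2) * x ^+ 2.
    apply: (@le_trans _ _ ((polar_density tau x)%:E *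
      \int[Pr]_om ((1 + ((W 2 om + (y + w)) / e) ^+ 2)^-1)%:E)%E); last first.
      by rewrite lee_wpmul2l ?lee_fin ?polar_density_ge0//; exact: tail_sum_cauchy.
    rewrite -ge0_integralZl//.
    + rewrite le_eqVlt; apply/orP; left; apply/eqP; apply: eq_integral => om _.
      rewrite /F' /polar_fun /cauchy_kernel/= -EFinM -/y; congr (_ * (1 + (_ / e) ^+ 2)^-1)%:E.
      by ring.
    + apply/measurable_EFinP.
      exact: (measurableT_comp (measurable_cauchy_kernel (y + w) e) (measurable_tail_sum q lam mY 2)).
    + by move=> om _; rewrite lee_fin cauchy_ge0.
    + by rewrite lee_fin polar_density_ge0.
  rewrite ge0_integralZr//; last 2 first.
  - by apply: continuous_measurable_EFin; exact: continuous_polar_density.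
  - by move=> x _; rewrite lee_fin polar_density_ge0.
  rewrite integral_polar_density -EFinM lee_fin le_eqVlt; apply/orP; left; apply/eqP.
  have := @pi_gt0 R; rewrite /B; move: (@pi R) => p p0; field.
  by rewrite !gt_eqF.
have hge : (0 <= \int[Pr]_om h (om, tau))%E.
  by apply: integral_ge0 => om _; apply: integral_ge0 => x _; exact: F0.
rewrite -[X in (X <= _)%E]/(\int[Pr]_om h (om, tau))%E.
move: b1 b2 hge; case: (\int[Pr]_om h (om, tau))%E => [y| |]//.
rewrite !lee_fin => b1 b2 _.
have -> : lam 0%N + sigma + sigma * tau ^+ 2 = lam 0%N + sigma * (1 + tau ^+ 2) by ring.
by apply: harmonic_le => //; exact: mulr_gt0.
Qed.

Let prob_window w e (C : R) : 0 < e ->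
  (\int[Pr]_om (cauchy_kernel w e (W 0 om))%:E <= C%:E)%E ->
  (Pr [set om | (`|W 0 om + w| <= e)%R] <= (2 * C)%:E)%E.
Proof.
move=> e0 H; set A := [set om | _].
have mW : measurable_fun [set: T] (fun om => `|W 0 om + w|).
  apply: measurableT_comp => //; apply: measurable_funD => //.
  exact: measurable_tail_sum.
have mA : measurable A.
  have -> : A = (fun om => `|W 0 om + w|) @^-1` `]-oo, e].
    by apply/seteqP; split => om /=; rewrite in_itv.
  by rewrite -[X in measurable X]setTI; exact: mW.
have mk : measurable_fun [set: T] (fun om => (cauchy_kernel w e (W 0 om))%:E).
  apply/measurable_EFinP.
  exact: (measurableT_comp (measurable_cauchy_kernel w e) (measurable_tail_sum q lam mY 0)).
rewrite -(setIT A) -integral_indic//.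
apply: (@le_trans _ _ (\int[Pr]_om (2%:E * (cauchy_kernel w e (W 0 om))%:E))%E).
  apply: ge0_le_integral => //.
  - by apply/measurable_EFinP; exact: measurable_indic.
  - exact: emeasurable_funM.
  move=> om _; rewrite indicE; case: (boolP (om \in A)) => [|_]; last first.
    by rewrite mule_ge0// lee_fin cauchy_ge0.
  rewrite inE /A/= => hA; rewrite -EFinM lee_fin /cauchy_kernel.
  rewrite ler_pdivlMr ?oneDsqr_gt0// mul1r -lerBrDl (_ : 2 - 1 = 1 :> R); last by ring.
  rewrite -[leRHS](expr1n _ 2) -[X in X <= _]real_normK ?num_real//.
  rewrite ler_pXn2r ?nnegrE// normrM normfV (gtr0_norm e0).
  by rewrite ler_pdivrMr// mul1r.
rewrite ge0_integralZl//; last by move=> om _; rewrite lee_fin cauchy_ge0.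
by rewrite EFinM lee_wpmul2l.
Qed.

(** Index 3 + 2j, the smaller member of its pair, dominates index 4 + 2j, the larger member of the
    next. Keeping only the smaller members thus loses at most a factor 2 from index 3 on. *)
Let sum_pairs_le m : \sum_(3 <= i < 3 + m.*2) lam i ^+ 2 <= 2 * pair_energy m 2.
Proof.
elim: m => [|m IH].
  by rewrite addn0 big_geq// /pair_energy big_ord0 mulr0.
rewrite /pair_energy big_ord_recr [leLHS]/= mulrDr.
have -> : (3 + m.+1.*2 = (3 + m.*2).+2)%N by lia.
have n3 : (3 <= 3 + m.*2)%N by lia.
have -> : (2 + m.*2).+1 = (3 + m.*2)%N by lia.
move: (3 + m.*2)%N n3 IH => n n3 IH.
rewrite (big_nat_recr n.+1)/=; last exact: leqW.
rewrite (big_nat_recr n)//= -addrA; apply: lerD; first exact: IH.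
by rewrite mulr_natl mulr2n lerD2l ler_pXn2r ?nnegrE.
Qed.

Lemma tail_sum_anti_concentration w e : (1 < q)%N -> 0 < e ->
  (\sum_(0 <= i < q) lam i ^+ 2) * (\sum_(1 <= i < q) lam i ^+ 2) != 0 ->
  (Pr [set om | (`|W 0 om + w| <= e)%R] <= (6 * pi * e *
     ((\sum_(0 <= i < q) lam i ^+ 2) * (\sum_(1 <= i < q) lam i ^+ 2)) `^ (- 4^-1))%:E)%E.
Proof.
move=> q1 e0; set L2 := \sum_(1 <= i < q) _; set L1 := \sum_(0 <= i < q) _.
have sq i : 0 <= lam i ^+ 2 by exact: sqr_ge0.
have L1E : L1 = lam 0%N ^+ 2 + L2 by rewrite /L1 big_ltn// ltnW.
have L20 : 0 <= L2 by exact: sumr_ge0.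
have L10 : 0 <= L1 by exact: sumr_ge0.
move=> hM; have M0 : 0 < L1 * L2 by rewrite lt_neqAle eq_sym hM mulr_ge0.
have L2p : 0 < L2.
  by rewrite lt_neqAle L20 andbT eq_sym; apply: contra hM => /eqP ->; rewrite mulr0.
pose m := (q - 2)./2.
have mq : (2 + m.*2 <= q)%N by rewrite /m; lia.
(* Indices 1 and 2 account for the first term and the later ones for the second. For odd q the last
   index, which belongs to no pair, is covered too. *)
have L2le : L2 <= 2 * lam 1%N ^+ 2 + 2 * pair_energy m 2.
  rewrite /L2 big_ltn//; have [q2|q2] := leqP q 2.
    rewrite big_geq// addr0 mulr_natl mulr2n -addrA lerDl addr_ge0//.
    by rewrite mulr_ge0//; apply: sumr_ge0.
  rewrite big_ltn// addrA; apply: lerD.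
    rewrite mulr_natl mulr2n lerD2l ler_pXn2r ?nnegrE//.
  apply: le_trans (sum_pairs_le m); rewrite (@big_cat_nat _ _ _ q 3 (3 + m.*2))//=.
    by rewrite lerDl; apply: sumr_ge0.
  by rewrite /m; lia.
have dec i j : (i <= j)%N -> lam j <= lam i.
  move=> /subnK <-; elim: (j - i)%N => // n IHn.
  by rewrite addSn; apply: le_trans IHn; exact: lamS.
have p0 : 0 < pi :> R by exact: pi_gt0.
have l1p : 0 < lam 1%N.
  rewrite lt_neqAle lam0 andbT eq_sym; apply/eqP => l10.
  have : L2 = 0.
    rewrite /L2 big_nat_cond big1// => i /andP[/andP[i1 _] _].
    have -> : lam i = 0 by apply/eqP; rewrite eq_le lam0 andbT -l10 dec.
    by rewrite expr0n.
  by move=> L2z; rewrite L2z ltxx in L2p.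
have l01 : lam 1%N <= lam 0%N by exact: lamS.
have l0p : 0 < lam 0%N by exact: lt_le_trans l01.
(* The threshold 6 makes the second case self-contained: 2 lam_1^2 < L2 / 3 gives L2 <= 3
   [pair_energy m 2] by [L2le], hence the energy exceeds 2 lam_1^2, and no pair carries more than
   half of it (indices from 0). *)
have [caseA|caseB] := leP L2 (6 * lam 1%N ^+ 2).
  have u0 : 0 < lam 0%N * lam 1%N by exact: mulr_gt0.
  have Mu : L1 * L2 <= 81 * (lam 0%N * lam 1%N) ^+ 2.
    have h1 : L1 <= 7 * lam 0%N ^+ 2.
      have : lam 1%N ^+ 2 <= lam 0%N ^+ 2 by rewrite ler_pXn2r ?nnegrE.
      by rewrite L1E; lra.
    have : L1 * L2 <= (7 * lam 0%N ^+ 2) * (6 * lam 1%N ^+ 2) by exact: ler_pM.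
    have : 0 <= (lam 0%N * lam 1%N) ^+ 2 by exact: sqr_ge0.
    rewrite exprMn; lra.
  have hs := inv_sqrt_le_powR u0 M0 Mu.
  apply: (le_trans (prob_window e0 (concentration_two w q1 e0 l1p))).
  rewrite lee_fin; set s := (Num.sqrt _)^-1 in hs *; set P := _ `^ _ in hs *.
  have : pi * e * s <= pi * e * (3 * P) by rewrite ler_wpM2l// mulr_ge0// ltW.
  have : 0 <= pi * e * (3 * P) by rewrite !mulr_ge0 ?powR_ge0// ltW.
  lra.
have hS1 : L2 <= 3 * pair_energy m 2 by lra.
have S1p : 0 < pair_energy m 2 by lra.
have hS j : (j < m)%N -> 2 * lam (2 + j.*2).+1 ^+ 2 <= pair_energy m 2.
  move=> _; have : lam (2 + j.*2).+1 ^+ 2 <= lam 1%N ^+ 2.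
    by rewrite ler_pXn2r ?nnegrE// dec.
  lra.
set sigma := Num.sqrt (2 * pair_energy m 2).
have sg0 : 0 < sigma by rewrite sqrtr_gt0 mulr_gt0.
have sg2 : sigma ^+ 2 = 2 * pair_energy m 2 by rewrite sqr_sqrtr// mulr_ge0// ltW.
have u0 : 0 < (lam 0%N + sigma) * sigma by rewrite mulr_gt0// addr_gt0.
have Mu : L1 * L2 <= 81 * ((lam 0%N + sigma) * sigma) ^+ 2.
  have h1 : L1 <= 9 * (lam 0%N + sigma) ^+ 2.
    have h : 0 <= lam 0%N * sigma by rewrite mulr_ge0// ltW.
    by rewrite L1E sqrrD sg2; have := sq 0%N; lra.
  have h2 : L2 <= 9 * sigma ^+ 2 by rewrite sg2; lra.
  apply: (@le_trans _ _ ((9 * (lam 0%N + sigma) ^+ 2) * (9 * sigma ^+ 2))).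
    exact: ler_pM.
  by rewrite exprMn le_eqVlt; apply/orP; left; apply/eqP; ring.
have hs := inv_sqrt_le_powR u0 M0 Mu.
apply: (le_trans (prob_window e0 (concentration_many w mq e0 l0p S1p hS))).
rewrite -/sigma lee_fin; set s := (Num.sqrt _)^-1 in hs *; set P := _ `^ _ in hs *.
have : pi * e * s <= pi * e * (3 * P) by rewrite ler_wpM2l// mulr_ge0// ltW.
lra.
Qed.

End gaussian_concentration.

(** * Norms and calculus *)

Section euclidean_norm.
Context {R : realType}.

Lemma enorm_ge0 n (v : 'cV[R]_n) : 0 <= enorm v.
Proof. exact: sqrtr_ge0. Qed.

Lemma enorm_sqr n (v : 'cV[R]_n) : enorm v ^+ 2 = \sum_i v i 0 ^+ 2.
Proof. by rewrite sqr_sqrtr// sumr_ge0// => i _; exact: sqr_ge0. Qed.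

Lemma enormZ n (a : R) (v : 'cV[R]_n) : enorm (a *: v) = `|a| * enorm v.
Proof.
rewrite /enorm -sqrtr_sqr -sqrtrM ?sqr_ge0// mulr_sumr; congr Num.sqrt.
by apply: eq_bigr => i _; rewrite mxE exprMn.
Qed.

Lemma enorm0 n : enorm (0 : 'cV[R]_n) = 0.
Proof. by rewrite -(scale0r 0) enormZ normr0 mul0r. Qed.

Lemma enorm_eq0 n (v : 'cV[R]_n) : (enorm v == 0) = (v == 0).
Proof.
apply/eqP/eqP => [v0|->]; last exact: enorm0.
apply/eqP; rewrite -normr_eq0 eq_le normr_ge0 andbT -v0; exact: ler_enorm.
Qed.

Lemma enorm_delta n (i : 'I_n) : enorm (delta_mx i 0 : 'cV[R]_n) = 1.
Proof.
rewrite /enorm (bigD1 i)//= mxE !eqxx/= big1 ?addr0 ?expr1n ?sqrtr1// => j ji.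
by rewrite mxE (negbTE ji) expr0n.
Qed.

Lemma cauchy_schwarz n (x y : 'cV[R]_n) :
  `|(x^T *m y) 0 0| <= enorm x * enorm y.
Proof.
have nn (u v : 'cV[R]_n) : - (u^T *m v) 0 0 <= enorm u * enorm v.
  have [/eqP|u0] := eqVneq (enorm u) 0.
    by rewrite enorm_eq0 => /eqP ->; rewrite trmx0 mul0mx mxE oppr0 mulr_ge0 ?enorm_ge0.
  have [/eqP|v0] := eqVneq (enorm v) 0.
    by rewrite enorm_eq0 => /eqP ->; rewrite mulmx0 mxE oppr0 mulr_ge0 ?enorm_ge0.
  have up : 0 < enorm u by rewrite lt_neqAle eq_sym u0 enorm_ge0.
  have vp : 0 < enorm v by rewrite lt_neqAle eq_sym v0 enorm_ge0.
  have : 0 <= \sum_i (enorm v * u i 0 + enorm u * v i 0) ^+ 2.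
    by apply: sumr_ge0 => i _; exact: sqr_ge0.
  have -> : \sum_i (enorm v * u i 0 + enorm u * v i 0) ^+ 2 =
     2 * (enorm u * enorm v) * (enorm u * enorm v + (u^T *m v) 0 0).
    transitivity (enorm v ^+ 2 * (\sum_i u i 0 ^+ 2) + enorm u ^+ 2 * (\sum_i v i 0 ^+ 2)
       + 2 * (enorm u * enorm v) * (u^T *m v) 0 0).
      rewrite mxE !mulr_sumr -!big_split/=; apply: eq_bigr => i _; rewrite !mxE; ring.
    rewrite -!enorm_sqr; ring.
  rewrite pmulr_rge0; last by rewrite !mulr_gt0.
  by rewrite -lerBlDr sub0r.
rewrite ler_norml -lerNl nn/=.
have -> : x^T *m y = - (x^T *m - y) by rewrite mulmxN opprK.
rewrite [(- (x^T *m - y)) 0 0]mxE; apply: le_trans (nn _ _) _.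
by rewrite -scaleN1r enormZ normrN1 mul1r.
Qed.

Definition sqr_frobenius m n (A : 'M[R]_(m, n)) : R := \sum_i \sum_j A i j ^+ 2.

Lemma sqr_frobenius_ge0 m n (A : 'M[R]_(m, n)) : 0 <= sqr_frobenius A.
Proof. by apply: sumr_ge0 => i _; apply: sumr_ge0 => j _; exact: sqr_ge0. Qed.

Lemma sqr_enorm_mul_le m n (A : 'M[R]_(m, n)) x :
  enorm (A *m x) ^+ 2 <= sqr_frobenius A * enorm x ^+ 2.
Proof.
rewrite enorm_sqr mulr_suml; apply: ler_sum => i _.
have -> : (A *m x) i 0 = (((row i A)^T)^T *m x) 0 0.
  by rewrite trmxK !mxE; apply: eq_bigr => j _; rewrite mxE.
have -> : \sum_j A i j ^+ 2 = enorm (row i A)^T ^+ 2.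
  by rewrite enorm_sqr; apply: eq_bigr => j _; rewrite !mxE.
rewrite -exprMn -[leLHS]real_normK ?num_real// ler_pXn2r ?nnegrE ?mulr_ge0 ?enorm_ge0//.
exact: cauchy_schwarz.
Qed.

Let opset m n (A : 'M[R]_(m, n)) :=
  [set enorm (A *m x) | x in [set x : 'cV[R]_n | enorm x <= 1]].

Let opset_sup m n (A : 'M[R]_(m, n)) : has_sup (opset A).
Proof.
split; first by exists (enorm (A *m 0)); exists 0 => //=; rewrite enorm0 ler01.
exists (Num.sqrt (sqr_frobenius A)) => _ [x /= x1 <-].
rewrite -[leLHS]ger0_norm ?enorm_ge0// -sqrtr_sqr ler_sqrt ?sqr_frobenius_ge0//.
apply: le_trans (sqr_enorm_mul_le A x) _.
by rewrite ler_piMr ?sqr_frobenius_ge0// expr_le1// enorm_ge0.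
Qed.

Lemma opnorm_ge0 m n (A : 'M[R]_(m, n)) : 0 <= opnorm A.
Proof.
apply: (@le_trans _ _ (enorm (A *m 0))); first exact: enorm_ge0.
apply: ub_le_sup; first by case: (opset_sup A).
by exists 0 => //=; rewrite enorm0 ler01.
Qed.

Lemma enorm_mul_le m n (A : 'M[R]_(m, n)) x :
  enorm (A *m x) <= opnorm A * enorm x.
Proof.
have [/eqP|x0] := eqVneq (enorm x) 0.
  by rewrite enorm_eq0 => /eqP ->; rewrite mulmx0 !enorm0 mulr0.
have xp : 0 < enorm x by rewrite lt_neqAle eq_sym x0 enorm_ge0.
rewrite -ler_pdivrMr//; apply: ub_le_sup; first by case: (opset_sup A).
exists ((enorm x)^-1 *: x) => /=.
  by rewrite enormZ ger0_norm ?invr_ge0 ?enorm_ge0// mulVf.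
by rewrite -scalemxAr enormZ ger0_norm ?invr_ge0 ?enorm_ge0// mulrC.
Qed.

Definition quadform n (B : 'M[R]_n) (x : 'cV[R]_n) : R := (x^T *m B *m x) 0 0.

Lemma quadform_le n (B : 'M[R]_n) x : `|quadform B x| <= opnorm B * enorm x ^+ 2.
Proof.
rewrite /quadform -mulmxA; apply: le_trans (cauchy_schwarz _ _) _.
by rewrite mulrC exprS expr1 mulrA ler_wpM2r ?enorm_ge0// enorm_mul_le.
Qed.

Lemma quadform1 n (x : 'cV[R]_n) : quadform 1%:M x = enorm x ^+ 2.
Proof.
by rewrite /quadform mulmx1 enorm_sqr mxE; apply: eq_bigr => i _; rewrite !mxE.
Qed.

Lemma quadformE n (B : 'M[R]_n) x :
  quadform B x = \sum_i \sum_j x i 0 * B i j * x j 0.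
Proof.
rewrite /quadform -mulmxA mxE; apply: eq_bigr => i _.
by rewrite !mxE mulr_sumr; apply: eq_bigr => j _; rewrite mulrA.
Qed.

Lemma continuous_sumr (T : topologicalType) n (f : 'I_n -> T -> R) :
  (forall i, continuous (f i)) -> continuous (fun x => \sum_i f i x).
Proof.
elim: n f => [|n IH] f cf x.
  rewrite (_ : (fun x => _) = cst 0); first exact: cvg_cst.
  by apply/funext => y; rewrite big_ord0.
rewrite (_ : (fun x => _) = (fun x => f ord0 x + \sum_i f (lift ord0 i) x)).
  by apply: cvgD; [exact: cf|apply: IH => i; exact: cf].
by apply/funext => y; rewrite big_ord_recl.
Qed.

Lemma continuous_quadform n (B : 'M[R]_n) : continuous (quadform B).
Proof.
rewrite (_ : quadform B = fun x => \sum_i \sum_j x i 0 * B i j * x j 0);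
  last by apply/funext => y; exact: quadformE.
apply: continuous_sumr => i; apply: continuous_sumr => j x.
have c k : continuous (fun x : 'cV[R]_n => x k 0) by exact: coord_continuous.
have h : {for x, continuous (fun x : 'cV[R]_n => x i 0 * B i j)}.
  by apply: continuousM; [exact: c|exact: cst_continuous].
exact: (@continuousM R _ (fun x : 'cV[R]_n => x i 0 * B i j) (fun x => x j 0) x h (c j x)).
Qed.

Definition psd_quadform n (B : 'M[R]_n) := forall x, 0 <= quadform B x.

Lemma quadform_conv n (B : 'M[R]_n) (s : R) x y : psd_quadform B -> 0 <= s <= 1 ->
  quadform B (s *: x + (1 - s) *: y) <= s * quadform B x + (1 - s) * quadform B y.
Proof.
move=> B0 /andP[s0 s1]; rewrite -subr_ge0.
suff -> : s * quadform B x + (1 - s) * quadform B y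
    - quadform B (s *: x + (1 - s) *: y) = s * (1 - s) * quadform B (x - y).
  by rewrite !mulr_ge0// subr_ge0.
rewrite !quadformE !mulr_sumr -big_split -sumrB/=; apply: eq_bigr => i _.
rewrite !mulr_sumr -big_split -sumrB/=; apply: eq_bigr => j _.
by rewrite !mxE; ring.
Qed.

Local Open Scope convex_scope.

Lemma quadform_conv_le_max n (B : 'M[R]_n) (x y : 'cV[R]_n) (s : {i01 R}) :
  psd_quadform B ->
  quadform B ((x : convex_lmodType _) <| s |> y) <= Num.max (quadform B x) (quadform B y).
Proof.
move=> B0; have s01 : 0 <= s%:num <= 1 by apply/andP; split.
apply: le_trans (quadform_conv _ _ B0 s01) _.
case/andP: s01 => s0 s1; set m := Num.max _ _.
rewrite (_ : m = s%:num * m + (1 - s%:num) * m); last by ring.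
by apply: lerD; apply: ler_wpM2l; rewrite ?subr_ge0// /m le_max lexx ?orbT.
Qed.

Lemma convex_quadform_lt n (B : 'M[R]_n) u : psd_quadform B ->
  convex_set [set x | quadform B x < u].
Proof.
move=> B0 x y s; rewrite !inE/= => xu yu.
by apply: le_lt_trans (quadform_conv_le_max _ _ _ B0) _; rewrite gt_max xu.
Qed.

Lemma convex_quadform_le n (B : 'M[R]_n) u : psd_quadform B ->
  convex_set [set x | quadform B x <= u].
Proof.
move=> B0 x y s; rewrite !inE/= => xu yu.
by apply: le_trans (quadform_conv_le_max _ _ _ B0) _; rewrite ge_max xu.
Qed.

Lemma measurable_quadform n (B : 'M[R]_n) (I : interval R) :
  measurable ([set x | quadform B x \in I] : set (borelV R n)).
Proof.
have := continuous_borelV_measurable (@continuous_quadform n B).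
move=> /(_ measurableT [set` I] (measurable_itv I)); rewrite setTI; congr measurable.
Qed.

End euclidean_norm.

(** * Calculus along segments and coercive Hessians *)

Section line_calculus.
Context {R : realType}.

Lemma quadformB n (A B : 'M[R]_n) v : quadform (A - B) v = quadform A v - quadform B v.
Proof.
rewrite !quadformE -sumrB; apply: eq_bigr => i _; rewrite -sumrB.
by apply: eq_bigr => j _; rewrite !mxE mulrBr mulrBl.
Qed.

Lemma deriveE_grad n (f : 'cV[R]_n -> R) (a v : 'cV[R]_n) :
  differentiable f a -> 'D_v f a = (grad f a *m v) 0 0.
Proof.
move=> df; rewrite deriveE// [v in LHS](_ : v = \sum_i v i 0 *: delta_mx i 0).
  rewrite linear_sum mxE/=; apply: eq_bigr => i _.
  by rewrite linearZ/= mxE deriveE// mulrC.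
apply/colP => i; rewrite summxE (bigD1 i)//= big1 ?addr0 => [|j ji].
  by rewrite !mxE !eqxx mulr1.
by rewrite !mxE eq_sym (negbTE ji) mulr0.
Qed.

Lemma is_derive_line n (f : 'cV[R]_n -> R) (a v : 'cV[R]_n) (s : R) :
  differentiable f (a + s *: v) ->
  is_derive s 1 (fun s => f (a + s *: v)) ((grad f (a + s *: v) *m v) 0 0).
Proof.
move=> df; rewrite -deriveE_grad//.
have eq : (fun h : R => h^-1 *: (((fun s => f (a + s *: v)) \o shift s) (h *: 1) -
      f (a + s *: v))) =
    (fun h : R => h^-1 *: ((f \o shift (a + s *: v)) (h *: v) - f (a + s *: v))).
  apply/funext => h /=; congr (_ *: (f _ - _)).
  by rewrite [h *: 1]mulr1 scalerDl addrCA.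
have dv : derivable f (a + s *: v) v by exact: diff_derivable.
split; first by rewrite /derivable eq.
by rewrite /derive eq.
Qed.

Lemma is_derive_grad_line n (f : 'cV[R]_n -> R) (a v : 'cV[R]_n) (s : R) :
  differentiable (grad f) (a + s *: v) ->
  is_derive s 1 (fun s => (grad f (a + s *: v) *m v) 0 0)
    (quadform (hess f (a + s *: v)) v).
Proof.
move=> df.
have dfi i : differentiable (fun x => grad f x 0 i) (a + s *: v).
  apply: (@differentiable_comp _ _ _ _ (grad f) (fun M : 'rV[R]_n => M 0 i)) => //.
  exact: differentiable_coord.
rewrite (_ : (fun s => _) = (fun s => \sum_i grad f (a + s *: v) 0 i * v i 0));
  last by apply/funext => y; rewrite mxE.
have H i : is_derive s 1 (fun s => grad f (a + s *: v) 0 i * v i 0)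
   ((\sum_j hess f (a + s *: v) i j * v j 0) * v i 0).
  have h := is_derive_line (dfi i).
  rewrite (_ : \sum_j _ = (grad (fun x => grad f x 0 i) (a + s *: v) *m v) 0 0);
    last by rewrite mxE; apply: eq_bigr => j _; rewrite !mxE.
  rewrite (_ : (fun s => _) = v i 0 \*: (fun s => grad f (a + s *: v) 0 i)).
    by rewrite mulrC; apply: is_deriveZ.
  by apply/funext => y /=; rewrite mulrC.
have := is_derive_sum H.
rewrite (_ : \sum_(i < n) _ = fun s => \sum_i grad f (a + s *: v) 0 i * v i 0);
  last by apply/funext => y; rewrite fct_sumE.
rewrite (_ : \sum_(i < n) (\sum_j _) * _ = quadform (hess f (a + s *: v)) v)//.
rewrite quadformE; apply: eq_bigr => i _; rewrite mulr_suml.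
by apply: eq_bigr => j _; rewrite mulrC mulrA.
Qed.

Let mvt01 (f df : R -> R) (s : R) : 0 <= s ->
  (forall x, x \in `[0, s] -> is_derive x 1 f (df x)) ->
  exists2 c, c \in `[0, s] & f s - f 0 = df c * s.
Proof.
move=> s0 hf; have [c cs E] := @MVT_segment R f df 0 s s0
  (fun x xs => hf x (subset_itv_oo_cc xs))
  (derivable_within_continuous (fun x xs => @ex_derive _ _ _ _ _ _ _ (hf x xs))).
by exists c => //; rewrite E subr0.
Qed.

(** Two applications of the mean value theorem on the segment: phi has derivative psi, and the
    derivative of psi is the increment of the Hessian form. This gives the constant 1 where
    integration would give 1/6. *)
Lemma taylor_lipschitz_hess n (f : 'cV[R]_n -> R) (a v : 'cV[R]_n) (L : R) :
  0 <= L ->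
  (forall s : R, s \in `[0, 1] -> twice_differentiable f (a + s *: v)) ->
  (forall s : R, s \in `[0, 1] ->
    opnorm (hess f (a + s *: v) - hess f a) <= L * enorm (s *: v)) ->
  `|f (a + v) - f a - (grad f a *m v) 0 0 - 2^-1 * quadform (hess f a) v|
    <= L * enorm v ^+ 3.
Proof.
move=> L0 df Lip; set g : R := (grad f a *m v) 0 0; set q : R := quadform (hess f a) v.
pose psi (s : R) : R := (grad f (a + s *: v) *m v) 0 0 - g - s * q.
pose phi (s : R) : R := f (a + s *: v) - s * g - 2^-1 * s ^+ 2 * q.
have dpsi (x : R) : x \in `[0, 1] ->
    is_derive x (1 : R) psi (quadform (hess f (a + x *: v)) v - q).
  move=> x01; have [_ h] := df _ x01; have h1 := is_derive_grad_line h.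
  rewrite /psi; apply: is_derive_eq; rewrite /GRing.scale/=.
  by rewrite mulr0 mulr1 add0r subr0.
have dphi (x : R) : x \in `[0, 1] -> is_derive x (1 : R) phi (psi x).
  move=> x01; have [/nbhs_singleton h _] := df _ x01; have h1 := is_derive_line h.
  rewrite /phi /psi; apply: is_derive_eq; rewrite /GRing.scale/=.
  have e : 2^-1 * (x + x) = x by lra.
  by rewrite !mulr0 !mulr1 !add0r e [q * x]mulrC.
have sub (c : R) : c \in `[0, 1] -> {subset `[0, c] <= `[0, 1 : R]}.
  move=> c01; apply: subitvP; by move: c01; rewrite in_itv/= subitvE !bnd_simp => /andP[_ ->].
have psi0 : psi 0 = 0 by rewrite /psi scale0r addr0 subrr mul0r subr0.
have phi0 : phi 0 = f a by rewrite /phi scale0r addr0 expr0n/= mul0r mulr0 !mul0r !subr0.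
have -> : f (a + v) - f a - g - 2^-1 * q = phi 1 - phi 0.
  by rewrite phi0 /phi scale1r expr1n mulr1 mul1r; ring.
have [c c01 ->] := mvt01 ler01 dphi; rewrite mulr1.
have c0 : 0 <= c by move: c01; rewrite in_itv/= => /andP[].
have [e e0c] := mvt01 c0 (fun x xc => dpsi x (sub _ c01 x xc)).
have e01 := sub _ c01 _ e0c.
rewrite psi0 subr0 => ->.
have -> : quadform (hess f (a + e *: v)) v - q = quadform (hess f (a + e *: v) - hess f a) v.
  by rewrite quadformB.
have c1 : c <= 1 by move: c01; rewrite in_itv/= => /andP[].
have {e01}[e0 e1] : 0 <= e /\ e <= 1 by move: e01; rewrite in_itv/= => /andP[].
rewrite normrM (ger0_norm c0); apply: (@le_trans _ _ (L * enorm v * enorm v ^+ 2 * 1)).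
  apply: ler_pM => //; apply: le_trans (quadform_le _ _) _.
  rewrite ler_wpM2r ?sqr_ge0//; apply: (le_trans (Lip _ _)).
    by rewrite in_itv/= e0.
  by rewrite enormZ ler_wpM2l// ger0_norm// ler_piMl// enorm_ge0.
by rewrite mulr1 -mulrA -exprS.
Qed.

(** The gradient vanishes at the interior minimum a. If the Hessian form at v were below m = mu
    |v|^2, the slope of f along v at a + c v would be below m c for small c > 0, and the mean value
    theorem would give an increase below m s^2 over [0, s], against the growth. A second-order
    expansion would yield 2 mu; the factor 2 is given away. *)
Lemma quadratic_growth_hess n (f : 'cV[R]_n -> R) (Th : set 'cV[R]_n) a (mu : R) :
  open Th -> Th a -> 0 <= mu ->
  (forall x, Th x -> mu * enorm (x - a) ^+ 2 <= f x - f a) ->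
  twice_differentiable f a ->
  forall v, mu * enorm v ^+ 2 <= quadform (hess f a) v.
Proof.
move=> oTh Tha mu0 growth [df dg] v; set m := mu * _.
have m0 : 0 <= m by rewrite mulr_ge0// sqr_ge0.
pose h (s : R) : R := (grad f (a + s *: v) *m v) 0 0.
pose phi (s : R) : R := f (a + s *: v).
have [r r0 hr] : exists2 r : R, 0 < r & forall s, `|s| < r ->
    Th (a + s *: v) /\ differentiable f (a + s *: v).
  have line : (fun s : R => a + s *: v) s @[s --> (0 : R)] --> a.
    suff : (fun s : R => a + s *: v) s @[s --> (0 : R)] --> a + 0 *: v.
      by rewrite scale0r addr0.
    by apply: cvgD; [exact: cvg_cst|apply: cvgZr_tmp; exact: cvg_id].
  have nTh : nbhs a [set x | Th x /\ differentiable f x].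
    by near=> x; split; near: x => //; exact: open_nbhs_nbhs.
  have /nbhs_ballP[r r0 br] := line _ nTh.
  exists r => // s sr; apply: br; rewrite -ball_normE /ball_/= sub0r normrN//.
have dphi s : `|s| < r -> is_derive s (1 : R) phi (h s).
  by move=> /hr[_ d]; exact: is_derive_line.
have h0 : h 0 = 0.
  have d0 := dphi 0; rewrite normr0 in d0; have {}d0 := d0 r0.
  have : is_derive (0 : R) (1 : R) phi 0.
    apply: (@derive1_at_min _ _ (- r) r).
    - by rewrite ge0_cp// ltW.
    - by move=> t; rewrite in_itv/= -ltr_norml => /dphi[].
    - by rewrite in_itv/= oppr_lt0 r0.
    - move=> t; rewrite in_itv/= -ltr_norml => /hr[Tht _].
      rewrite /phi scale0r addr0 -subr_ge0; apply: le_trans (growth _ Tht).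
      by rewrite mulr_ge0 ?sqr_ge0.
  by case=> _ e1; case: d0 => _ <-.
have dh : is_derive (0 : R) (1 : R) h (quadform (hess f a) v).
  rewrite -[X in quadform (hess f X)]addr0 -(scale0r v); apply: is_derive_grad_line.
  by rewrite scale0r addr0.
rewrite leNgt; apply/negP => Qm.
have [e e0 he] : exists2 e : R, 0 < e & forall k, 0 < k -> k < e -> k^-1 * h k < m.
  have [dh1 dh2] := dh.
  have cv : k^-1 *: ((h \o shift 0) (k *: 1) - h 0) @[k --> (0 : R)^'] -->
     quadform (hess f a) v by rewrite -dh2; exact: dh1.
  have [e /= e0 be] := cvgr_lt _ cv _ Qm.
  exists e => // k k0 ke; have := be k; rewrite /= addr0 h0 subr0 [k *: 1]mulr1; apply.
    by rewrite sub0r normrN gtr0_norm.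
  by rewrite gt_eqF.
have [s s0 [sr se]] : exists2 s : R, 0 < s & s < r /\ s < e.
  exists (Num.min r e / 2); first by rewrite divr_gt0// lt_min r0.
  have : Num.min r e <= r by rewrite ge_min lexx.
  have : Num.min r e <= e by rewrite ge_min lexx orbT.
  have : 0 < Num.min r e by rewrite lt_min r0.
  by move=> *; split; lra.
have dp c : c \in `[0, s] -> is_derive c (1 : R) phi (h c).
  rewrite in_itv/= => /andP[c0 cs]; apply: dphi; rewrite ger0_norm//.
  exact: le_lt_trans sr.
have [c] := MVT s0 (fun x xs => dp x (subset_itv_oo_cc xs))
  (derivable_within_continuous (fun x xs => @ex_derive _ _ _ _ _ _ _ (dp x xs))).
rewrite in_itv/= subr0 => /andP[c0 cs] E.
have [Ths _] : Th (a + s *: v) /\ differentiable f (a + s *: v).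
  by apply: hr; rewrite gtr0_norm.
have := growth _ Ths.
rewrite -[f (a + s *: v)]/(phi s) (_ : f a = phi 0); last by rewrite /phi scale0r addr0.
rewrite E addrAC subrr add0r enormZ gtr0_norm// exprMn mulrCA -/m expr2 -mulrA mulrC.
rewrite ler_pM2r// => hc.
have := he c c0 (lt_trans cs se); rewrite mulrC ltr_pdivrMr// ltNge => /negP; apply.
by apply: le_trans hc; rewrite mulrC ler_wpM2r// ltW.
Unshelve. all: by end_near.
Qed.

Lemma gradN n (f : 'cV[R]_n -> R) a :
  differentiable f a -> grad (fun x => - f x) a = - grad f a.
Proof.
move=> df; apply/rowP => i; rewrite !mxE; apply: (@deriveN _ _ _ f).
exact: diff_derivable.
Qed.

Lemma hessN n (f : 'cV[R]_n -> R) a :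
  twice_differentiable f a -> hess (fun x => - f x) a = - hess f a.
Proof.
move=> [df dg]; apply/matrixP => i j; rewrite !mxE.
have dgi : differentiable (fun x => grad f x 0 i) a.
  apply: (@differentiable_comp _ _ _ _ (grad f) (fun M : 'rV[R]_n => M 0 i)) => //.
  exact: differentiable_coord.
rewrite -(@deriveN _ _ _ (fun x => grad f x 0 i)); last exact: diff_derivable.
apply: near_eq_derive; apply: filterS df => x dfx.
by rewrite gradN// mxE.
Qed.

(** The absolute value admits the Hessian of the expected log-likelihood, whose quadratic form is
    negative. *)
Lemma coercive_unitmx n (B : 'M[R]_n) (mu : R) : 0 < mu ->
  (forall v, mu * enorm v ^+ 2 <= `|quadform B v|) -> B \in unitmx.
Proof.
move=> mu0 coer; rewrite -unitmx_tr -row_free_unit -kermx_eq0; apply/eqP/row_matrixP => i.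
set K := kermx _; rewrite row0.
have Bv : B *m (row i K)^T = 0.
  by apply: trmx_inj; rewrite trmx_mul trmxK trmx0 -row_mul mulmx_ker row0.
have := coer (row i K)^T; rewrite /quadform -mulmxA Bv mulmx0 mxE normr0.
rewrite pmulr_rle0// => /(conj (sqr_ge0 (enorm (row i K)^T)))/andP; rewrite -eq_le.
rewrite eq_sym expf_eq0/= enorm_eq0 => /eqP h; apply: trmx_inj; rewrite h.
by rewrite trmx0.
Qed.

Lemma coercive_invmx_le n (B : 'M[R]_n) (mu : R) : 0 < mu ->
  (forall v, mu * enorm v ^+ 2 <= `|quadform B v|) ->
  forall x, enorm (invmx B *m x) <= mu^-1 * enorm x.
Proof.
move=> mu0 coer x; have uB := coercive_unitmx mu0 coer.
set y := invmx B *m x; have -> : x = B *m y by rewrite mulKVmx.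
rewrite mulrC ler_pdivlMr// mulrC; have := coer y; rewrite /quadform -mulmxA => h.
have {h} := le_trans h (cauchy_schwarz _ _).
have [->|y0] := eqVneq (enorm y) 0; first by rewrite mulr0 enorm_ge0.
rewrite expr2 mulrCA ler_pM2l// lt_neqAle eq_sym y0; exact: enorm_ge0.
Qed.

End line_calculus.

(** * Gaussian and moment estimates *)

Section std_normal_estimates.
Context {R : realType}.
Local Notation mu := (@lebesgue_measure R).
Local Notation gamma := (@normal_prob R 0 1).
Local Notation phi := (normal_pdf 0 1).

Lemma measurable_sqr_ge (u : R) : measurable [set x : R | u <= x ^+ 2].
Proof.
have m2 : measurable_fun [set: R] (fun x : R => x ^+ 2) by exact: measurable_funX.
have := m2 measurableT _ (measurable_itv `[u, +oo[); rewrite setTI; congr measurable.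
by apply/seteqP; split => x /=; rewrite in_itv/= andbT.
Qed.

(** Comparison with the normal density of variance 2: the quotient of the two densities is sqrt 2
    exp (- x^2 / 4), at most sqrt 2 exp (- u / 4) on the event. *)
Lemma std_normal_tail (u : R) :
  (gamma [set x | (u <= x ^+ 2)%R] <= (Num.sqrt 2 * expR (- (u / 4)))%:E)%E.
Proof.
have s2 : 0 < Num.sqrt 2 :> R by rewrite sqrtr_gt0.
pose c : R := Num.sqrt 2 * expR (- (u / 4)).
have c0 : 0 <= c by rewrite mulr_ge0 ?expR_ge0// ltW.
have pdf_le x : u <= x ^+ 2 -> phi x <= c * normal_pdf 0 (Num.sqrt 2) x.
  move=> ux; rewrite std_normal_pdfE normal_pdfE ?gt_eqF// /normal_peak /normal_fun.
  rewrite subr0 sqr_sqrtr// (_ : 2 * pi *+ 2 = 2 * (2 * pi)); last by rewrite -mulr_natl.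
  rewrite (@sqrtrM _ 2 (2 * pi))// invfM /c.
  have -> (a b d : R) : Num.sqrt 2 * a * ((Num.sqrt 2)^-1 * b * d) = b * (a * d).
    by field; rewrite gt_eqF.
  rewrite ler_wpM2l ?invr_ge0 ?sqrtr_ge0// -expRD ler_expR.
  by rewrite -mulr_natl; lra.
have mA := measurable_sqr_ge u.
rewrite /normal_prob.
have mphi s : measurable_fun [set: measurableTypeR R] (fun x => (normal_pdf 0 s x)%:E).
  by apply/measurable_EFinP; exact: measurable_normal_pdf.
set A := [set x | _] in mA *.
have le1 : (\int[mu]_(x in A) (phi x)%:E <=
    \int[mu]_(x in A) (c%:E * (normal_pdf 0 (Num.sqrt 2) x)%:E))%E.
  apply: ge0_le_integral => //.
  - by move=> x _; rewrite lee_fin std_normal_pdf_ge0.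
  - exact: measurable_funTS.
  - by apply: measurable_funeM; exact: measurable_funTS.
apply: (le_trans le1).
have le2 : (\int[mu]_(x in A) (c%:E * (normal_pdf 0 (Num.sqrt 2) x)%:E) <=
    \int[mu]_(x in [set: R]) (c%:E * (normal_pdf 0 (Num.sqrt 2) x)%:E))%E.
  apply: ge0_subset_integral => //.
  - exact: measurable_funeM.
  - by move=> x _; rewrite -EFinM lee_fin mulr_ge0// normal_pdf_ge0.
apply: (le_trans le2); rewrite ge0_integralZl//.
- by rewrite integral_normal_pdf mule1.
- by move=> x _; rewrite lee_fin normal_pdf_ge0.
Qed.

(** exp (u / 4) >= 1 + u / 4, and 1 + u / 4 - sqrt u is the square of 1 - sqrt u / 2. *)
Lemma expR_quarter_le (u : R) : 0 < u -> expR (- (u / 4)) <= (Num.sqrt u)^-1.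
Proof.
move=> u0; rewrite expRN lef_pV2 ?posrE ?expR_gt0 ?sqrtr_gt0//.
apply: (@le_trans _ _ (1 + u / 4)); last exact: expR_ge1Dx.
have := sqr_sqrtr (ltW u0); set s := Num.sqrt u => <-.
by have := sqr_ge0 (1 - s / 2); rewrite sqrrB; lra.
Qed.

Lemma std_normal_pdf_le1 (x : R) : phi x <= 1.
Proof.
apply: le_trans (normal_pdf_ub _ _ _) _; first exact: oner_neq0.
rewrite /normal_peak expr1n mul1r; move: (@pi R) (pi_ge2 R) => p p2.
rewrite -mulr_natl invf_le1 ?sqrtr_gt0; last by lra.
by rewrite -{1}sqrtr1 ler_sqrt; lra.
Qed.

Lemma std_normal_le_lebesgue (A : set (measurableTypeR R)) :
  measurable A -> (gamma A <= mu A)%E.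
Proof.
move=> mA; rewrite -[leRHS]mul1e -integral_cst//.
apply: ge0_le_integral => //.
- by move=> x _; rewrite lee_fin std_normal_pdf_ge0.
- by apply/measurable_EFinP; apply: measurable_funTS; exact: measurable_normal_pdf.
- by move=> x _; rewrite lee_fin std_normal_pdf_le1.
Qed.

(** The window lies in two symmetric intervals, each of length at most sqrt (e / lam) by
    subadditivity of the square root, and the density is at most 1. *)
Lemma std_normal_sqr_window (lam s e : R) : 0 < lam -> 0 <= e ->
  (gamma [set x | (s <= lam * x ^+ 2 < s + e)%R] <= (2 * Num.sqrt (e / lam))%:E)%E.
Proof.
move=> lam0 e0; pose b : R := Num.sqrt ((s + e) / lam).
(* The lower end s may be negative, where the window starts at x = 0. *)
pose a : R := Num.sqrt (Num.max 0 s / lam).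
have [se0|se0] := leP (s + e) 0.
  rewrite (_ : [set _ | _] = set0) ?measure0 ?lee_fin ?mulr_ge0 ?sqrtr_ge0//.
  apply/seteqP; split => // x /= /andP[_] /lt_le_trans /(_ se0).
  by rewrite ltNge mulr_ge0 ?sqr_ge0// ltW.
have m0 : 0 <= Num.max 0 s by rewrite le_max lexx.
have ab : a <= b.
  rewrite ler_sqrt ?divr_ge0 ?(ltW lam0) ?(ltW se0)// ler_pM2r ?invr_gt0//.
  by rewrite ge_max (ltW se0) lerDl.
have bae : b - a <= Num.sqrt (e / lam).
  rewrite lerBlDl.
  rewrite -[leRHS]ger0_norm ?addr_ge0 ?sqrtr_ge0// -sqrtr_sqr ler_sqrt ?sqr_ge0//.
  rewrite sqrrD !sqr_sqrtr ?divr_ge0 ?(ltW lam0)//.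
  have : 0 <= a * Num.sqrt (e / lam) by rewrite mulr_ge0 ?sqrtr_ge0.
  have : (s + e) / lam <= (Num.max 0 s + e) / lam.
    by rewrite ler_pM2r ?invr_gt0// lerD2r le_max lexx orbT.
  by rewrite -/a [X in _ <= X -> _]mulrDl -mulr_natl; lra.
have mI (x y : R) : measurable (`[x, y]%classic : set (measurableTypeR R)).
  exact: measurable_itv.
apply: (@le_trans _ _ (gamma (`[a, b] `|` `[- b, - a])%classic)).
  apply: le_measure; rewrite ?inE.
  - have m2 : measurable_fun [set: R] (fun x : R => lam * x ^+ 2).
      by apply: measurable_funM => //; exact: measurable_funX.
    have := m2 measurableT _ (measurable_itv `[s, s + e[); rewrite setTI.
    by congr measurable; apply/seteqP; split => x /=; rewrite in_itv/=.
  - exact: measurableU.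
  move=> x /= /andP[sx xe].
  have h1 : a <= `|x|.
    rewrite -sqrtr_sqr ler_sqrt ?sqr_ge0// ler_pdivrMr// mulrC ge_max sx.
    by rewrite mulr_ge0 ?sqr_ge0// ltW.
  have h2 : `|x| <= b.
    rewrite -sqrtr_sqr ler_sqrt ?divr_ge0 ?(ltW lam0) ?(ltW se0)//.
    by rewrite ler_pdivlMr// mulrC ltW.
  by move: h1 h2; case: (ger0P x) => x0 h1 h2; [left|right];
    rewrite in_itv/=; apply/andP; split=> //; lra.
apply: le_trans (measureU2 _ (mI _ _) (mI _ _)) _.
apply: (@le_trans _ _ (mu `[a, b]%classic + mu `[(- b)%R, (- a)%R]%classic)%E).
  by apply: leeD; exact: std_normal_le_lebesgue.
rewrite !lebesgue_measure_itv/= !lte_fin.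
have itv (x y : R) : x <= y -> ((if (x < y)%R then y%:E + (- x)%:E else 0%R) <= (y - x)%:E)%E.
  by move=> xy; case: ifP => // _; rewrite lee_fin subr_ge0.
apply: (@le_trans _ _ ((b - a)%:E + (- a - - b)%R%:E)%E).
  by apply: leeD; apply: itv => //; rewrite lerN2.
by rewrite -EFinD lee_fin; lra.
Qed.

Context d (T : measurableType d) (Pr : probability T R).

Lemma std_gaussian_marginal n (Y : T -> 'cV[R]_n) (i : 'I_n) (B : set R) :
  std_gaussian Pr Y -> measurable B -> Pr [set om | B (Y om i 0)] = gamma B.
Proof.
move=> gY mB; have := gY (fun j => if j == i then B else setT).
rewrite (bigD1 i)//= eqxx big1 => [|j /negbTE ->]; last exact: probability_setT.
rewrite mule1 => <-; last by move=> j; case: ifP.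
congr (Pr _); apply/seteqP; split => om /=; last by move=> /(_ i); rewrite eqxx.
by move=> h j; case: eqP => // ->.
Qed.

(** A squared norm of at least n u forces some coordinate to have square at least u; the factor n is
    the union bound. *)
Lemma std_gaussian_norm_tail n (Y : T -> 'cV[R]_n) (u : R) : (0 < n)%N ->
  measurable_coords Y -> std_gaussian Pr Y ->
  (Pr [set om | (n%:R * u <= enorm (Y om) ^+ 2)%R] <=
   (n%:R * (Num.sqrt 2 * expR (- (u / 4))))%:E)%E.
Proof.
move=> n0 mY gY; pose A i := [set om | u <= Y om i 0 ^+ 2].
have mA i : measurable (A i).
  by rewrite -[A i]setTI; exact: (mY i measurableT _ (measurable_sqr_ge u)).
have [mU leU] : measurable (\big[setU/set0]_(i < n) A i) /\
    (Pr (\big[setU/set0]_(i < n) A i) <=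
     \sum_(i < n) (Num.sqrt 2 * expR (- (u / 4)))%:E)%E.
  elim/big_ind2 : _ => [|X x X' x' [mX hX] [mX' hX']|i _].
  - by rewrite measure0.
  - split; first exact: measurableU.
    by apply: le_trans (measureU2 _ _ _) _ => //; exact: leeD.
  - split=> //; rewrite -/(Pr _) (std_gaussian_marginal i gY (measurable_sqr_ge u)).
    exact: std_normal_tail.
apply: (@le_trans _ _ (Pr (\big[setU/set0]_(i < n) A i))).
  have mN : measurable_fun [set: T] (fun om => enorm (Y om) ^+ 2).
    under eq_fun do rewrite enorm_sqr.
    by apply: measurable_sum => i; exact: measurable_funX.
  apply: le_measure; rewrite ?inE//.
    have := mN measurableT _ (measurable_itv `[n%:R * u, +oo[); rewrite setTI.
    by congr measurable; apply/seteqP; split => om /=; rewrite in_itv/= andbT.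
  move=> om /= h; have [i ui] : exists i, u <= Y om i 0 ^+ 2.
    apply: contrapT => /forallNP no; move: h; rewrite leNgt => /negP; apply.
    rewrite enorm_sqr (_ : n%:R * u = \sum_(i < n) u); last first.
      by rewrite sumr_const card_ord mulr_natl.
    apply: ltr_sum => [|i _]; first by apply/hasP; exists (Ordinal n0); rewrite ?mem_index_enum.
    by rewrite ltNge; apply/negP/no.
  by rewrite (bigD1 i)//=; left.
apply: le_trans leU _; rewrite sumEFin lee_fin.
by rewrite sumr_const card_ord mulr_natl.
Qed.

End std_normal_estimates.

(** * The covariance of a vector with bounded fourth moment *)

Section covariance_bound.
Context {R : realType} d (T : measurableType d) (P : probability T R).
Variables (D : set T) (q : nat) (g : T -> 'rV[R]_q) (kappa : R).
Hypothesis mD : measurable D.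
Hypothesis PD : P D = 1%E.
Hypothesis mg : forall j, measurable_fun D (fun x => g x 0 j).
Hypothesis kappa0 : 0 < kappa.
Hypothesis g4 : (\int[P]_(x in D) (enorm (g x)^T ^+ 4)%:E <= (kappa ^+ 2)%:E)%E.

Local Notation E f := (\int[P]_(x in D) f x).
Local Notation int f := (P.-integrable D (EFin \o f)).

Lemma integrable_EFin_sum (I : Type) (s : seq I) (f : I -> T -> R) :
  (forall i, int (f i)) -> int (fun x => \sum_(i <- s) f i x).
Proof.
move=> fi; rewrite (_ : _ \o _ = fun x => (\sum_(i <- s) (f i x)%:E)%E).
  by apply: integrable_sum => // i _; exact: fi.
by apply/funext => x /=; rewrite sumEFin.
Qed.

Lemma Rintegral_sum (I : Type) (s : seq I) (f : I -> T -> R) :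
  (forall i, int (f i)) ->
  E (fun x => \sum_(i <- s) f i x) = \sum_(i <- s) E (f i).
Proof.
move=> fi; elim: s => [|i s IH].
  under eq_Rintegral do rewrite big_nil; rewrite big_nil.
  by rewrite Rintegral_cst// mul0r.
under eq_Rintegral do rewrite big_cons; rewrite big_cons RintegralD ?IH//.
exact: integrable_EFin_sum.
Qed.

Let intD (f f' : T -> R) : int f -> int f' -> int (fun x => f x + f' x).
Proof. by move=> h h'; exact: (integrableD mD h h'). Qed.

Let intZ (c : R) (f : T -> R) : int f -> int (fun x => c * f x).
Proof. by move=> h; exact: (integrableZl mD c h). Qed.

Let sqr_norm x := enorm (g x)^T ^+ 2.

Let sqr_normE x : sqr_norm x = \sum_j g x 0 j ^+ 2.
Proof. by rewrite /sqr_norm enorm_sqr; apply: eq_bigr => j _; rewrite mxE. Qed.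

Let msqr : measurable_fun D sqr_norm.
Proof.
rewrite (_ : sqr_norm = fun x => \sum_j g x 0 j ^+ 2); last exact/funext.
by apply: measurable_sum => j; exact: measurable_funX.
Qed.

Let int_cst (c : R) : int (fun=> c).
Proof.
apply/integrableP; split; first exact: measurable_cst.
by rewrite /= integral_cst//= PD mule1 ltry.
Qed.

Let E_cst (c : R) : E (fun=> c) = c.
Proof. by have := Rintegral_cst P mD c => ->; rewrite /= PD mulr1. Qed.

Let int_sqr4 : int (fun x => sqr_norm x ^+ 2).
Proof.
apply/integrableP; split.
  by apply/measurable_EFinP; exact: measurable_funX.
under eq_integral do rewrite /= ger0_norm ?sqr_ge0// -exprM.
exact: le_lt_trans g4 (ltry _).
Qed.

(** The arithmetic-geometric inequality with weight kappa replaces Cauchy-Schwarz for integrals and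
    loses nothing: integrated, the right side is at most (kappa + kappa) / 2. *)
Let sqr_le x : sqr_norm x <= (kappa + kappa^-1 * sqr_norm x ^+ 2) / 2.
Proof.
rewrite -subr_ge0 (_ : _ - _ = (kappa - sqr_norm x) ^+ 2 / (2 * kappa)).
  by rewrite divr_ge0 ?sqr_ge0// mulr_ge0// ltW.
by field; rewrite gt_eqF.
Qed.

Let int_bound : int (fun x => (kappa + kappa^-1 * sqr_norm x ^+ 2) / 2).
Proof.
rewrite (_ : EFin \o _ = (fun x => (2^-1)%:E * (kappa%:E + (kappa^-1)%:E * (sqr_norm x ^+ 2)%:E))%E).
  apply: integrableZl => //; apply: integrableD => //; first exact: int_cst.
  by apply: integrableZl => //; exact: int_sqr4.
by apply/funext => x; rewrite /= mulrC.
Qed.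

Let int_sqr : int sqr_norm.
Proof.
apply: le_integrable int_bound => //; first exact/measurable_EFinP.
move=> x _; rewrite lee_fin ger0_norm ?sqr_ge0//.
by apply: le_trans (ler_norm _); exact: sqr_le.
Qed.

Let E_sqr_le : E sqr_norm <= kappa.
Proof.
apply: (@le_trans _ _ (E (fun x => (kappa + kappa^-1 * sqr_norm x ^+ 2) / 2))).
  by apply: le_Rintegral.
have le4 : E (fun x => sqr_norm x ^+ 2) <= kappa ^+ 2.
  rewrite -lee_fin fineK; last exact: integrable_fin_num int_sqr4.
  by apply: le_trans g4; under eq_integral do rewrite /sqr_norm -exprM.
rewrite RintegralZr//; last first.
  by apply: intD; [exact: int_cst|apply: intZ; exact: int_sqr4].
rewrite RintegralD//; last first; first by apply: intZ; exact: int_sqr4.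
rewrite RintegralZl// E_cst.
rewrite ler_pdivrMr// mulrDr mulr1 lerD2l ler_pdivrMl// -expr2//.
Qed.

Let int_mul j k : int (fun x => g x 0 j * g x 0 k).
Proof.
apply: le_integrable int_sqr => //.
  by apply/measurable_EFinP; exact: measurable_funM.
move=> x _; rewrite lee_fin [leRHS]ger0_norm ?sqr_ge0// sqr_normE.
have le i : g x 0 i ^+ 2 <= \sum_j g x 0 j ^+ 2.
  by rewrite (bigD1 i)//= lerDl sumr_ge0// => m _; exact: sqr_ge0.
have := le j; have := le k.
have := sqr_ge0 (g x 0 j - g x 0 k); have := sqr_ge0 (g x 0 j + g x 0 k).
rewrite sqrrD sqrrB ler_norml -mulr_natl; move=> *; apply/andP; split; lra.
Qed.

Let int_g j : int (fun x => g x 0 j).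
Proof.
have : int (fun x => 1 + g x 0 j * g x 0 j).
  rewrite (_ : EFin \o _ = (fun x => 1%:E + (g x 0 j * g x 0 j)%:E)%E)//.
  by apply: integrableD => //; [exact: int_cst|exact: int_mul].
apply: le_integrable => //; first exact/measurable_EFinP.
move=> x _; rewrite lee_fin; apply: le_trans (ler_norm _).
have := sqr_ge0 (g x 0 j - 1); have := sqr_ge0 (g x 0 j + 1).
rewrite sqrrD sqrrB ler_norml; move=> *; apply/andP; split; lra.
Qed.

Let m j := E (fun x => g x 0 j).
Let h x j := g x 0 j - m j.

Let int_h j : int (fun x => h x j).
Proof. by apply: intD; [exact: int_g|exact: int_cst]. Qed.

Let int_hh j k : int (fun x => h x j * h x k).
Proof.
rewrite (_ : (fun x => _) = fun x => g x 0 j * g x 0 k + (- m k) * g x 0 j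
   + (- m j) * h x k); last by apply/funext => x; rewrite /h; ring.
apply: intD; last by apply: intZ; exact: int_h.
by apply: intD; [exact: int_mul|apply: intZ; exact: int_g].
Qed.

Let E_hh j : E (fun x => h x j * h x j) <= E (fun x => g x 0 j * g x 0 j).
Proof.
have -> : (fun x => h x j * h x j) = fun x => g x 0 j * g x 0 j + (- m j * 2) * g x 0 j
   + m j ^+ 2 by apply/funext => x; rewrite /h; ring.
have i1 : int (fun x => (- m j * 2) * g x 0 j) by apply: intZ; exact: int_g.
have i2 := int_mul j j; have i3 := int_cst (m j ^+ 2); have i4 := intD i2 i1.
rewrite (RintegralD mD i4 i3) (RintegralD mD i2 i1) (RintegralZl _ mD (int_g j)) E_cst.
rewrite -/(m j).
by have := sqr_ge0 (m j); rewrite expr2; lra.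
Qed.

(** The left side is the trace of W times the covariance, that is the expectation of the form W at
    the centred vector. It is at most w times the expected squared norm, which centring can only
    decrease. *)
Lemma covariance_bound (W : 'M[R]_q) (w : R) : 0 <= w ->
  (forall x, quadform W x <= w * enorm x ^+ 2) ->
  \sum_j \sum_k W j k * E (fun x => h x j * h x k) <= w * kappa.
Proof.
move=> w0 Ww; pose hv x : 'cV[R]_q := \col_j h x j.
have int1 j k : int (fun x => W j k * (h x j * h x k)) by exact/intZ/int_hh.
have int2 j : int (fun x => \sum_k W j k * (h x j * h x k)).
  exact: integrable_EFin_sum.
have int3 : int (fun x => w * \sum_j h x j * h x j).
  by apply: intZ; apply: integrable_EFin_sum.
have -> : \sum_j \sum_k W j k * E (fun x => h x j * h x k) =
   E (fun x => \sum_j \sum_k W j k * (h x j * h x k)).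
  rewrite Rintegral_sum//; apply: eq_bigr => j _; rewrite Rintegral_sum//.
  by apply: eq_bigr => k _; rewrite RintegralZl.
apply: (@le_trans _ _ (E (fun x => w * \sum_j h x j * h x j))).
  apply: le_Rintegral => //; first exact: integrable_EFin_sum.
  move=> x _; have := Ww (hv x); rewrite quadformE enorm_sqr.
  rewrite (_ : \sum_i hv x i 0 ^+ 2 = \sum_j h x j * h x j); last first.
    by apply: eq_bigr => j _; rewrite mxE expr2.
  apply: le_trans; rewrite le_eqVlt; apply/orP; left; apply/eqP.
  apply: eq_bigr => j _; apply: eq_bigr => k _; rewrite !mxE; ring.
rewrite RintegralZl//; last exact: integrable_EFin_sum.
rewrite ler_wpM2l//; apply: le_trans E_sqr_le.
rewrite (_ : sqr_norm = fun x => \sum_j g x 0 j * g x 0 j); last exact/funext.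
by rewrite !Rintegral_sum//; apply: ler_sum => j _; exact: E_hh.
Qed.

End covariance_bound.

Section measurable_gradient.
Context {R : realType} d (T : measurableType d) (D : set T).

Let cvg_scaled_harmonic (r : R) : 0 < r ->
  (fun n => r * harmonic n) @ \oo --> (0 : R)^'.
Proof.
move=> r0 A /= [e /= e0 eA].
have h : (fun n => r * harmonic n) @ \oo --> (0 : R).
  by rewrite -[X in _ --> X](mulr0 r); apply: cvgMl_tmp; exact: cvg_harmonic.
have /cvgrPdist_lt/(_ e e0) := h.
apply: filterS => n /= hn; apply: eA => //.
by rewrite mulf_neq0 ?gt_eqF// harmonic_gt0.
Qed.

(** A partial derivative is a pointwise limit of difference quotients, here along steps r / (2 (k +
    1)) that stay in [Th], where F is known to be measurable. *)
Lemma measurable_grad n (Th : set 'cV[R]_n) (a : 'cV[R]_n) (F : 'cV[R]_n -> T -> R) (j : 'I_n) :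
  open Th -> Th a -> (forall x, Th x -> measurable_fun D (F x)) ->
  (forall z, D z -> differentiable (F^~ z) a) ->
  measurable_fun D (fun z => grad (F^~ z) a 0 j).
Proof.
move=> oTh Tha mF dF.
have /nbhs_ballP[r r0 br] : nbhs a Th by exact: open_nbhs_nbhs.
pose h n : R := r / 2 * harmonic n.
have h0 : h @ \oo --> (0 : R)^' by apply: cvg_scaled_harmonic; rewrite divr_gt0.
apply: (measurable_fun_cvg (h := fun n z => (h n)^-1 *: (F (h n *: delta_mx j 0 + a) z - F a z))).
  move=> k; apply: measurable_funM => //; apply: measurable_funB; last exact: mF.
  apply: mF; apply: br; rewrite -ball_normE /ball_/= opprD addrCA subrr addr0 normrN.
  apply: le_lt_trans (ler_enorm _) _; rewrite enormZ enorm_delta mulr1.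
  have hk : 0 < harmonic k :> R by exact: harmonic_gt0.
  have hk1 : harmonic k <= 1 :> R by rewrite /harmonic/= invf_le1// ler1n.
  rewrite ger0_norm ?mulr_ge0 ?(ltW hk) ?divr_ge0 ?(ltW r0)//.
  have hr : h k <= r / 2 by rewrite ler_piMr// divr_ge0// ltW.
  by apply: (le_lt_trans hr); move: r0 => /= r0; lra.
move=> z Dz; rewrite mxE.
have dv : derivable (F^~ z) a (delta_mx j 0) by exact/diff_derivable/dF.
exact: (cvg_comp _ _ h0 dv).
Qed.

End measurable_gradient.

Section moments.
Context {R : realType} {p q d : nat} (S : eto_problem R p q d).

(** Negation exchanges the positive and negative parts, and [fine] sends infinite values to 0, so
    the identity covers every f. It is applied to the log-density at every theta, inside [Theta] or
    not. *)
Lemma EPN f : EP S (fun z => - f z) = - EP S f.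
Proof.
rewrite /EP /Rintegral.
have := integralE (Ptrue S) (Zset S) (\- (EFin \o f))%E.
rewrite funeposN funenegN => e; apply: etrans (congr1 fine e) _.
rewrite [in RHS]integralE.
have : (0 <= \int[Ptrue S]_(x in Zset S) ((EFin \o f)^\+ x))%E by exact: integral_ge0.
have : (0 <= \int[Ptrue S]_(x in Zset S) ((EFin \o f)^\- x))%E by exact: integral_ge0.
case: (\int[_]_(x in _) _)%E => [a| |]; case: (\int[_]_(x in _) _)%E => [b| |] //= _ _.
all: rewrite ?oppr0// ?opprB//.
Qed.

Lemma normP4_integral (f : borelV R d -> R) (c : R) : 0 <= c ->
  measurable (Zset S) ->
  (forall z, 0 <= f z) -> (normP S 4 f <= c%:E)%E ->
  (\int[Ptrue S]_(z in Zset S) (f z ^+ 4)%:E <= (c ^+ 4)%:E)%E.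
Proof.
move=> c0 mZ f0; rewrite /normP => h.
have : ('N[Ptrue S]_(4%:E)[(EFin \o f) \_ (Zset S)] `^ 4 <= c%:E `^ 4)%E.
  apply: gt0_ler_poweR => //; rewrite in_itv/= ?leey ?lee_fin ?c0 ?Lnorm_ge0//.
rewrite poweR_Lnorm// poweR_EFin (powR_mulrn 4 c0); apply: le_trans.
rewrite [leLHS]integral_mkcond le_eqVlt; apply/orP; left; apply/eqP.
apply: eq_integral => z _; rewrite !patchE; case: ifPn => _ /=.
  by rewrite ger0_norm// -powR_mulrn.
by rewrite normr0 powR0.
Qed.

Lemma sqr_frobenius_mxtrace n (M : 'M[R]_n) : M^T = M -> sqr_frobenius M = \tr (M *m M).
Proof.
move=> sM; apply: eq_bigr => i _; rewrite mxE; apply: eq_bigr => j _.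
by rewrite -[in X in _ = _ * X]sM mxE expr2.
Qed.

(** The squared Frobenius norm is tr (M1^2) = tr (N V N) = tr (N N V), where N is the inverse
    Hessian, of norm at most 1 / mu, and V the covariance of the score. The fourth moment (c4 sqrt
    q)^4 = (c4^2 q)^2 bounds tr V by c4^2 q. *)
Lemma sqr_frobenius_M1_le (mu c1 c2 c3 c4 l1 l2 : R) (M1 : 'M[R]_q) :
  (0 < q)%N -> 0 < mu -> 0 < c4 ->
  eto_setting S -> eto_regularity S mu c1 c2 c3 c4 l1 l2 -> is_M1 S M1 ->
  sqr_frobenius M1 <= mu^-1 ^+ 2 * (c4 ^+ 2 * q%:R).
Proof.
move=> q0 mu0 c40 [[_ oT mZ PZ] hd _ _ [_ TK _]]
  [K1 [K2 [K3 [_ _ _ [hr growth _] [_ td _ n4]]]]] [[sM _] M1E].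
set Hr := hess (fun theta => EP S (loss S theta)) (thetaKL S).
have coer := quadratic_growth_hess oT TK (ltW mu0) growth td.
have HE : hess (fun theta => EP S (logp S theta)) (thetaKL S) = - Hr.
  rewrite /Hr -(hessN td); apply: (congr1 (fun f => hess f (thetaKL S))).
  by apply/funext => th; rewrite (EPN (logp S th)) opprK.
move: M1E; rewrite HE; set N := invmx (- Hr); set V := varP _ _ => M1E.
have coerN v : mu * enorm v ^+ 2 <= `|quadform (- Hr) v|.
  rewrite -[- Hr]sub0r quadformB (_ : quadform 0 v = 0); last first.
    by rewrite /quadform mulmx0 mul0mx mxE.
  by rewrite sub0r normrN; apply: le_trans (ler_norm _); exact: coer.
have Nle := coercive_invmx_le mu0 coerN.
rewrite sqr_frobenius_mxtrace// M1E mxtrace_mulC mulmxA.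
pose g z := grad (logp S^~ z) (thetaKL S).
have logpE z : logp S^~ z = (fun th => - loss S th z).
  by apply/funext => th; rewrite opprK.
have dl z : Zset S z -> differentiable (loss S^~ z) (thetaKL S).
  by move=> Zz; have [[/nbhs_singleton]] := hr _ _ TK Zz.
have gE z : Zset S z -> g z = - grad (loss S^~ z) (thetaKL S).
  by move=> Zz; rewrite /g logpE gradN//; exact: dl.
have mg j : measurable_fun (Zset S) (fun z => g z 0 j).
  apply: (measurable_grad j oT TK) => [th Tth|z Zz].
    have [mdens _ _ _] := hd _ Tth.
    exact: (measurableT_comp (@measurable_ln R)).
  by rewrite logpE; apply: differentiableN; exact: dl.
have k0 : 0 < c4 ^+ 2 * q%:R by rewrite mulr_gt0 ?exprn_gt0// ltr0n.
have g4 : (\int[Ptrue S]_(z in Zset S) (enorm (g z)^T ^+ 4)%:E <=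
    ((c4 ^+ 2 * q%:R) ^+ 2)%:E)%E.
  have := @normP4_integral (fun z => enorm (grad (loss S^~ z) (thetaKL S))^T)
    (c4 * Num.sqrt q%:R) _ mZ (fun z => enorm_ge0 _) n4.
  rewrite (_ : (c4 * _) ^+ 4 = (c4 ^+ 2 * q%:R) ^+ 2); last first.
    by rewrite -[in RHS](sqr_sqrtr (ler0n R q)) -exprMn -exprM.
  rewrite mulr_ge0 ?sqrtr_ge0 ?(ltW c40)// => /(_ isT); apply: le_trans.
  rewrite le_eqVlt; apply/orP; left; apply/eqP.
  apply: eq_integral => z /set_mem Zz; rewrite gE//.
  by rewrite linearN/= -scaleN1r enormZ normrN1 mul1r.
have w0 : 0 <= mu^-1 ^+ 2 by exact: sqr_ge0.
have NN x : quadform (N *m N) x <= mu^-1 ^+ 2 * enorm x ^+ 2.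
  apply: le_trans (ler_norm _) _; rewrite /quadform -mulmxA.
  apply: le_trans (cauchy_schwarz _ _) _.
  rewrite [enorm x ^+ 2]expr2 mulrCA ler_wpM2l ?enorm_ge0// -mulmxA.
  apply: le_trans (Nle _) _; rewrite expr2 -mulrA ler_wpM2l ?invr_ge0 ?(ltW mu0)//.
have := covariance_bound mZ PZ mg k0 g4 w0 NN; apply: le_trans.
rewrite le_eqVlt; apply/orP; left; apply/eqP.
apply: eq_bigr => j _; rewrite mxE; apply: eq_bigr => k _; congr (_ * _).
rewrite mxE; apply: eq_Rintegral => z _; exact: mulrC.
Qed.

End moments.

(** * Comparison of the regret with its Gaussian limit *)

Section real_probability.
Context {R : realType} d (T : measurableType d) (P : probability T R).
Implicit Types A B : set T.

Lemma fine_probability_le A (c : R) :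
  measurable A -> (P A <= c%:E)%E -> fine (P A) <= c.
Proof. by move=> mA h; rewrite -lee_fin fineK//; exact: fin_num_measure. Qed.

Lemma fine_le_probability A B :
  measurable A -> measurable B -> A `<=` B -> fine (P A) <= fine (P B).
Proof.
move=> mA mB AB; apply: fine_le; [exact: fin_num_measure..|].
by apply: le_measure; rewrite ?inE.
Qed.

Lemma fine_probabilityU A B : measurable A -> measurable B ->
  fine (P (A `|` B)) <= fine (P A) + fine (P B).
Proof.
move=> mA mB; apply: fine_probability_le; first exact: measurableU.
by rewrite EFinD !fineK ?fin_num_measure//; exact: measureU2.
Qed.

Lemma fine_probability_setC A : measurable A -> fine (P (~` A)) = 1 - fine (P A).
Proof.
move=> mA; rewrite probability_setC// -(fineK (fin_num_measure P A mA)).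
by rewrite -EFinB.
Qed.

Lemma measurable_itv_preimage (f : T -> R) (I : interval R) :
  measurable_fun setT f -> measurable [set x | f x \in I].
Proof.
by move=> mf; rewrite -[X in measurable X]setTI; exact: mf (measurable_itv I).
Qed.

Lemma measurable_ge (f : T -> R) u : measurable_fun setT f -> measurable [set x | u <= f x].
Proof.
move=> mf; have := measurable_itv_preimage `[u, +oo[ mf; congr measurable.
by apply/seteqP; split => x /=; rewrite in_itv/= andbT.
Qed.

Lemma measurable_gt (f : T -> R) u : measurable_fun setT f -> measurable [set x | u < f x].
Proof.
move=> mf; have := measurable_itv_preimage `]u, +oo[ mf; congr measurable.
by apply/seteqP; split => x /=; rewrite in_itv/= andbT.
Qed.

End real_probability.

Section comparison.
Context {R : realType} {q : nat}.
Context d (T : measurableType d) (Pr : probability T R).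
Context d' (T' : measurableType d') (Pr' : probability T' R).
Variables (X : T -> 'cV[R]_q) (X' : T' -> 'cV[R]_q) (L : T -> R).
Variables (H : 'M[R]_q) (b e w r s : R).
Hypothesis psdH : psd_quadform H.
Hypothesis mX : forall B, measurable_fun setT (fun om => quadform B (X om)).
Hypothesis mX' : forall B, measurable_fun setT (fun om => quadform B (X' om)).
Hypothesis convex_close : forall A : set 'cV[R]_q,
  convex_set A -> measurable (A : set (borelV R q)) ->
  `|fine (Pr [set om | A (X om)]) - fine (Pr' [set om | A (X' om)])| <= b.
Hypothesis r0 : 0 <= r.
Hypothesis s0 : 0 <= s.
Hypothesis LX : forall om, enorm (X om) <= r -> enorm (X om) < s ->
  `|L om - quadform H (X om)| <= e.
Hypothesis window : forall u,
  fine (Pr' [set om | u <= quadform H (X' om) < u + e]) <= w.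

(** Superlevel sets of a form are not convex; the comparison is made for their convex
    complements. *)
Let ge_close B u : psd_quadform B ->
  `|fine (Pr [set om | u <= quadform B (X om)])
    - fine (Pr' [set om | u <= quadform B (X' om)])| <= b.
Proof.
move=> B0.
have C (U : Type) (f : U -> R) : [set om | u <= f om] = ~` [set om | f om < u].
  by apply/seteqP; split => om /=; rewrite leNgt => /negP.
have mlt d0 (U : measurableType d0) (f : U -> R) : measurable_fun setT f ->
    measurable [set om | f om < u].
  by move=> mf; rewrite -[X in measurable X]setCK -C; apply/measurableC/measurable_ge.
rewrite !C !fine_probability_setC; [|exact: mlt..].
have mA : measurable ([set x | quadform B x < u] : set (borelV R q)).
  by have := measurable_quadform B `]-oo, u[; congr measurable.
have := convex_close (@convex_quadform_lt _ _ _ u B0) mA.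
by rewrite /= distrC; congr (_ <= _); congr `|_|; ring.
Qed.

Let gt_close B u : psd_quadform B ->
  `|fine (Pr [set om | u < quadform B (X om)])
    - fine (Pr' [set om | u < quadform B (X' om)])| <= b.
Proof.
move=> B0.
have C (U : Type) (f : U -> R) : [set om | u < f om] = ~` [set om | f om <= u].
  by apply/seteqP; split => om /=; rewrite ltNge => /negP.
have mlt d0 (U : measurableType d0) (f : U -> R) : measurable_fun setT f ->
    measurable [set om | f om <= u].
  by move=> mf; rewrite -[X in measurable X]setCK -C; apply/measurableC/measurable_gt.
rewrite !C !fine_probability_setC; [|exact: mlt..].
have mA : measurable ([set x | quadform B x <= u] : set (borelV R q)).
  by have := measurable_quadform B `]-oo, u]; congr measurable.
have := convex_close (@convex_quadform_le _ _ _ u B0) mA.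
by rewrite /= distrC; congr (_ <= _); congr `|_|; ring.
Qed.

Let psd1 : psd_quadform (1%:M : 'M[R]_q).
Proof. by move=> x; rewrite quadform1 sqr_ge0. Qed.

Let bad_r := [set om | r ^+ 2 < quadform 1%:M (X om)].
Let bad_s := [set om | s ^+ 2 <= quadform 1%:M (X om)].
Let tails := fine (Pr' [set om | r ^+ 2 < enorm (X' om) ^+ 2]) +
  fine (Pr' [set om | s ^+ 2 <= enorm (X' om) ^+ 2]).

Let bad_le : fine (Pr bad_r) + fine (Pr bad_s) <= tails + 2 * b.
Proof.
have := gt_close (r ^+ 2) psd1; have := ge_close (s ^+ 2) psd1.
rewrite -/bad_r -/bad_s !ler_norml.
have n1 om : quadform 1%:M (X' om) = enorm (X' om) ^+ 2 by exact: quadform1.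
rewrite /tails.
rewrite (_ : [set om | s ^+ 2 <= quadform 1%:M (X' om)] = [set om | s ^+ 2 <= enorm (X' om) ^+ 2]);
  last by apply/seteqP; split=> om /=; rewrite n1.
rewrite (_ : [set om | r ^+ 2 < quadform 1%:M (X' om)] = [set om | r ^+ 2 < enorm (X' om) ^+ 2]);
  last by apply/seteqP; split=> om /=; rewrite n1.
by move=> /andP[_ h1] /andP[_ h2]; lra.
Qed.

Let good om : ~ bad_r om -> ~ bad_s om -> `|L om - quadform H (X om)| <= e.
Proof.
rewrite /bad_r /bad_s /= quadform1 => /negP; rewrite -leNgt => hr /negP.
rewrite -ltNge => hs; apply: LX.
  by move: hr; rewrite ler_pXn2r ?nnegrE ?enorm_ge0.
by move: hs; rewrite ltr_pXn2r ?nnegrE ?enorm_ge0.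
Qed.

Let mbad_r : measurable bad_r. Proof. exact: measurable_gt. Qed.
Let mbad_s : measurable bad_s. Proof. exact: measurable_ge. Qed.

Let cover A B : measurable A -> measurable B ->
  (forall om, ~ bad_r om -> ~ bad_s om -> A om -> B om) ->
  fine (Pr A) <= fine (Pr B) + tails + 2 * b.
Proof.
move=> mA mB AB; have mb : measurable (bad_r `|` bad_s) by exact: measurableU.
have h : fine (Pr A) <= fine (Pr (B `|` (bad_r `|` bad_s))).
  apply: fine_le_probability => //; first exact: measurableU.
  move=> om Aom; have [br|nbr] := pselect (bad_r om); first by right; left.
  have [bs|nbs] := pselect (bad_s om); first by right; right.
  by left; exact: AB.
have h1 := fine_probabilityU Pr mB mb.
have h2 := fine_probabilityU Pr mbad_r mbad_s.
have h3 := bad_le.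
by lra.
Qed.

Let window_step u : fine (Pr' [set om | u <= quadform H (X' om)]) <=
  fine (Pr' [set om | u + e <= quadform H (X' om)]) + w.
Proof.
have mG v := measurable_ge v (mX' H).
have mW : measurable [set om | u <= quadform H (X' om) < u + e].
  by have := measurable_itv_preimage `[u, u + e[ (mX' H); congr measurable.
have h : fine (Pr' [set om | u <= quadform H (X' om)]) <=
    fine (Pr' ([set om | u + e <= quadform H (X' om)] `|`
               [set om | u <= quadform H (X' om) < u + e])).
  apply: fine_le_probability => //; first exact: measurableU.
  by move=> om /= uQ; case: leP => h; [left|right; rewrite uQ].
have h1 := fine_probabilityU Pr' (mG (u + e)) mW.
have h2 := window u.
by lra.
Qed.

(** Off the two bad events, t <= L lies between t + e <= Q and t - e <= Q. One b is for the level
    set and two are for the balls; w is the Gaussian cost of moving the level by e. *)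
Lemma quadratic_comparison t : measurable [set om | t <= L om] ->
  `|fine (Pr [set om | t <= L om]) - fine (Pr' [set om | t <= quadform H (X' om)])|
  <= 3 * b + w + fine (Pr' [set om | r ^+ 2 < enorm (X' om) ^+ 2]) +
     fine (Pr' [set om | s ^+ 2 <= enorm (X' om) ^+ 2]).
Proof.
move=> mL; rewrite ler_norml.
have c1 := cover mL (measurable_ge (t - e) (mX H)).
have c2 := cover (measurable_ge (t + e) (mX H)) mL.
have {}c1 := c1 (fun om nr ns (tL : t <= L om) =>
  ltac:(move: (good nr ns); rewrite ler_norml => /andP[? ?] /=; lra)).
have {}c2 := c2 (fun om nr ns (tQ : t + e <= quadform H (X om)) =>
  ltac:(move: (good nr ns); rewrite ler_norml => /andP[? ?] /=; lra)).
have := ge_close (t - e) psdH; have := ge_close (t + e) psdH.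
rewrite !ler_norml => /andP[g1 g2] /andP[g3 g4].
have s1 := window_step t; have := window_step (t - e); rewrite subrK => s2.
rewrite /tails in c1 c2.
by apply/andP; split; lra.
Qed.

End comparison.

Section gaussian_quadratic_form.
Context {R : realType} d (T : measurableType d) (Pr : probability T R).
Variables (q : nat) (Y : T -> 'cV[R]_q) (A : 'M[R]_q) (lam : q.-tuple R).
Hypothesis mY : measurable_coords Y.
Hypothesis gY : std_gaussian Pr Y.
Hypothesis psdA : psdmx A.
Hypothesis specA : is_spectrum A lam.

Lemma measurable_quadform_coords (B : 'M[R]_q) :
  measurable_fun setT (fun om => quadform B (Y om)).
Proof.
under eq_fun do rewrite quadformE.
apply: measurable_sum => i; apply: measurable_sum => j.
by apply: measurable_funM => //; apply: measurable_funM.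
Qed.

Let measurable_window u e : measurable [set om | u <= quadform A (Y om) < u + e].
Proof.
have := measurable_itv_preimage `[u, u + e[ (measurable_quadform_coords A).
by congr measurable.
Qed.

Let symA : A^T = A. Proof. by case: psdA. Qed.

Let diagA : exists2 U : 'M[R]_q, rotation U &
  forall y, quadform A y = \sum_(i < q) lam`_i * (U *m y) i 0 ^+ 2.
Proof.
by have [U [rU hU]] := quad_diag symA specA.2; exists U.
Qed.

(** Beyond the last eigenvalue [nth] returns 0, so sign and monotonicity hold for all natural
    indices, as the concentration bounds require. *)
Lemma spectrum_psd_ge0 i : 0 <= lam`_i.
Proof.
have [iq|iq] := ltnP i q; last by rewrite nth_default ?size_tuple.
have [U rU hU] := diagA; pose y : 'cV[R]_q := U^T *m delta_mx (Ordinal iq) 0.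
have := psdA.2 y; rewrite -/(quadform A y) hU mulmxA rotation_orthT// mul1mx.
rewrite (bigD1 (Ordinal iq))//= big1 => [|j ji]; last first.
  by rewrite mxE (negbTE ji) expr0n mulr0.
by rewrite mxE !eqxx expr1n mulr1 addr0.
Qed.

Lemma spectrum_psd_anti i : lam`_i.+1 <= lam`_i.
Proof.
have [iq|iq] := ltnP i.+1 (size lam); last by rewrite nth_default// spectrum_psd_ge0.
by have /sortedP := specA.1 => /(_ 0 i iq).
Qed.

Lemma quadform_window1 (e u : R) : q = 1%N -> 0 <= e -> lam`_0 != 0 ->
  fine (Pr [set om | u <= quadform A (Y om) < u + e]) <= 2 * Num.sqrt (e / lam`_0).
Proof.
move=> q1 e0 l0; have lp : 0 < lam`_0 by rewrite lt_neqAle eq_sym l0 spectrum_psd_ge0.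
have [U rU hU] := diagA.
have q0 : (0 < q)%N by rewrite q1.
have one (i : 'I_q) : i = Ordinal q0.
  by apply/val_inj => /=; have := ltn_ord i; rewrite {2}q1; case: (nat_of_ord i).
have QE om : quadform A (Y om) = lam`_0 * (U *m Y om) (Ordinal q0) 0 ^+ 2.
  by rewrite hU (bigD1 (Ordinal q0))//= big1 ?addr0// => i; rewrite (one i) eqxx.
apply: fine_probability_le => //.
have mB : measurable [set x : R | u <= lam`_0 * x ^+ 2 < u + e].
  have m2 : measurable_fun [set: R] (fun x : R => lam`_0 * x ^+ 2).
    by apply: measurable_funM => //; exact: measurable_funX.
  by have := measurable_itv_preimage `[u, u + e[ m2; congr measurable.
have := std_gaussian_marginal (Ordinal q0) (std_gaussian_rotation rU mY gY) mB.
rewrite (_ : [set om | _] = [set om | u <= quadform A (Y om) < u + e]) => [->|].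
  exact: std_normal_sqr_window.
by apply/seteqP; split => om /=; rewrite QE.
Qed.

Lemma quadform_window2 (e u : R) : (1 < q)%N -> 0 <= e ->
  (\sum_(l <- lam) l ^+ 2) * (\sum_(l <- behead lam) l ^+ 2) != 0 ->
  fine (Pr [set om | u <= quadform A (Y om) < u + e]) <=
  6 * pi * e * ((\sum_(l <- lam) l ^+ 2) * (\sum_(l <- behead lam) l ^+ 2)) `^ (- 4^-1).
Proof.
move=> q1 e0 hM; have [U rU hU] := diagA.
(* The rotated coordinates, continued by 0 to all natural indices. *)
pose Yn k om : R := if insub k is Some i then (U *m Y om) i 0 else 0.
have mOY := measurable_coords_mul U mY.
have gOY := std_gaussian_rotation rU mY gY.
have YnE (i : 'I_q) om : Yn i om = (U *m Y om) i 0 by rewrite /Yn valK.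
have mYn k : measurable_fun setT (Yn k).
  rewrite /Yn; case: insubP => [i _ _|_]; first exact: mOY.
  exact: measurable_cst.
have gYn B : (forall i, measurable (B i)) ->
    Pr [set om | forall i, (i < q)%N -> B i (Yn i om)] =
    (\prod_(0 <= i < q) normal_prob 0 1 (B i))%E.
  move=> mB; rewrite big_mkord -(gOY (fun i : 'I_q => B i))//; congr (Pr _).
  apply/seteqP; split => om /= h i; first by rewrite -YnE; apply: h.
  by move=> iq; have := h (Ordinal iq); rewrite -YnE.
have sumE : \sum_(l <- lam) l ^+ 2 = \sum_(0 <= i < q) lam`_i ^+ 2.
  by rewrite (big_nth 0) size_tuple.
have sum2E : \sum_(l <- behead lam) l ^+ 2 = \sum_(1 <= i < q) lam`_i ^+ 2.
  rewrite (big_nth 0) size_behead size_tuple big_add1 big_nat [RHS]big_nat.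
  by apply: eq_bigr => i _; rewrite nth_behead.
rewrite sumE sum2E in hM *.
have tailE om : tail_sum q Yn (fun i => lam`_i) 0 om = quadform A (Y om).
  by rewrite hU /tail_sum big_mkord; apply: eq_bigr => i _; rewrite YnE.
(* The kernel of width e requires e > 0; for e = 0 the half-open window is empty. *)
have [->|en0] := eqVneq e 0.
  rewrite (_ : [set _ | _] = set0) ?measure0 ?mulr0 ?mul0r//.
  by apply/seteqP; split => // om /=; rewrite addr0; lra.
have ep : 0 < e by rewrite lt_neqAle eq_sym en0.
have := tail_sum_anti_concentration mYn gYn spectrum_psd_ge0 spectrum_psd_anti (- u) q1 ep hM.
move=> h; apply: fine_probability_le => //; apply: le_trans h.
apply: le_measure; rewrite ?inE//.
  have m1 : measurable_fun setT (fun om => `|quadform A (Y om) - u|).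
    by apply: measurableT_comp => //; apply: measurable_funB => //;
      exact: measurable_quadform_coords.
  have := measurable_itv_preimage `]-oo, e] m1; congr measurable.
  by apply/seteqP; split => om /=; rewrite tailE in_itv.
move=> om /= /andP[h1 h2]; rewrite tailE ger0_norm; lra.
Qed.

End gaussian_quadratic_form.

Section random_vectors.
Context {R : realType} d (T : measurableType d) (Pr : probability T R) (q : nat).
Variable Y : {RV Pr >-> borelV R q}.

(** Continuity is available on [Th] only, so the event is the complement of the preimage of an open
    subset of [Th]. *)
Lemma measurable_ge_open_continuous (Th : set 'cV[R]_q) (f : 'cV[R]_q -> R) (t : R) :
  open Th -> (forall th, Th th -> {for th, continuous f}) -> (forall om, Th (Y om)) ->
  measurable [set om | t <= f (Y om)].
Proof.
move=> oTh cf YTh; pose U := [set th | Th th /\ f th < t].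
have oU : open U.
  rewrite openE => th [Tth fth]; rewrite /interior.
  have n1 : nbhs th Th by exact: open_nbhs_nbhs.
  have n2 : \forall x \near th, f x < t by exact: (cvgr_lt _ (cf _ Tth)).
  by near=> x; split; near: x.
have mU : measurable ((Y : T -> borelV R q) @^-1` U).
  rewrite -[X in measurable X]setTI; apply: measurable_funP => //.
  exact: sub_sigma_algebra.
have -> : [set om | t <= f (Y om)] = ~` (Y @^-1` U).
  apply/seteqP; split => om /=; first by move=> tf [_]; rewrite ltNge tf.
  by move=> h; rewrite leNgt; apply/negP => ft; apply: h.
exact: measurableC.
Unshelve. all: by end_near.
Qed.

Lemma measurable_quadform_affine (B : 'M[R]_q) (a : R) (b : 'cV[R]_q) :
  measurable_fun setT (fun om => quadform B (a *: (Y om - b))).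
Proof.
have c : continuous (fun x : 'cV[R]_q => quadform B (a *: (x - b))).
  rewrite (_ : (fun x => _) = fun x : 'cV[R]_q => \sum_i \sum_j
      a * (x i 0 - b i 0) * B i j * (a * (x j 0 - b j 0))); last first.
    apply/funext => x; rewrite quadformE; apply: eq_bigr => i _.
    by apply: eq_bigr => j _; rewrite !mxE.
  apply: continuous_sumr => i; apply: continuous_sumr => j x.
  have ck k : {for x, continuous (fun x : 'cV[R]_q => a * (x k 0 - b k 0))}.
    apply: continuousM; first exact: cst_continuous.
    by apply: continuousB; [exact: coord_continuous|exact: cst_continuous].
  have ci : {for x, continuous (fun x : 'cV[R]_q => a * (x i 0 - b i 0) * B i j)}.
    by apply: continuousM; [exact: ck|exact: cst_continuous].
  exact: (@continuousM R _ (fun x : 'cV[R]_q => a * (x i 0 - b i 0) * B i j)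
    (fun x : 'cV[R]_q => a * (x j 0 - b j 0)) x ci (ck j)).
exact: (measurableT_comp (continuous_borelV_measurable c) (@measurable_funP _ _ _ _ setT Y)).
Qed.
End random_vectors.

Section gaussian_tails.
Context {R : realType} d (T : measurableType d) (Pr : probability T R).
Variables (q : nat) (Y : T -> 'cV[R]_q) (M : 'M[R]_q).
Hypothesis q0 : (0 < q)%N.
Hypothesis mY : measurable_coords Y.
Hypothesis gY : std_gaussian Pr Y.

Let mN : measurable_fun setT (fun om => enorm (Y om) ^+ 2).
Proof.
under eq_fun do rewrite -quadform1.
exact: measurable_quadform_coords.
Qed.

Let mMN : measurable_fun setT (fun om => enorm (M *m Y om) ^+ 2).
Proof.
under eq_fun do rewrite -quadform1.
exact: (measurable_quadform_coords (measurable_coords_mul M mY)).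
Qed.

Let tail_le (E : set T) u : measurable E -> 
  (forall om, E om -> q%:R * u <= enorm (Y om) ^+ 2) ->
  fine (Pr E) <= q%:R * (Num.sqrt 2 * expR (- (u / 4))).
Proof.
move=> mE hE; apply: fine_probability_le => //.
apply: le_trans (std_gaussian_norm_tail u q0 mY gY).
by apply: le_measure; rewrite ?inE//; exact: measurable_ge.
Qed.

(** The radius amounts to u = 4 ln n in [std_gaussian_norm_tail], so that exp (- u / 4) = 1 / n;
    this is then weakened to 1 / sqrt n. *)
Lemma gaussian_opnorm_tail n : (0 < n)%N ->
  fine (Pr [set om | (opnorm M * Num.sqrt (4 * q%:R * ln n%:R)) ^+ 2 < enorm (M *m Y om) ^+ 2])
  <= Num.sqrt 2 * (q%:R / Num.sqrt n%:R).
Proof.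
move=> n0; have n1 : 1 <= n%:R :> R by rewrite ler1n.
have l0 : 0 <= ln n%:R :> R by exact: ln_ge0.
apply: (@le_trans _ _ (q%:R * (Num.sqrt 2 * expR (- (4 * ln n%:R / 4))))).
  apply: tail_le => [|om /=]; first exact: measurable_gt.
  rewrite exprMn sqr_sqrtr ?mulr_ge0// => h.
  have : opnorm M ^+ 2 * (4 * q%:R * ln n%:R) < opnorm M ^+ 2 * enorm (Y om) ^+ 2.
    apply: lt_le_trans h _; rewrite -exprMn ler_pXn2r ?nnegrE ?mulr_ge0 ?enorm_ge0 ?opnorm_ge0//.
    exact: enorm_mul_le.
  (* For M = 0 the radius is 0, and it is the strict inequality that empties the event. *)
  have [->|M0] := eqVneq (opnorm M) 0; first by rewrite expr0n/= !mul0r ltxx.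
  have Mp : 0 < opnorm M ^+ 2 by rewrite exprn_even_gt0.
  by rewrite ltr_pM2l// => /ltW; rewrite mulrCA mulrA.
rewrite [4 * _]mulrC mulfK ?pnatr_eq0// expRN lnK ?posrE ?ltr0n// mulrCA.
rewrite ler_wpM2l ?sqrtr_ge0// ler_wpM2l//.
rewrite lef_pV2 ?posrE ?sqrtr_gt0 ?ltr0n//.
rewrite -[leRHS]sqr_sqrtr ?ler0n// expr2 ler_peMr ?sqrtr_ge0//.
by rewrite -{1}sqrtr1 ler_sqrt ?ler0n.
Qed.

(** |M Y|^2 <= k^2 q |Y|^2 turns the event into |Y|^2 >= q v^2 with v = sqrt n rho / (k q). The
    bound exp (- v^2 / 4) <= 1 / v supplies one factor q, the union bound the other. *)
Lemma gaussian_frobenius_tail n (k rho : R) : (0 < n)%N -> 0 < k -> 0 < rho ->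
  sqr_frobenius M <= k ^+ 2 * q%:R ->
  fine (Pr [set om | (Num.sqrt n%:R * rho) ^+ 2 <= enorm (M *m Y om) ^+ 2])
  <= Num.sqrt 2 * (k / rho) * (q%:R ^+ 2 / Num.sqrt n%:R).
Proof.
move=> n0 k0 rho0 FM; have np : 0 < n%:R :> R by rewrite ltr0n.
have qp : 0 < q%:R :> R by rewrite ltr0n.
have kq : 0 < k ^+ 2 * q%:R by rewrite mulr_gt0 ?exprn_gt0.
pose v : R := Num.sqrt n%:R * rho / (k * q%:R).
have v0 : 0 < v by rewrite divr_gt0 ?mulr_gt0 ?sqrtr_gt0.
apply: (@le_trans _ _ (q%:R * (Num.sqrt 2 * expR (- (v ^+ 2 / 4))))).
  apply: tail_le => [|om /= h]; first exact: measurable_ge.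
  rewrite -(ler_pM2l kq) (_ : k ^+ 2 * q%:R * (q%:R * v ^+ 2) = (Num.sqrt n%:R * rho) ^+ 2).
    apply: le_trans h _; apply: le_trans (sqr_enorm_mul_le _ _) _.
    by rewrite ler_wpM2r ?sqr_ge0.
  by rewrite /v; field; rewrite !gt_eqF.
have := expR_quarter_le (exprn_gt0 2 v0); rewrite sqrtr_sqr gtr0_norm// => h.
apply: (@le_trans _ _ (q%:R * (Num.sqrt 2 * v^-1))).
  by rewrite ler_wpM2l// ler_wpM2l ?sqrtr_ge0.
rewrite le_eqVlt; apply/orP; left; apply/eqP; rewrite /v.
by field; rewrite !gt_eqF ?sqrtr_gt0.
Qed.

End gaussian_tails.

Section regret.
Context {R : realType} {p q d : nat} (S : eto_problem R p q d) (L1 : R).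
Hypothesis oT : open (Theta S).
Hypothesis TK : Theta S (thetaKL S).
Hypothesis lip : lipschitz_hessian S L1.

(** The open set [Theta] contains two distinct points, and the Lipschitz inequality between them
    forces the sign. *)
Lemma lipschitz_hessian_ge0 : (0 < q)%N -> 0 <= L1.
Proof.
move=> q0; have /nbhs_ballP[r r0 br] : nbhs (thetaKL S) (Theta S) by exact: open_nbhs_nbhs.
pose v : 'cV[R]_q := (r / 2) *: delta_mx (Ordinal q0) 0.
have r2 : 0 < r / 2 by rewrite divr_gt0.
have nv : enorm v = r / 2 by rewrite enormZ enorm_delta mulr1 gtr0_norm.
have Tv : Theta S (thetaKL S + v).
  apply: br; rewrite -ball_normE /ball_/= opprD addNKr normrN.
  apply: le_lt_trans (ler_enorm _) _; rewrite nv ltr_pdivrMr// mulr_natr mulr2n.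
  by rewrite ltrDl.
have e : thetaKL S + v - thetaKL S = v by rewrite addrAC subrr add0r.
have [_ _ /(_ _ _ Tv TK)] := lip; rewrite e nv => /(le_trans (opnorm_ge0 _)).
by rewrite pmulr_lge0.
Qed.

Lemma linearized_regret_approx rho th : 0 <= L1 ->
  star_within (Theta S) (thetaKL S) rho -> Theta S th ->
  enorm (th - thetaKL S) < rho ->
  `|linearized_regret S th
    - 2^-1 * quadform (hess (v0w S) (thetaKL S)) (th - thetaKL S)|
  <= L1 * enorm (th - thetaKL S) ^+ 3.
Proof.
move=> L10 star Tth near; have [_ td Lip] := lip.
have Ts (s : R) : s \in `[0, 1] -> Theta S (thetaKL S + s *: (th - thetaKL S)).
  by rewrite in_itv/=; exact: star.
have := @taylor_lipschitz_hess _ _ (v0w S) (thetaKL S) (th - thetaKL S) L1 L10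
  (fun s s01 => td _ (Ts s s01)).
rewrite [thetaKL S + _]addrC subrK /linearized_regret; apply => s s01.
apply: le_trans (Lip _ _ (Ts s s01) TK) _.
by rewrite [thetaKL S + _]addrC addrK.
Qed.

Lemma continuous_linearized_regret (n : R) th : Theta S th ->
  {for th, continuous (fun th => n * linearized_regret S th)}.
Proof.
move=> Tth; have [_ td _] := lip.
have [/nbhs_singleton df _] := td _ Tth.
have c1 : {for th, continuous (v0w S)} by exact: differentiable_continuous.
have c2 : continuous (fun th : 'cV[R]_q => (grad (v0w S) (thetaKL S) *m (th - thetaKL S)) 0 0).
  rewrite (_ : (fun th => _) = fun th : 'cV[R]_q =>
     \sum_j grad (v0w S) (thetaKL S) 0 j * (th j 0 - thetaKL S j 0)); last first.
    by apply/funext => x; rewrite mxE; apply: eq_bigr => j _; rewrite !mxE.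
  apply: continuous_sumr => j x.
  suff : {for x, continuous (fun y : 'cV[R]_q =>
      grad (v0w S) (thetaKL S) 0 j * (y j 0 - thetaKL S j 0))} by [].
  apply: continuousM; first exact: cst_continuous.
  by apply: continuousB; [exact: coord_continuous|exact: cst_continuous].
have c3 : {for th, continuous (fun th => linearized_regret S th)}.
  apply: (@continuousB _ _ _ (fun th => v0w S th - v0w S (thetaKL S))); last exact: c2.
  by apply: (@continuousB _ _ _ (v0w S) (cst (v0w S (thetaKL S)))) => //; exact: cst_continuous.
apply: (@continuousM _ _ (cst n) (fun th => linearized_regret S th)) => //.
exact: cst_continuous.
Qed.

End regret.

(** * Powers of n and q in the error terms *)

Section rates.
Context {R : realType}.

Lemma powR_exp (x a : R) n : 0 <= x -> (x `^ a) ^+ n = x `^ (a * n%:R).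
Proof. by move=> x0; rewrite powRrM powR_mulrn// powR_ge0. Qed.

Lemma sqrt_cube (x : R) : 0 <= x -> Num.sqrt x ^+ 3 = x `^ (3 / 2).
Proof. by move=> x0; rewrite -powR12_sqrt// powR_exp// mulrC. Qed.

Lemma powR_inv_sqrt (x : R) : 0 <= x -> x `^ (- 2^-1) = (Num.sqrt x)^-1.
Proof. by move=> x0; rewrite powRN powR12_sqrt. Qed.

(** The exponent 2 is below 9/4; the Gaussian tails carry no factor C, whence the C^-1. *)
Lemma sqr_div_sqrt_le_BE_rate (C : R) n q : 0 < C -> (0 < q)%N ->
  q%:R ^+ 2 / Num.sqrt n%:R <= C^-1 * BE_rate C n q.
Proof.
move=> C0 q0; rewrite /BE_rate -mulrA mulKf ?gt_eqF// powR_inv_sqrt//.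
rewrite ler_wpM2r ?invr_ge0 ?sqrtr_ge0//.
rewrite -powR_mulrn// ler_powR ?ler1n//; lra.
Qed.

Lemma BE_rate_ge0 (C : R) n q : 0 < C -> 0 <= BE_rate C n q.
Proof. by move=> C0; rewrite !mulr_ge0 ?powR_ge0// ltW. Qed.

Lemma cubic_error (L M : R) q n : 0 <= M -> (0 < n)%N ->
  L * (M * Num.sqrt (4 * q%:R * ln n%:R)) ^+ 3 / Num.sqrt n%:R =
  8 * (L * M ^+ 3 * q%:R `^ (3 / 2) * ln n%:R `^ (3 / 2) * n%:R `^ (- 2^-1)).
Proof.
move=> M0 n0; have l0 : 0 <= ln n%:R :> R by rewrite ln_ge0// ler1n.
have s4 : Num.sqrt 4 = 2 :> R.
  by rewrite (_ : 4 = 2 ^+ 2) ?sqrtr_sqr ?ger0_norm// -natrX.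
rewrite sqrtrM ?mulr_ge0// (@sqrtrM _ 4)// s4 -!sqrt_cube// powR_inv_sqrt//.
by field; rewrite gt_eqF ?sqrtr_gt0 ?ltr0n.
Qed.

(** The square root halves every exponent, which is where n^(-1/4) and (ln n)^(3/4) come from when q
    = 1; the constant is sqrt 8 <= 3. *)
Lemma sqrt_cubic_error (L M lam : R) n : 0 <= L -> 0 <= M -> 0 < lam -> (0 < n)%N ->
  Num.sqrt (8 * (L * M ^+ 3 * 1%:R `^ (3 / 2) * ln n%:R `^ (3 / 2) * n%:R `^ (- 2^-1)) / lam)
  <= 3 * ((Num.sqrt lam)^-1 * L `^ (2^-1) * M `^ (3 / 2) * (ln n%:R) `^ (3 / 4)
     * n%:R `^ (- 4^-1)).
Proof.
move=> L0 M0 lam0 n0; have l0 : 0 <= ln n%:R :> R by rewrite ln_ge0// ler1n.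
set t := (X in _ <= 3 * X).
have t0 : 0 <= t by rewrite !mulr_ge0 ?powR_ge0 ?invr_ge0 ?sqrtr_ge0.
have tE : t ^+ 2 = L * M ^+ 3 * 1%:R `^ (3 / 2) * ln n%:R `^ (3 / 2) * n%:R `^ (- 2^-1) / lam.
  rewrite /t !exprMn exprVn sqr_sqrtr ?(ltW lam0)// !powR_exp// powR1.
  rewrite mulVf ?pnatr_eq0// powRr1// (_ : 3 / 2 * 2 = 3); last by lra.
  rewrite (powR_mulrn 3)// (_ : 3 / 4 * 2 = 3 / 2); last by lra.
  rewrite (_ : - 4^-1 * 2 = - 2^-1); last by lra.
  by field; rewrite gt_eqF.
apply: (@le_trans _ _ (Num.sqrt ((3 * t) ^+ 2))); last first.
  by rewrite sqrtr_sqr ger0_norm// mulr_ge0.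
rewrite -mulrA -tE; clearbody t; rewrite ler_sqrt ?sqr_ge0// exprMn.
by have := sqr_ge0 t; lra.
Qed.

End rates.

Section regret_gap.
Context {R : realType} {p q d : nat} (S : eto_problem R p q d).
Context dT (T : measurableType dT) (Pr : probability T R) (th : {RV Pr >-> borelV R q}).
Context dY (TY : measurableType dY) (PrY : probability TY R) (Y0 : {RV PrY >-> borelV R q}).
Variables (M1 : 'M[R]_q) (L1 rho k b w : R) (n : nat).
Local Notation H := (hess (v0w S) (thetaKL S)).
Local Notation A := (2^-1 *: (M1 *m H *m M1)).
Hypothesis q0 : (0 < q)%N.
Hypothesis n0 : (0 < n)%N.
Hypothesis rho0 : 0 < rho.
Hypothesis k0 : 0 < k.
Hypothesis oT : open (Theta S).
Hypothesis TK : Theta S (thetaKL S).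
Hypothesis lip : lipschitz_hessian S L1.
Hypothesis star : star_within (Theta S) (thetaKL S) rho.
Hypothesis Tth : forall om, Theta S (th om).
Hypothesis psdH : psdmx H.
Hypothesis gY : std_gaussian PrY Y0.
Hypothesis symM : M1^T = M1.
Hypothesis frobM : sqr_frobenius M1 <= k ^+ 2 * q%:R.
Hypothesis close : forall B : set 'cV[R]_q,
  convex_set B -> measurable (B : set (borelV R q)) ->
  `|fine (Pr [set om | B (Num.sqrt n%:R *: (th om - thetaKL S))])
    - fine (PrY [set om | B (M1 *m Y0 om)])| <= b.
Let r := opnorm M1 * Num.sqrt (4 * q%:R * ln n%:R).
Let e := L1 * r ^+ 3 / Num.sqrt n%:R.
Hypothesis window : forall u,
  fine (PrY [set om | u <= quadform A (Y0 om) < u + e]) <= w.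

Let quadformZ m (a : R) (B : 'M[R]_m) x : quadform (a *: B) x = a * quadform B x.
Proof. by rewrite /quadform -scalemxAr -scalemxAl mxE. Qed.

Let quadform_scale m (a : R) (B : 'M[R]_m) x : quadform B (a *: x) = a ^+ 2 * quadform B x.
Proof.
rewrite !quadformE mulr_sumr; apply: eq_bigr => i _; rewrite mulr_sumr.
by apply: eq_bigr => j _; rewrite !mxE; ring.
Qed.

Lemma G_formE y : G_form S M1 y = quadform A y.
Proof. by rewrite quadformZ /G_form /quadform !mulmxA. Qed.

Lemma quadform_congr y : quadform A y = quadform (2^-1 *: H) (M1 *m y).
Proof. by rewrite !quadformZ /quadform trmx_mul symM !mulmxA. Qed.

Lemma psdmx_half_congr : psdmx A.
Proof.
split; last first.
  move=> x; rewrite -/(quadform A x) quadform_congr quadformZ mulr_ge0 ?invr_ge0//.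
  exact: psdH.2.
by rewrite linearZ/= !trmx_mul symM psdH.1 mulmxA.
Qed.

Lemma regret_gap t :
  `|fine (Pr [set om | t <= n%:R * linearized_regret S (th om)])
    - fine (PrY [set om | t <= G_form S M1 (Y0 om)])|
  <= 3 * b + w + Num.sqrt 2 * (q%:R / Num.sqrt n%:R)
     + Num.sqrt 2 * (k / rho) * (q%:R ^+ 2 / Num.sqrt n%:R).
Proof.
have np : 0 < n%:R :> R by rewrite ltr0n.
have sn : 0 < Num.sqrt n%:R :> R by rewrite sqrtr_gt0.
have sn2 : Num.sqrt n%:R ^+ 2 = n%:R :> R by rewrite sqr_sqrtr ?ler0n.
have L0 := lipschitz_hessian_ge0 oT TK lip q0.
have mY0 := measurable_coords_RV Y0.
have mL : measurable [set om | t <= n%:R * linearized_regret S (th om)].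
  apply: (@measurable_ge_open_continuous _ _ _ _ _ th (Theta S)
    (fun x => n%:R * linearized_regret S x)) => // x Tx.
  exact: (continuous_linearized_regret lip).
have r0 : 0 <= r by rewrite mulr_ge0 ?opnorm_ge0 ?sqrtr_ge0.
have psdh : psd_quadform (2^-1 *: H).
  by move=> x; rewrite quadformZ mulr_ge0 ?invr_ge0//; exact: psdH.2.
have LX om : enorm (Num.sqrt n%:R *: (th om - thetaKL S)) <= r ->
    enorm (Num.sqrt n%:R *: (th om - thetaKL S)) < Num.sqrt n%:R * rho ->
    `|n%:R * linearized_regret S (th om) -
      quadform (2^-1 *: H) (Num.sqrt n%:R *: (th om - thetaKL S))| <= e.
  rewrite enormZ gtr0_norm// ltr_pM2l// => hr hrho.
  have := linearized_regret_approx TK lip L0 star (Tth om) hrho.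
  set l := linearized_regret _ _; set delta := th om - _ in hr *.
  have -> : quadform (2^-1 *: H) (Num.sqrt n%:R *: delta) =
      n%:R * (2^-1 * quadform H delta).
    by rewrite quadformZ quadform_scale sn2 mulrCA.
  rewrite -mulrBr normrM gtr0_norm// -(ler_pM2l np) => /le_trans; apply.
  (* n L1 |delta|^3 equals L1 (sqrt n |delta|)^3 / sqrt n, and sqrt n |delta| is at most r. *)
  rewrite /e ler_pdivlMr// -[X in X * (L1 * _)]sn2.
  rewrite [leLHS](_ : _ = L1 * (Num.sqrt n%:R * enorm delta) ^+ 3); last by ring.
  have hx : 0 <= Num.sqrt n%:R * enorm delta by rewrite mulr_ge0 ?enorm_ge0 ?sqrtr_ge0.
  by apply: ler_wpM2l => //; apply: lerXn2r.
have mMY B : measurable_fun setT (fun om => quadform B (M1 *m Y0 om)).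
  exact: (measurable_quadform_coords (measurable_coords_mul M1 mY0)).
have win u : fine (PrY [set om | u <= quadform (2^-1 *: H) (M1 *m Y0 om) < u + e]) <= w.
  have := window u; congr (fine (PrY _) <= _).
  by apply/seteqP; split => om /=; rewrite quadform_congr.
have mX B := measurable_quadform_affine th B (Num.sqrt n%:R) (thetaKL S).
have s0 : 0 <= Num.sqrt n%:R * rho by rewrite mulr_ge0 ?ltW.
have := quadratic_comparison psdh mX mMY close r0 s0 LX win mL.
have -> : [set om | t <= quadform (2^-1 *: H) (M1 *m Y0 om)] =
    [set om | t <= G_form S M1 (Y0 om)].
  by apply/seteqP; split => om /=; rewrite G_formE quadform_congr.
move=> /le_trans; apply.
rewrite -addrA -[leRHS]addrA lerD2l; apply: lerD.
  exact: gaussian_opnorm_tail.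
exact: gaussian_frobenius_tail.
Qed.

End regret_gap.

Theorem proposition2 (R : realType)
  (* fixed before n, q and the problem; K may depend on them *)
  (mu c1 c2 c3 c4 ulam1 ulam2 C rho : R)
  (hmu : 0 < mu) (hc1 : 0 < c1) (hc2 : 0 < c2) (hc3 : 0 <= c3) (hc4 : 0 < c4)
  (hulam1 : 0 < ulam1) (hulam2 : 0 < ulam2) (hC : 0 < C) (hrho : 0 < rho) :
  exists K : R, 0 < K /\
  forall (p q d : nat) (S : eto_problem R p q d)
    (dT : measure_display) (T : measurableType dT) (Pr : probability T R)
    (Z : nat -> {RV Pr >-> borelV R d}) (that : nat -> {RV Pr >-> borelV R q})
    (dY : measure_display) (TY : measurableType dY) (PrY : probability TY R)
    (Y0 : {RV PrY >-> borelV R q})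
    (M1 : 'M[R]_q) (lam : q.-tuple R) (L1 : R),
    (0 < q)%N ->
    eto_setting S ->
    (forall i om, Zset S (Z i om)) ->
    iid_from Pr Z (Ptrue S) ->
    is_mle S Z that ->
    lipschitz_hessian S L1 ->
    eto_consistency S Pr Z ->
    eto_regularity S mu c1 c2 c3 c4 ulam1 ulam2 ->
    star_within (Theta S) (thetaKL S) rho ->
    psdmx (hess (v0w S) (thetaKL S)) ->
    std_gaussian PrY Y0 ->
    is_M1 S M1 ->
    berry_esseen S Pr that PrY Y0 M1 C ->
    is_spectrum (2^-1 *: (M1 *m hess (v0w S) (thetaKL S) *m M1)) lam ->
    (q = 1%N -> lam`_0 != 0) ->
    ((2 <= q)%N ->
       (\sum_(l <- lam) l ^+ 2) * (\sum_(l <- behead lam) l ^+ 2) != 0) ->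
    exists D : nat -> R, forall n : nat, (0 < n)%N ->
      [/\ forall t : R, 0 < t ->
            `|fine (Pr [set om | t <= n%:R * linearized_regret S (that n om)])
              - fine (PrY [set om | t <= G_form S M1 (Y0 om)])| <= K * D n,
          q = 1%N ->
            D n <= K * ((Num.sqrt lam`_0)^-1 * L1 `^ (2^-1)
                          * opnorm M1 `^ (3 / 2)
                          * (ln n%:R) `^ (3 / 4) * n%:R `^ (- 4^-1)
                        + BE_rate C n q)
        & (2 <= q)%N ->
            D n <= K * (BE_rate C n q
                        + ((\sum_(l <- lam) l ^+ 2)
                             * (\sum_(l <- behead lam) l ^+ 2)) `^ (- 4^-1)
                          * L1 * opnorm M1 ^+ 3 * q%:R `^ (3 / 2)
                          * (ln n%:R) `^ (3 / 2) * n%:R `^ (- 2^-1))].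
Proof.
pose k : R := c4 / mu.
have k0 : 0 < k by rewrite divr_gt0.
pose c5 : R := Num.sqrt 2 + Num.sqrt 2 * (k / rho).
have kr0 : 0 < k / rho by rewrite divr_gt0.
have c50 : 0 <= c5 by rewrite addr_ge0 ?sqrtr_ge0// mulr_ge0 ?sqrtr_ge0// ltW.
have p0 : 0 < pi :> R by exact: pi_gt0.
(* 3 counts the Berry-Esseen comparisons and c5 / C pays for the two Gaussian tails. The window
   costs 6 = 2 * 3 for q = 1 and 48 pi = 6 pi * 8 for q >= 2, where 8 is the factor in
   [cubic_error]. *)
pose K : R := 3 + c5 * C^-1 + 6 + 48 * pi.
have cC0 : 0 <= c5 * C^-1 by rewrite mulr_ge0// invr_ge0 ltW.
have K1 : 1 <= K by rewrite /K; move: (@pi R) p0 => p p0; lra.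
have K0 : 0 < K by exact: lt_le_trans K1.
exists K; split=> // p q d S dT T Pr Z that dY TY PrY Y0 M1 lam L1 q0 set_ _ _
  mle lip _ reg star psdH gY isM be spec l0 lM.
have [[_ oT _ _] _ _ _ [_ TK _]] := set_.
have sM : M1^T = M1 by have [[]] := isM.
have frobM : sqr_frobenius M1 <= k ^+ 2 * q%:R.
  apply: le_trans (sqr_frobenius_M1_le q0 hmu hc4 set_ reg isM) _.
  by rewrite /k expr_div_n exprVn le_eqVlt; apply/orP; left; apply/eqP; ring.
have L0 := lipschitz_hessian_ge0 oT TK lip q0.
have M0 := opnorm_ge0 M1.
have mY0 := measurable_coords_RV Y0.
have psdA := psdmx_half_congr psdH sM.
pose X1 n : R := (Num.sqrt lam`_0)^-1 * L1 `^ (2^-1) * opnorm M1 `^ (3 / 2)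
  * (ln n%:R) `^ (3 / 4) * n%:R `^ (- 4^-1).
pose m4 : R := ((\sum_(l <- lam) l ^+ 2) * (\sum_(l <- behead lam) l ^+ 2)) `^ (- 4^-1).
pose X2 n : R := m4 * L1 * opnorm M1 ^+ 3 * q%:R `^ (3 / 2)
  * (ln n%:R) `^ (3 / 2) * n%:R `^ (- 2^-1).
have X10 n : 0 <= X1 n by rewrite !mulr_ge0 ?powR_ge0 ?invr_ge0 ?sqrtr_ge0.
have X20 n : 0 <= X2 n by rewrite !mulr_ge0 ?powR_ge0 ?exprn_ge0.
(* D is the claimed rate itself, so its two upper bounds only need K >= 1. *)
exists (fun n => if q == 1%N then X1 n + BE_rate C n q else BE_rate C n q + X2 n).
move=> n n0; have B0 := BE_rate_ge0 n q hC.
split; first last.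
- move=> q2; rewrite gtn_eqF//.
  by apply: ler_peMl; rewrite ?addr_ge0// X20.
- move=> /eqP ->.
  by apply: ler_peMl; rewrite ?addr_ge0// X10.
move=> t _.
set D := (X in _ <= K * X).
have BD : BE_rate C n q <= D by rewrite /D; case: ifP => _; rewrite ?lerDl ?lerDr.
(* Common to both ranges of q: the window is charged to D minus its Berry-Esseen part, everything
   else to that part. *)
have gap w : (forall u, fine (PrY [set om | u <=
    quadform (2^-1 *: (M1 *m hess (v0w S) (thetaKL S) *m M1)) (Y0 om) <
    u + L1 * (opnorm M1 * Num.sqrt (4 * q%:R * ln n%:R)) ^+ 3 / Num.sqrt n%:R]) <= w) ->
  w <= (6 + 48 * pi) * (D - BE_rate C n q) -> 
  `|fine (Pr [set om | t <= n%:R * linearized_regret S (that n om)])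
    - fine (PrY [set om | t <= G_form S M1 (Y0 om)])| <= K * D.
  move=> win wD.
  have Tth om : Theta S (that n om) by have [] := mle n om n0.
  have close B : convex_set B -> measurable (B : set (borelV R q)) ->
      `|fine (Pr [set om | B (Num.sqrt n%:R *: (that n om - thetaKL S))])
        - fine (PrY [set om | B (M1 *m Y0 om)])| <= BE_rate C n q.
    exact: be.
  have := regret_gap q0 n0 hrho k0 oT TK lip star Tth psdH gY sM frobM close win t.
  move=> /le_trans; apply.
  have h2 := sqr_div_sqrt_le_BE_rate n hC q0.
  have h1 : q%:R / Num.sqrt n%:R <= q%:R ^+ 2 / Num.sqrt n%:R :> R.
    by rewrite ler_wpM2r ?invr_ge0 ?sqrtr_ge0// expr2 ler_peMl// ler1n.
  set s1 := q%:R / _ in h1 *; set s2 := q%:R ^+ 2 / _ in h1 h2 *.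
  have h3 : Num.sqrt 2 * s1 <= Num.sqrt 2 * s2 by rewrite ler_wpM2l ?sqrtr_ge0.
  have h4 : c5 * s2 <= c5 * C^-1 * BE_rate C n q by rewrite -mulrA ler_wpM2l.
  have h5 : (3 + c5 * C^-1) * BE_rate C n q <= (3 + c5 * C^-1) * D.
    by rewrite ler_wpM2l// addr_ge0.
  have h6 : (6 + 48 * pi) * (D - BE_rate C n q) <= (6 + 48 * pi) * D.
    by rewrite ler_wpM2l ?addr_ge0 ?mulr_ge0 ?pi_ge0// lerBlDr lerDl.
  have -> : K * D = (3 + c5 * C^-1) * D + (6 + 48 * pi) * D by rewrite /K; ring.
  have e5 : c5 * s2 = Num.sqrt 2 * s2 + Num.sqrt 2 * (k / rho) * s2 by rewrite /c5 mulrDl.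
  rewrite mulrDl in h5.
  lra.
have [q2|q1] := ltnP 1 q; last first.
  have {}q1 : q = 1%N by apply/eqP; rewrite eqn_leq q1.
  apply: (gap (6 * X1 n)).
    move=> u; apply: le_trans (quadform_window1 mY0 gY psdA spec u q1 _ (l0 q1)) _.
      by rewrite divr_ge0 ?mulr_ge0 ?exprn_ge0 ?mulr_ge0 ?sqrtr_ge0.
    have q1E : q%:R = 1%:R :> R by rewrite q1.
    have lp : 0 < lam`_0 by rewrite lt_neqAle eq_sym (l0 q1) (spectrum_psd_ge0 psdA spec).
    have := sqrt_cubic_error L0 M0 lp n0; rewrite cubic_error// q1E -/(X1 n); lra.
  have q1b : q == 1%N by rewrite q1.
  by rewrite /D q1b addrK ler_wpM2r// lerDl mulr_ge0// pi_ge0.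
have q1b : (q == 1%N) = false by rewrite gtn_eqF.
apply: (gap (48 * pi * X2 n)).
  move=> u; apply: le_trans (quadform_window2 mY0 gY psdA spec u q2 _ (lM q2)) _.
    by rewrite divr_ge0 ?mulr_ge0 ?exprn_ge0 ?mulr_ge0 ?sqrtr_ge0.
  rewrite cubic_error// /X2 -/m4 le_eqVlt; apply/orP; left; apply/eqP.
  by move: (@pi R) => p'; ring.
by rewrite /D q1b [BE_rate _ _ _ + _]addrC addrK ler_wpM2r// lerDr.
Qed.
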